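(* Let $q\in[1,\infty)$ and $u\in L^q(S)$. Then $\lim_{t\to\infty}T(t)u=\overline{(u)}_S$ in $L^q(S)$.
   Context: Setting. Let $n\in\mathbb{N}$, $n\ge 2$; let $\emptyset\ne S\subseteq\mathbb{R}^n$ be open, connected, bounded and of class $C^1$; let $p\in(1,\infty)\setminus\{2\}$. Let $\lambda$ be Lebesgue measure and $|\cdot|$ the Euclidean norm. Let $\gamma:S\to(0,\infty)$ satisfy $\gamma\in L^\infty(S)$, $\gamma^{1/(1-p)}\in L^1(S)$, and assume there is a Muckenhoupt weight $\gamma_0\in A_p(\mathbb{R}^n)$ with $\gamma_0|_S=\gamma$ a.e. on $S$. Here $A_p(\mathbb{R}^n)$ is the set of $\gamma_0:\mathbb{R}^n\to\mathbb{R}$ with $\gamma_0>0$ a.e., $\gamma_0\in L^1_{\mathrm{loc}}(\mathbb{R}^n)$ and $\sup_B \frac{1}{\lambda(B)}\int_B\gamma_0\,d\lambda\left(\frac{1}{\lambda(B)}\int_B\gamma_0^{1/(1-p)}d\lambda\right)^{p-1}<\infty$, the supremum over all balls $B\subseteq\mathbb{R}^n$. Let $\nu(B):=\int_B\gamma\,d\lambda$ and $W^{1,p}_\gamma(S):=\{f\in L^p(S): f \text{ weakly differentiable},\ \nabla f\in L^p(S,\nu;\mathbb{R}^n)\}$. Truncation and generalized gradient. For $k>0$, $\tau_k(s):=s$ if $|s|<k$ and $\tau_k(s):=k\,\mathrm{sign}(s)$ if $|s|\ge k$. If $f:S\to\mathbb{R}$ is measurable with $\tau_k(f)\in W^{1,1}_{\mathrm{loc}}(S)$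 for all $k>0$, then $\tilde\nabla f:S\to\mathbb{R}^n$ is the a.e. unique function with $\nabla\tau_k(f)=\tilde\nabla f\,\mathbf{1}_{\{|f|<k\}}$ a.e. for all $k>0$. Operators (identified with their graphs). $A\subseteq L^1(S)\times L^1(S)$: $(f,\hat f)\in A$ iff $f\in W^{1,p}_\gamma(S)\cap L^\infty(S)$, $\hat f\in L^1(S)$ and $\int_S\gamma|\nabla f|^{p-2}\nabla f\cdot\nabla\varphi\,d\lambda=\int_S\hat f\varphi\,d\lambda$ for all $\varphi\in W^{1,p}_\gamma(S)\cap L^\infty(S)$. $\mathcal{A}\subseteq L^1(S)\times L^1(S)$: $(f,\hat f)\in\mathcal{A}$ iff $f,\hat f\in L^1(S)$, $\tau_k(f)\in W^{1,p}_\gamma(S)$ for all $k>0$, and $\int_S\gamma|\tilde\nabla f|^{p-2}\tilde\nabla f\cdot\nabla(\tau_k(f-\varphi))\,d\lambda\le\int_S\hat f\,\tau_k(f-\varphi)\,d\lambda$ for all $k>0$ and $\varphi\in W^{1,p}_\gamma(S)\cap L^\infty(S)$. Semigroup. It is known (prior work) that $\mathcal{A}$ is completely accretive, m-accretive in $L^1(S)$ and the closure of $A$, that $D(A)$ is dense in $L^1(S)$, and that for each $u\in L^1(S)$ there is a unique strong solution (which is also the unique mild solution) $T(\cdot)u\in C([0,\infty);L^1(S))\cap W^{1,1}_{\mathrm{loc}}((0,\infty);L^1(S))$ of $0\in T'(t)u+\mathcal{A}T(t)u$, $T(t)u\in D(\mathcal{A})$ for a.e. $t>0$, $T(0)u=u$.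 Here $W^{1,1}_{\mathrm{loc}}((0,\infty);X)$ denotes the locally absolutely continuous, a.e. differentiable functions $(0,\infty)\to X$, and $T'(t)u$ is the a.e. derivative of $T(\cdot)u$. $(T(t))_{t\ge0}$ is this semigroup. (Complete accretivity of $\mathcal{A}$ means: for all $(f,\hat f),(h,\hat h)\in\mathcal{A}$, $\alpha>0$ and all convex lower semicontinuous $j:\mathbb{R}\to[0,\infty]$ with $j(0)=0$, $\int_S j(f-h)d\lambda\le\int_S j(f-h+\alpha(\hat f-\hat h))d\lambda$.) Average. $\overline{(u)}_S:=\frac{1}{\lambda(S)}\int_S u\,d\lambda$ for $u\in L^1(S)$, also viewed as a constant function on $S$. *)

(* Defs.v *)
From HB Require Import structures.
From mathcomp Require Import all_boot all_order all_algebra.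
From mathcomp Require Import all_classical all_reals all_analysis.

Set Implicit Arguments.
Unset Strict Implicit.
Unset Printing Implicit Defensive.

Import Order.TTheory GRing.Theory Num.Theory.
Import numFieldNormedType.Exports.

Local Open Scope classical_set_scope.
Local Open Scope ring_scope.

(* 'rV[R]_n carries the product sigma-algebra, i.e. the Borel one. This is the
   library's construction for n.-tuple R, repeated for row vectors because those
   also carry a topology. *)
Section measurable_rV.
Context (R : realType) (n : nat).

Let coord (i : 'I_n) (x : 'rV[R]_n) : R := x ord0 i.

Let rV_set0 : g_sigma_preimage coord set0.
Proof. exact: sigma_algebra0. Qed.

Let rV_setC A : g_sigma_preimage coord A -> g_sigma_preimage coord (~` A).
Proof. exact: sigma_algebraC. Qed.

Let rV_bigcup (F : (set 'rV[R]_n)^nat) :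
  (forall i, g_sigma_preimage coord (F i)) ->
  g_sigma_preimage coord (\bigcup_i (F i)).
Proof. exact: sigma_algebra_bigcup. Qed.

HB.instance Definition _ := @isMeasurable.Build
  (measure_tuple_display default_measure_display)
  'rV[R]_n (g_sigma_preimage coord) rV_set0 rV_setC rV_bigcup.

Lemma measurable_coord (i : 'I_n) :
  measurable_fun [set: 'rV[R]_n] (fun x => x ord0 i).
Proof.
move=> _ Y mY; rewrite setTI; apply: sub_sigma_algebra => /=.
rewrite -bigcup_seq/=; exists i => /=; first by rewrite mem_index_enum.
by exists Y => //; rewrite setTI.
Qed.

Lemma measurable_fun_rV d (T : measurableType d) (f : T -> 'rV[R]_n) :
  (forall i, measurable_fun [set: T] (fun x => f x ord0 i)) ->
  measurable_fun [set: T] f.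
Proof.
move=> mf; apply: (measurability
  (\big[setU/set0]_(i < n) preimage_set_system setT (coord i) measurable)) => //.
move=> _ [A + <-]; rewrite -bigcup_seq => -[i _ [B mB <-]].
by rewrite !setTI; have := mf i measurableT B mB; rewrite setTI.
Qed.

End measurable_rV.

Section lebesgue_measure_rV.
Context (R : realType).

Definition rV_cons n (z : measurableTypeR R * 'rV[R]_n) : 'rV[R]_n.+1 :=
  \row_i oapp (fun j => z.2 ord0 j) z.1 (unlift ord0 i).

Lemma measurable_rV_cons n : measurable_fun setT (@rV_cons n).
Proof.
apply: measurable_fun_rV => i; rewrite /rV_cons.
under eq_fun do rewrite mxE.
case: (unlift ord0 i) => [j|] /=; last exact: measurable_fst.
exact: (measurableT_comp (@measurable_coord R n j) measurable_snd).
Qed.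

Let rV_uncons n (x : 'rV[R]_n.+1) : measurableTypeR R * 'rV[R]_n :=
  (x ord0 ord0, \row_i x ord0 (lift ord0 i)).

Let rV_consK n : cancel (@rV_cons n) (@rV_uncons n).
Proof.
move=> [a x]; rewrite /rV_uncons !mxE unlift_none; congr pair.
by apply/rowP => i; rewrite !mxE liftK.
Qed.

Let measurable_rV_uncons n : measurable_fun setT (@rV_uncons n).
Proof.
apply/measurable_fun_pair; first exact: measurable_coord.
apply: measurable_fun_rV => i; under eq_fun do rewrite mxE.
exact: measurable_coord.
Qed.

Section step.
Context (n : nat) (mu : {sigma_finite_measure set 'rV[R]_n -> \bar R}).
Let m_cons := @measurable_rV_cons n.

Definition lebesgue_cons : set 'rV[R]_n.+1 -> \bar R :=
  pushforward (lebesgue_measure \x mu)%E (@rV_cons n).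

Let lebesgue_cons0 : lebesgue_cons set0 = 0%E.
Proof. exact: measure0. Qed.

Let lebesgue_cons_ge0 A : (0 <= lebesgue_cons A)%E.
Proof. exact: measure_ge0. Qed.

Let lebesgue_cons_sigma_additive : semi_sigma_additive lebesgue_cons.
Proof. exact: measure_semi_sigma_additive. Qed.

HB.instance Definition _ := isMeasure.Build _ _ _ lebesgue_cons
  lebesgue_cons0 lebesgue_cons_ge0 lebesgue_cons_sigma_additive.

Let lebesgue_cons_sigma_finite : sigma_finite setT lebesgue_cons.
Proof.
have /sigma_finiteP[F [FT ndF Foo]] := sigma_finiteT (@lebesgue_measure R).
have /sigma_finiteP[G [GT ndG Goo]] := sigma_finiteT mu.
exists (fun k => @rV_uncons n @^-1` (F k `*` G k)).
  rewrite -preimage_bigcup -[LHS](preimage_setT (@rV_uncons n)); congr (_ @^-1` _).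
  apply/esym/seteqP; split => // -[a x] _.
  have [k _ Fa] : (\bigcup_k F k) a by rewrite -FT.
  have [l _ Gx] : (\bigcup_l G l) x by rewrite -GT.
  exists (maxn k l) => //; split => /=.
    by move: a Fa; exact/subsetPset/ndF/leq_maxl.
  by move: x Gx; exact/subsetPset/ndG/leq_maxr.
move=> k; have [mF Fk] := Foo k; have [mG Gk] := Goo k; split.
  rewrite -[X in measurable X]setTI; apply: measurable_rV_uncons => //.
  exact: measurableX.
rewrite /lebesgue_cons /pushforward -comp_preimage.
rewrite (_ : _ \o _ = id); last by apply/funext => z /=; rewrite rV_consK.
by rewrite product_measure1E// lte_mul_pinfty// ge0_fin_numE.
Qed.

HB.instance Definition _ := Measure_isSigmaFinite.Build _ _ _ lebesgue_cons
  lebesgue_cons_sigma_finite.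

End step.

Fixpoint lebesgue_rV n : {sigma_finite_measure set 'rV[R]_n -> \bar R} :=
  match n with
  | 0 => \d_(0 : 'rV[R]_0)
  | m.+1 => lebesgue_cons (lebesgue_rV m)
  end.

End lebesgue_measure_rV.

Lemma lebesgue_rV_box (R : realType) (n : nat) (A : 'I_n -> set R) :
  (forall i, measurable (A i)) ->
  lebesgue_rV R n [set x | forall i, A i (x ord0 i)] =
  (\prod_(i < n) lebesgue_measure (A i))%E.
Proof.
elim: n A => [|n IHn] A mA.
  rewrite big_ord0 /= diracE mem_set//=.
  by move=> [].
have mB : measurable [set x : 'rV[R]_n | forall i, A (lift ord0 i) (x ord0 i)].
  rewrite (_ : mkset _ = \bigcap_(i in [set: 'I_n])
      ((fun x : 'rV[R]_n => x ord0 i) @^-1` A (lift ord0 i))).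
    apply: fin_bigcap_measurable => // i _.
    by rewrite -[X in measurable X]setTI; exact: measurable_coord.
  by apply/seteqP; split => [x Ax i _|x Ax i]; exact: Ax.
rewrite big_ord_recl -IHn// -[RHS]product_measure1E//.
rewrite /lebesgue_cons /pushforward; congr (product_measure1 _ _ _).
apply/seteqP; split => [[a x] /= Aax|[a x] /= [Aa Ax] i].
  split=> [|i]; first by have := Aax ord0; rewrite mxE unlift_none.
  by have := Aax (lift ord0 i); rewrite mxE liftK.
by rewrite mxE; case: unliftP => [j ->|->].
exact: mA.
Qed.

Section sobolev.
Context (R : realType) (n : nat).
Implicit Types (S : set 'rV[R]_n) (f phi : 'rV[R]_n -> R)
  (F G : 'rV[R]_n -> 'rV[R]_n) (p k : R).

Definition dot (x y : 'rV[R]_n) : R := \sum_(i < n) x ord0 i * y ord0 i.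

(* `|x| on 'rV[R]_n is the sup norm. *)
Definition enorm (x : 'rV[R]_n) : R := Num.sqrt (dot x x).

Definition eball (c : 'rV[R]_n) (r : R) : set 'rV[R]_n :=
  [set x | enorm (x - c) < r].

(* An element of L^q(S) is represented by a function on the whole space, of
   which only the values on S matter. *)
Definition Lq S (q : \bar R) f : Prop := f \_ S \in Lfun (lebesgue_rV R n) q.

Definition Lq_norm S (q : \bar R) f : \bar R :=
  'N[lebesgue_rV R n]_q[EFin \o f \_ S].

Definition L1loc S f : Prop :=
  measurable_fun S f /\
  forall K, compact K -> K `<=` S ->
    (lebesgue_rV R n).-integrable K (EFin \o f).

Definition partial (i : 'I_n) f : 'rV[R]_n -> R :=
  fun x => 'D_(delta_mx ord0 i) f x.

Fixpoint is_Ck (m : nat) f : Prop :=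
  continuous f /\
  match m with
  | 0 => True
  | m'.+1 => forall i, (forall x, derivable f x (delta_mx ord0 i)) /\
                       is_Ck m' (partial i f)
  end.

Definition test_function S phi : Prop :=
  [/\ forall m, is_Ck m phi, compact (closure [set x | phi x != 0]) &
      closure [set x | phi x != 0] `<=` S].

Definition is_weak_gradient S f G : Prop :=
  [/\ L1loc S f, forall i, L1loc S (fun x => G x ord0 i) &
      forall phi, test_function S phi -> forall i,
        \int[lebesgue_rV R n]_(x in S) (f x * partial i phi x) =
        - \int[lebesgue_rV R n]_(x in S) (G x ord0 i * phi x)].

(* As functions with an L^1_loc gradient, these are exactly W^{1,1}_loc(S). *)
Definition weakly_differentiable S f : Prop :=
  exists G, is_weak_gradient S f G.

(* Determined up to a null subset of S when f is weakly differentiable. *)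
Definition weak_gradient S f : 'rV[R]_n -> 'rV[R]_n :=
  xget (fun=> 0) [set G | is_weak_gradient S f G].

Definition truncate k (s : R) : R := if `|s| < k then s else k * Num.sg s.

Definition is_gen_gradient S f G : Prop :=
  (forall i, measurable_fun S (fun x => G x ord0 i)) /\
  forall k, 0 < k ->
    weakly_differentiable S (truncate k \o f) /\
    {ae lebesgue_rV R n, forall x, S x ->
       weak_gradient S (truncate k \o f) x = if `|f x| < k then G x else 0}.

(* Determined up to a null subset of S when f is measurable and all its
   truncations are in W^{1,1}_loc(S). *)
Definition gen_gradient S f : 'rV[R]_n -> 'rV[R]_n :=
  xget (fun=> 0) [set G | is_gen_gradient S f G].

(* L^p(S, nu; R^n), where nu is the measure with density w on S. *)
Definition Lp_weighted S (w : 'rV[R]_n -> R) p G : Prop :=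
  (forall i, measurable_fun S (fun x => G x ord0 i)) /\
  (\int[lebesgue_rV R n]_(x in S) (w x * enorm (G x) `^ p)%:E < +oo)%E.

Definition W1p S (w : 'rV[R]_n -> R) p f : Prop :=
  [/\ Lq S p%:E f, weakly_differentiable S f &
      Lp_weighted S w p (weak_gradient S f)].

Definition A_p p (w : 'rV[R]_n -> R) : Prop :=
  [/\ {ae lebesgue_rV R n, forall x, 0 < w x},
      L1loc setT w &
      let avg B f := ((fine (lebesgue_rV R n B))^-1%:E *
        \int[lebesgue_rV R n]_(x in B) (f x)%:E)%E in
      (ereal_sup [set avg (eball c r) w *
                      avg (eball c r) (fun x => w x `^ (1 / (1 - p)))%R
                        `^ (p - 1)
                 | c in [set: 'rV[R]_n] & r in [set r : R | (0 < r)%R]]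
       < +oo)%E].

Definition average S f : R :=
  (\int[lebesgue_rV R n]_(x in S) f x) / fine (lebesgue_rV R n S).

End sobolev.

(* Near each of its boundary points, S is the open supergraph of a C^1 function
   of n - 1 coordinates, after a relabelling and reorientation of the axes. *)
Definition C1_boundary (R : realType) (n : nat) (S : set 'rV[R]_n) : Prop :=
  forall x0, closure S x0 -> ~ interior S x0 ->
  exists (r : R) (i : 'I_n) (b : bool) (g : 'rV[R]_n.-1 -> R),
    [/\ 0 < r, is_Ck 1 g &
        forall x, eball x0 r x ->
          (S x <-> g (col' i x) < (-1) ^+ b * x ord0 i)].

Section semigroup.
Context (R : realType) (n : nat).
Implicit Types (S : set 'rV[R]_n) (gamma : 'rV[R]_n -> R) (p : R).

(* Both integrands are integrable on S: h is bounded, and on {|f - phi| < k} the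
   gradient gf is that of a fixed truncation of f, so that Hoelder's inequality
   for the measure gamma applies. Hence Rintegral never takes its default value,
   and h is weakly differentiable. *)
Definition calA S gamma p (f fhat : 'rV[R]_n -> R) : Prop :=
  [/\ Lq S 1 f, Lq S 1 fhat,
      forall k, 0 < k -> W1p S gamma p (truncate k \o f) &
      forall k phi, 0 < k -> W1p S gamma p phi -> Lq S +oo phi ->
        let h := truncate k \o (f \- phi) in
        let gf := gen_gradient S f in
        \int[lebesgue_rV R n]_(x in S)
          (gamma x * enorm (gf x) `^ (p - 2) * dot (gf x) (weak_gradient S h x))
        <= \int[lebesgue_rV R n]_(x in S) (fhat x * h x)].

(* Curves [0, +oo) -> L^1(S) are indexed by R; negative times are ignored. *)
Implicit Type v : R -> 'rV[R]_n -> R.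

Definition L1_continuous S v : Prop :=
  forall t, 0 <= t ->
    Lq_norm S 1 (v s \- v t) @[s --> within [set s | 0 <= s] (nbhs t)]
      --> 0%E.

(* Finite families of nonoverlapping intervals are listed from left to right. *)
Definition L1_locally_absolutely_continuous S v : Prop :=
  forall a b : R, 0 < a -> a <= b ->
  forall e : R, 0 < e -> exists2 d, 0 < d &
    forall I : seq (R * R),
      (forall J, J \in I -> [/\ a <= J.1, J.1 <= J.2 & J.2 <= b]) ->
      pairwise (fun J K : R * R => J.2 <= K.1) I ->
      \sum_(J <- I) (J.2 - J.1) < d ->
      (\sum_(J <- I) Lq_norm S 1 (v J.2 \- v J.1)%R < e%:E)%E.

Definition L1_derivative S v (t : R) (w : 'rV[R]_n -> R) : Prop :=
  Lq S 1 w /\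
  Lq_norm S 1 (fun x => h^-1 * (v (t + h) x - v t x) - w x) @[h --> 0^'] --> 0%E.

Definition strong_solution S gamma p (u : 'rV[R]_n -> R) v : Prop :=
  [/\ forall t, 0 <= t -> Lq S 1 (v t),
      L1_continuous S v,
      L1_locally_absolutely_continuous S v,
      {ae lebesgue_measure, forall t : R, 0 < t ->
         exists2 w, L1_derivative S v t w & calA S gamma p (v t) (\- w)} &
      {ae lebesgue_rV R n, forall x, S x -> v 0 x = u x}].

Definition is_semigroup S gamma p (T : R -> ('rV[R]_n -> R) -> 'rV[R]_n -> R) :
    Prop :=
  forall u, Lq S 1 u -> strong_solution S gamma p u (T ^~ u).

End semigroup.

(* Main.v *)
(* Testing the inequality that defines calA with constants c shows that t |-> int_S
   j_k(T(t)u - c) is nonincreasing, where j_k is the primitive of the truncation tau_k, and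
   that it dissipates at least int_S gamma |grad tau_k(T(t)u)|^p when c = 0. Letting k -> 0,
   int_S |T(t)u - c| is nonincreasing for every constant c; c -> +oo and c -> -oo give
   conservation of mass, and c = k, c = -k give the monotonicity of int_S (|T(t)u| - k)^+.

   Since the total dissipation is finite, the gradients of tau_k(T(t_m)u) tend to 0 in
   L^1(S) along some sequence t_m, by Young's inequality and the integrability of
   gamma^(1/(1-p)). On small cubes this makes tau_k(T(t_m)u) close to a constant, and
   connectedness of S makes the constant independent of the cube. By conservation of mass
   the constant is the average, and monotonicity upgrades the subsequence to t -> oo.

   For L^q, int_S s^q is comparable to a positive combination of the excesses
   int_S (s - m)^+, so the tails of |T(t)u|^q are controlled by those of |u|^q uniformly
   in t. *)
Require Import Defs.
From HB Require Import structures.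
From mathcomp Require Import all_boot all_order all_algebra.
From mathcomp Require Import all_classical all_reals all_analysis.
From mathcomp Require Import measurable_realfun ring lra.

Set Implicit Arguments.
Unset Strict Implicit.
Unset Printing Implicit Defensive.

Import Order.TTheory GRing.Theory Num.Theory.
Import numFieldNormedType.Exports.

Local Open Scope classical_set_scope.
Local Open Scope ring_scope.

(** A weak gradient is accessible only through test functions, whereas the argument has to truncate
    functions and to compare their values at different points. Translation invariance of Lebesgue
    measure bridges this gap: pairing f with a translated test function turns the weak derivative
    into a formula for f(x + h e) - f(x) at almost every x ([weak_partial_line]), and both the chain
    rule and the Poincare estimate are read off from that formula. Cubes never reach the boundary of
    S. Since truncations are bounded by k, the uncovered part costs only a multiple of its measure,
    so a qualitative statement along a sequence is obtained, without a rate. In time, the curve is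
    differentiable in L^1(S) only almost everywhere. Convexity of the energies bounds their left
    difference quotients at such times, and absolute continuity is what allows this bound to be
    integrated across the exceptional null set. *)

(** * Lebesgue measure on row vectors: boxes and translation invariance *)

Section boxes.
Context (R : realType) (n : nat).
Local Notation mu := (lebesgue_rV R n).
Implicit Types (A : 'I_n -> set R) (x h : 'rV[R]_n).

Definition box A : set 'rV[R]_n := [set x | forall i, A i (x ord0 i)].

Lemma measurable_box A : (forall i, measurable (A i)) -> measurable (box A).
Proof.
move=> mA; rewrite (_ : box A = \bigcap_(i in [set: 'I_n])
    ((fun x : 'rV[R]_n => x ord0 i) @^-1` A i)).
  apply: fin_bigcap_measurable => // i _.
  by rewrite -[X in measurable X]setTI; exact: measurable_coord.
by apply/seteqP; split => [x Ax i _|x Ax i]; exact: Ax.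
Qed.

Lemma lebesgue_box A : (forall i, measurable (A i)) ->
  mu (box A) = (\prod_(i < n) lebesgue_measure (A i))%E.
Proof. exact: lebesgue_rV_box. Qed.

Definition boxes : set (set 'rV[R]_n) :=
  [set B | exists2 A, (forall i, measurable (A i)) & B = box A].

Lemma setI_closed_boxes : setI_closed boxes.
Proof.
move=> _ _ [A mA ->] [B mB ->]; exists (fun i => A i `&` B i).
  by move=> i; exact: measurableI.
apply/seteqP; split => [x [Ax Bx] i|x AB]; first by split; [exact: Ax|exact: Bx].
by split=> i; case: (AB i).
Qed.

Lemma measurable_boxes : measurable = <<s boxes >> :> set (set 'rV[R]_n).
Proof.
apply/seteqP; split => B.
  apply: smallest_sub; first exact: smallest_sigma_algebra.
  move=> C; rewrite -bigcup_seq => -[i _ [Y mY <-]].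
  apply: sub_sigma_algebra; exists (fun j => if j == i then Y else setT).
    by move=> j; case: ifP.
  rewrite setTI; apply/seteqP; split => [x Yx j|x Yx] /=.
    by case: eqP => // ->.
  by have := Yx i; rewrite eqxx.
apply: smallest_sub; first exact: sigma_algebra_measurable.
by move=> C [A mA ->]; exact: measurable_box.
Qed.

Lemma bounded_box_cover :
  \bigcup_k box (fun=> `]-(k%:R : R), k%:R[%classic) = setT.
Proof.
apply/seteqP; split => // x _.
exists (Num.truncn (\sum_(i < n) `|x ord0 i|)).+1 => // i /=.
rewrite in_itv /= -ltr_norml; apply: le_lt_trans (truncnS_gt _).
by rewrite (bigD1 i)//= lerDl sumr_ge0.
Qed.

Lemma lebesgue_rV_bounded_box (a b : R) :
  (mu (box (fun=> `]a, b[%classic)) < +oo)%E.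
Proof.
rewrite lebesgue_box => [|i]; last exact: measurable_itv.
under eq_bigr do rewrite lebesgue_measure_itv /=.
rewrite ltey_eq prode_fin_num// => i _.
by case: ifP => _ //; rewrite -EFinB.
Qed.

End boxes.

Lemma lebesgue_measure_translation (R : realType) (h : R) (A : set R) :
  measurable A ->
  lebesgue_measure ((fun x => x + h) @^-1` A) = lebesgue_measure A.
Proof.
move=> mA.
have mt : measurable_fun [set: measurableTypeR R]
    ((fun x => x + h) : measurableTypeR R -> measurableTypeR R).
  by apply: measurable_funD; [exact: measurable_id|exact: measurable_cst].
pose m : {measure set (measurableTypeR R) -> \bar R} :=
  measure_function_pushforward__canonical__measure_function_Measure
    lebesgue_measure mt.
apply/esym; apply: (@lebesgue_measure_unique R m) => //.
move=> _ /ocitvP[->|[[a b] /= ab ->]]; first by rewrite !measure0.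
rewrite /m/= /pushforward (_ : _ @^-1` _ = `]a - h, b - h]%classic); last first.
  by apply/seteqP; split => x /=; rewrite !in_itv/= ltrBlDr lerBrDr.
by rewrite !lebesgue_measure_itv/= !lte_fin ltrD2r -!EFinB opprB addrA subrK.
Qed.

Section translation.
Context (R : realType) (n : nat).
Local Notation mu := (lebesgue_rV R n).
Implicit Types (x h : 'rV[R]_n).

Lemma measurable_translation h : measurable_fun [set: 'rV[R]_n] (fun x => x + h).
Proof.
apply: measurable_fun_rV => i; under eq_fun do rewrite mxE.
apply: measurable_funD; first exact: measurable_coord.
exact: measurable_cst.
Qed.

(** Boxes with measurable sides form a generating pi-system, on which the measure is a product of
    one-dimensional measures; bounded cubes of finite measure exhaust the space, so uniqueness of
    measures applies. *)
Lemma lebesgue_rV_translation h (A : set 'rV[R]_n) : measurable A ->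
  mu ((fun x => x + h) @^-1` A) = mu A.
Proof.
move=> mA; rewrite -[LHS]/(pushforward mu (fun x => x + h) A).
have mt := measurable_translation h.
apply/esym; apply: (@measure_unique _ _ _ (@boxes R n)
  (fun k => box (fun=> `]-(k%:R : R), k%:R[%classic)) _ _ _ _ mu (pushforward mu _)) => //.
- exact: measurable_boxes.
- exact: setI_closed_boxes.
- by move=> k; exists (fun=> `]-(k%:R : R), k%:R[%classic).
- exact: bounded_box_cover.
- move=> _ [B mB ->].
  transitivity (mu (box (fun i => (fun y => y + h ord0 i) @^-1` B i))).
    have mB' i : measurable ((fun y => y + h ord0 i) @^-1` B i).
      rewrite -[X in measurable X]setTI.
      by apply: measurable_funD => //; exact: measurable_cst.
    apply: (etrans (lebesgue_box mB)); apply: (etrans _ (esym (lebesgue_box mB'))).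
    by apply: eq_bigr => i _; exact/esym/lebesgue_measure_translation.
  congr (mu _); apply/seteqP.
  by split => x Bx i; have := Bx i; rewrite mxE.
- by move=> k; exact: lebesgue_rV_bounded_box.
Qed.

Lemma ge0_integral_translation h (f : 'rV[R]_n -> \bar R) :
  measurable_fun [set: 'rV[R]_n] f -> (forall x, 0 <= f x)%E ->
  (\int[mu]_x f (x + h)%R = \int[mu]_x f x)%E.
Proof.
move=> mf f0; have mt := measurable_translation h.
rewrite -[LHS](ge0_integral_pushforward mt mu measurableT mf) => [|x _]//.
apply: eq_measure_integral => A mA _.
exact: lebesgue_rV_translation.
Qed.

Lemma integrable_translation h (f : 'rV[R]_n -> \bar R) :
  mu.-integrable setT f -> mu.-integrable setT (fun x => f (x + h)).
Proof.
move=> /integrableP[mf foo]; apply/integrableP; split.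
  exact: (measurableT_comp mf (measurable_translation h)).
rewrite (ge0_integral_translation h (f := fun x => `|f x|%E))//.
exact: measurableT_comp.
Qed.

Lemma integral_translation h (f : 'rV[R]_n -> \bar R) :
  mu.-integrable setT f ->
  (\int[mu]_x f (x + h)%R = \int[mu]_x f x)%E.
Proof.
move=> fi; have mt := measurable_translation h.
rewrite -[LHS](integral_pushforward mt (D := setT)) => //; last 2 first.
  exact: measurable_int fi.
  exact: integrable_translation.
apply: eq_measure_integral => A mA _.
exact: lebesgue_rV_translation.
Qed.

Lemma Rintegral_translation h (f : 'rV[R]_n -> R) :
  mu.-integrable setT (EFin \o f) ->
  \int[mu]_x f (x + h) = \int[mu]_x f x.
Proof.
by move=> fi; rewrite /Rintegral (integral_translation h fi).
Qed.

End translation.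

(** * Countable cube covers of open sets *)

Section cubes.
Context (R : realType) (n : nat).
Implicit Types (x : 'rV[R]_n) (U : set 'rV[R]_n).

Lemma ball_box x (r : R) : 0 < r ->
  ball x r = box (fun i => `]x ord0 i - r, x ord0 i + r[%classic).
Proof.
move=> r0; apply/seteqP; split => y.
  move=> [_ xy] i /=; have := xy ord0 i.
  by rewrite /ball /= in_itv /= ltr_distlC.
move=> xy; split => // i j; rewrite ord1 /ball /=.
by have := xy j; rewrite /= in_itv /= ltr_distlC.
Qed.

Lemma measurable_ball_rV x (r : R) : measurable (ball x r).
Proof.
have [r0|r0] := ltP 0 r.
  by rewrite ball_box//; apply: measurable_box => i; exact: measurable_itv.
rewrite (_ : ball x r = set0)//; apply/seteqP; split => // y [].
by rewrite ltNge r0.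
Qed.

(** Numbers that encode nothing get radius 0, hence an empty ball, so that unions may range over all
    naturals. *)
Definition rational_cube (k : nat) : 'rV[R]_n * R :=
  if unpickle k is Some (q, m) then (map_mx ratr (q : 'rV[rat]_n), m.+1%:R^-1 : R)
  else (0, 0).

(** The doubled cube is kept inside U so that the closed cube lies in U too; this makes room for the
    compact supports of bumps. *)
Lemma rational_cube_dense U x : open U -> U x ->
  exists k, let: (c, r) := rational_cube k in
    [/\ 0 < r, ball c r x & ball c (r *+ 2) `<=` U].
Proof.
move=> oU Ux; have /nbhs_ballP[e /= e0 xeU] := open_nbhs_nbhs (conj oU Ux).
(* A point of the doubled cube is within 3 r of x, so r < e / 4 is small enough. *)
pose m := Num.truncn (e / 4)^-1; pose r : R := m.+1%:R^-1.
have r0 : 0 < r by rewrite invr_gt0.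
have re : r < e / 4.
  by rewrite -[ltRHS]invrK ltf_pV2 ?posrE ?invr_gt0 ?divr_gt0// truncnS_gt.
have /choice[q qP] : forall i, exists q : rat,
    ratr q \in `]x ord0 i - r, (x ord0 i + r)[.
  by move=> i; apply: rat_in_itvoo; rewrite ltrD2l; lra.
exists (pickle (\row_i q i, m)); rewrite /rational_cube pickleK.
have qx : ball (map_mx ratr (\row_i q i) : 'rV[R]_n) r x.
  apply: ball_sym; rewrite ball_box// => i; rewrite /= !mxE; exact: qP.
split=> // y qy; apply: xeU; apply: le_ball (ball_triangle (ball_sym qx) qy).
by move: re; rewrite -/r mulr2n; lra.
Qed.

Lemma open_bigcup_cubes U : open U ->
  U = \bigcup_(k in [set k | ball (rational_cube k).1 ((rational_cube k).2 *+ 2) `<=` U])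
    ball (rational_cube k).1 (rational_cube k).2.
Proof.
move=> oU; apply/seteqP; split => [x Ux|x [k kU]].
  have [k] := rational_cube_dense oU Ux.
  by case E : (rational_cube k) => [c r] [r0 cx crU]; exists k => //=; rewrite E.
move=> cx; apply: kU; apply: le_ball (cx).
by case: cx => r0 _; rewrite mulr2n lerDl ltW.
Qed.

Lemma open_measurable_rV U : open U -> measurable U.
Proof.
move=> oU; rewrite (open_bigcup_cubes oU); apply: bigcup_measurable => k _.
exact: measurable_ball_rV.
Qed.

Lemma continuous_measurable_rV (f : 'rV[R]_n -> R) : continuous f ->
  measurable_fun [set: 'rV[R]_n] f.
Proof.
move=> /continuousP cf; apply: (measurability _ (RGenOpens.measurableE R)) => //.
move=> _ [_ [a [b ->] <-]]; rewrite setTI.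
by apply: open_measurable_rV; apply: cf.
Qed.

End cubes.

(** * Calculus of C^m functions *)

Section Ck.
Context (R : realType) (n : nat).
Implicit Types (f g : 'rV[R]_n -> R) (x v h : 'rV[R]_n).
Local Notation e i := (delta_mx ord0 i : 'rV[R]_n).

Lemma line_quotient f x v :
  (fun h : R => h^-1 *: ((f \o shift x) (h *: v) - f x)) =
  (fun h : R => h^-1 *: (((fun s : R => f (x + s *: v)) \o shift 0) (h *: 1) -
    f (x + 0 *: v))).
Proof. by apply/funext => s /=; rewrite scale0r !addr0 scaler1 [x + _]addrC. Qed.

Lemma derivable_line f x v :
  derivable f x v <-> derivable (fun s : R => f (x + s *: v)) 0 1.
Proof. by rewrite /derivable line_quotient. Qed.

Lemma derive_line f x v : 'D_v f x = 'D_1 (fun s : R => f (x + s *: v)) 0.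
Proof. by rewrite /derive line_quotient. Qed.

Lemma is_derive_line f x v (d : R) :
  is_derive (0 : R) (1 : R) (fun s : R => f (x + s *: v)) d -> is_derive x v f d.
Proof.
move=> [df fd]; split; first exact/derivable_line.
by rewrite derive_line.
Qed.

Lemma is_Ck_cont m f : is_Ck m f -> continuous f.
Proof. by case: m => [[]|m []]. Qed.

Lemma is_Ck_derive m f i x : is_Ck m.+1 f -> is_derive x (e i) f (partial i f x).
Proof. by move=> [_ /(_ i)[df _]]; split. Qed.

Lemma is_Ck_partial m f i : is_Ck m.+1 f -> is_Ck m (partial i f).
Proof. by move=> [_ /(_ i)[]]. Qed.

Lemma is_Ck_step m f (df : 'I_n -> 'rV[R]_n -> R) :
  continuous f -> (forall i x, is_derive x (e i) f (df i x)) ->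
  (forall i, is_Ck m (df i)) -> is_Ck m.+1 f.
Proof.
move=> cf fd dfm; split => // i; split; first by move=> x; have [] := fd i x.
rewrite (_ : partial i f = df i)//; apply/funext => x.
by rewrite /partial; have [_ ->] := fd i x.
Qed.

Lemma is_CkS m f : is_Ck m.+1 f -> is_Ck m f.
Proof.
elim: m f => [|m IH] f fS; first by split => //; exact: is_Ck_cont fS.
apply: (is_Ck_step (df := fun i => partial i f)); first exact: is_Ck_cont fS.
  by move=> i x; exact: is_Ck_derive fS.
by move=> i; apply/IH/is_Ck_partial.
Qed.

Lemma is_Ck_cst m (c : R) : @is_Ck R n m (fun=> c).
Proof.
elim: m c => [|m IH] c; first by split => //; exact: cst_continuous.
apply: (is_Ck_step (df := fun _ _ => 0)) => //; exact: cst_continuous.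
Qed.

Lemma is_CkD m f g : is_Ck m f -> is_Ck m g -> is_Ck m (fun x => f x + g x).
Proof.
elim: m f g => [|m IH] f g fm gm.
  have [[cf _] [cg _]] := (fm, gm).
  by split => // x; apply: (@continuousD _ _ _ f g x); [exact: cf|exact: cg].
apply: (is_Ck_step (df := fun i x => partial i f x + partial i g x)).
- move=> x; have cf := is_Ck_cont fm; have cg := is_Ck_cont gm.
  by apply: (@continuousD _ _ _ f g x); [exact: cf|exact: cg].
- by move=> i x; apply: is_deriveD; [exact: is_Ck_derive fm|exact: is_Ck_derive gm].
- by move=> i; apply: IH; exact: is_Ck_partial.
Qed.

Lemma is_CkM m f g : is_Ck m f -> is_Ck m g -> is_Ck m (fun x => f x * g x).
Proof.
elim: m f g => [|m IH] f g fm gm.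
  have [[cf _] [cg _]] := (fm, gm).
  by split => // x; apply: (@continuousM _ _ f g x); [exact: cf|exact: cg].
apply: (is_Ck_step (df := fun i x => f x * partial i g x + g x * partial i f x)).
- move=> x; have cf := is_Ck_cont fm; have cg := is_Ck_cont gm.
  by apply: (@continuousM _ _ f g x); [exact: cf|exact: cg].
- by move=> i x; apply: is_deriveM; [exact: is_Ck_derive fm|exact: is_Ck_derive gm].
- move=> i; apply: is_CkD; apply: IH.
  + exact: is_CkS.
  + exact: is_Ck_partial.
  + exact: is_CkS.
  + exact: is_Ck_partial.
Qed.

Lemma is_Ck_prod m (I : Type) (r : seq I) (F : I -> 'rV[R]_n -> R) :
  (forall i, is_Ck m (F i)) -> is_Ck m (fun x => \prod_(i <- r) F i x).
Proof.
move=> Fm; elim: r => [|i r IH].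
  by under eq_fun do rewrite big_nil; exact: is_Ck_cst.
by under eq_fun do rewrite big_cons; exact: is_CkM.
Qed.

Lemma is_derive_shift f x h v (d : R) :
  is_derive (x + h) v f d -> is_derive x v (fun y => f (y + h)) d.
Proof.
have E : (fun t : R => t^-1 *: (((fun y => f (y + h)) \o shift x) (t *: v) - f (x + h)))
       = (fun t : R => t^-1 *: ((f \o shift (x + h)) (t *: v) - f (x + h))).
  by apply/funext => t /=; rewrite addrA.
by move=> [df fd]; split; [rewrite /derivable E|rewrite /derive E].
Qed.

Lemma continuous_shift f h : continuous f -> continuous (fun x => f (x + h)).
Proof.
move=> cf x; have : {for x, continuous (f \o (fun y => y + h))}; last by [].
apply: continuous_comp; last exact: cf.
by apply: (@continuousD _ _ _ idfun (cst h)); [move=> ?; exact: cvg_id|exact: cst_continuous].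
Qed.

Lemma is_Ck_shift m f h : is_Ck m f -> is_Ck m (fun x => f (x + h)).
Proof.
elim: m f => [|m IH] f fm; first by split => //; apply: continuous_shift; case: fm.
apply: (is_Ck_step (df := fun i x => partial i f (x + h))).
- by apply: continuous_shift; exact: is_Ck_cont fm.
- by move=> i x; apply: is_derive_shift; exact: is_Ck_derive fm.
- by move=> i; apply: (IH (partial i f)); exact: is_Ck_partial.
Qed.

Lemma partial_shift m f h i x : is_Ck m.+1 f ->
  partial i (fun y => f (y + h)) x = partial i f (x + h).
Proof.
by move=> fm; have [_] := is_derive_shift (is_Ck_derive i (x + h) fm).
Qed.

Lemma is_Ck_line m f i x (s : R) : is_Ck m.+1 f ->
  is_derive s 1 (fun t : R => f (x + t *: e i)) (partial i f (x + s *: e i)).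
Proof.
move=> fm; have := is_Ck_derive i (x + s *: e i) fm.
have E : (fun t : R => t^-1 *: (((fun t : R => f (x + t *: e i)) \o shift s) (t *: 1)
    - f (x + s *: e i)))
  = (fun t : R => t^-1 *: ((f \o shift (x + s *: e i)) (t *: e i)
    - f (x + s *: e i))).
  by apply/funext => t /=; rewrite scaler1 scalerDl addrCA.
by move=> [df fd]; split; [rewrite /derivable E|rewrite /derive E].
Qed.

End Ck.

(** * Smooth bump functions on boxes *)

Section smooth_bump.
Context (R : realType).
Implicit Types (P : {poly R}) (x y : R).

(** The decay rate is chosen for the substitution y = 1/x, which turns it into x^2 and makes the
    difference quotient at 0 vanish. A single term of the exponential series, of degree beyond that
    of P, supplies the factorial. *)
Lemma horner_expR_bound P : exists2 C : R, 0 <= C &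
  forall y, 1 <= y -> `|P.[y] * expR (- y)| <= C / y ^+ 2.
Proof.
pose C := (\sum_(i < size P) `|P`_i|) * ((size P).+2)`!%:R.
have S0 : 0 <= \sum_(i < size P) `|P`_i| by rewrite sumr_ge0.
exists C => [|y y1]; first by rewrite mulr_ge0.
have y0 : 0 < y by lra.
have Py : `|P.[y]| <= (\sum_(i < size P) `|P`_i|) * y ^+ (size P).-1.
  rewrite horner_coef (le_trans (ler_norm_sum _ _ _))// mulr_suml ler_sum// => i _.
  rewrite normrM ler_wpM2l// ger0_norm ?exprn_ge0//; last by lra.
  by apply: ler_weXn2l => //; rewrite -ltnS (leq_trans (ltn_ord i))// leqSpred.
have ey : y ^+ (size P).+2 / ((size P).+2)`!%:R <= expR y.
  by apply: le_trans (expR_ge1Dxn (size P).+1 (ltW y0)); rewrite lerDr.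
have f0 : 0 < ((size P).+2)`!%:R :> R by rewrite ltr0n fact_gt0.
rewrite normrM (ger0_norm (expR_ge0 _)) expRN ler_pdivrMr ?expR_gt0//.
apply: (le_trans Py).
rewrite /C -!mulrA ler_wpM2l//.
apply: (@le_trans _ _ (((size P).+2)`!%:R * (y ^- 2 * (y ^+ (size P).+2 / ((size P).+2)`!%:R)))); last first.
  by rewrite ler_wpM2l// ?ler_wpM2l// invr_ge0 exprn_ge0// ltW.
rewrite [X in _ <= X](_ : _ = y ^+ (size P).+2 / y ^+ 2); last first.
  by field; rewrite !gt_eqF.
rewrite ler_pdivlMr ?exprn_gt0// -exprD ler_weXn2l// addn2 !ltnS.
by rewrite leq_pred.
Qed.

(** The polynomial in 1/x makes the family closed under differentiation, so that one induction gives
    smoothness of every order; [flat 1] is the classical exp(-1/x). *)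
Definition flat P x : R := if 0 < x then P.[x^-1] * expR (- x^-1) else 0.

Lemma flat_bound P : exists2 C : R, 0 <= C &
  forall x, x <= 1 -> `|flat P x| <= C * x ^+ 2.
Proof.
have [C C0 CP] := horner_expR_bound P; exists C => // x x1.
rewrite /flat; case: ifPn => x0; last by rewrite normr0 mulr_ge0// sqr_ge0.
have := CP x^-1; rewrite invf_ge1// => /(_ x1).
by rewrite exprVn invrK.
Qed.

Lemma is_derive_flat P x :
  is_derive x 1 (flat P) (flat ('X ^+ 2 * (P - P^`())) x).
Proof.
have [x0|x0|x0] := ltgtP x 0.
- apply: (@near_eq_is_derive _ _ _ (cst 0)) => //.
    near=> y; rewrite /flat ifF//; apply/negbTE; rewrite -leNgt ltW//.
    by near: y; exact: lt_nbhsl.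
  by rewrite /flat ltNge (ltW x0)/=; exact: is_derive_cst.
- apply: (@near_eq_is_derive _ _ _ (fun x : R => P.[x^-1] * expR (- x^-1))) => //.
    near=> y; rewrite /flat ifT//.
    by near: y; exact: lt_nbhsr.
  have dV : is_derive x 1 (fun y : R => y^-1) (- x ^- 2).
    have := @is_deriveV R id x 1 1 (lt0r_neq0 x0) (is_derive_id _ _).
    by rewrite scaler1.
  have dP := is_derive1_comp (is_derive_poly P x^-1) dV.
  have dN : is_derive x 1 (fun y : R => - y^-1) (x ^- 2).
    by have := is_deriveN dV; rewrite opprK.
  have dE := @is_derive1_comp R expR (fun y => - y^-1) x _ _ (is_derive_expR _) dN.
  have := is_deriveM dP dE; rewrite /flat x0.
  move/is_derive_eq; apply.
  rewrite !hornerE /= /GRing.scale /= -exprVn; ring.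
(* At 0 the quadratic bound makes the difference quotient at most C |h|. *)
- rewrite x0 {x0 x}; rewrite {2}/flat ltxx; have [C C0 CP] := flat_bound P.
  suff H : h^-1 *: ((flat P \o shift 0) (h *: 1) - flat P 0) @[h --> 0^'] --> (0 : R).
    by split; [apply/cvg_ex; exists 0|apply/cvg_lim].
  apply/cvgrPdist_le => e e0; near=> h.
  have h0 : h != 0 by near: h; exact: nbhs_dnbhs_neq.
  have he : `|h| <= e / (C + 1).
    by near: h; apply: dnbhs0_le; rewrite divr_gt0// ltr_wpDl.
  have h1 : `|h| <= 1 by near: h; exact: dnbhs0_le.
  rewrite /= sub0r normrN addr0 scaler1 {2}/flat ltxx subr0 normrM normfV.
  rewrite ler_pdivrMl ?normr_gt0//.
  apply: (le_trans (CP _ _)); first by rewrite (le_trans (ler_norm _)).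
  move: he; rewrite ler_pdivlMr ?ltr_wpDl// => he.
  rewrite -real_normK ?num_real// expr2 mulrCA ler_wpM2l//.
  by apply: le_trans he; rewrite mulrDr mulr1 [C * _]mulrC lerDl.
Unshelve. all: by end_near. Qed.

Lemma continuous_flat P : continuous (flat P).
Proof.
move=> x; apply: differentiable_continuous; apply/derivable1_diffP.
by have [] := is_derive_flat P x.
Qed.

End smooth_bump.

Section bump.
Context (R : realType) (n : nat).
Implicit Types (x : 'rV[R]_n) (a b : 'I_n -> R).
Local Notation e i := (delta_mx ord0 i : 'rV[R]_n).

Lemma is_derive_flat_coord (P : {poly R}) (s c : R) i j x :
  is_derive x (e i) (fun x => flat P (s * x ord0 j + c))
    ((s * (i == j)%:R) * flat ('X ^+ 2 * (P - P^`())) (s * x ord0 j + c)).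
Proof.
apply: is_derive_line.
rewrite (_ : (fun t : R => _) =
    flat P \o (fun t : R => (s * (i == j)%:R) * t + (s * x ord0 j + c))); last first.
  apply/funext => t /=; congr flat; rewrite !mxE eqxx /= [j == i]eq_sym.
  ring.
rewrite [X in is_derive _ _ _ X]mulrC; apply: is_derive1_comp; last first.
  have := is_deriveD (is_deriveZ (s * (i == j)%:R) (is_derive_id (0 : R) (1 : R)))
    (is_derive_cst (s * x ord0 j + c) (0 : R) (1 : R)).
  by rewrite addr0 /GRing.scale /= mulr1.
by rewrite mulr0 add0r; exact: is_derive_flat.
Qed.

Lemma is_Ck_flat_coord m (P : {poly R}) (s c : R) j :
  @is_Ck R n m (fun x => flat P (s * x ord0 j + c)).
Proof.
have cF (Q : {poly R}) : continuous (fun x : 'rV[R]_n => flat Q (s * x ord0 j + c)).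
  move=> x; have : {for x, continuous
      (flat Q \o (fun y => s * y + c) \o (fun x : 'rV[R]_n => x ord0 j))}; last by [].
  apply: continuous_comp; first exact: coord_continuous.
  apply: continuous_comp; last exact: continuous_flat.
  apply: (@continuousD _ _ _ ( *%R s) (cst c)); last exact: cst_continuous.
  exact: mulrl_continuous.
elim: m P => [|m IH] P; first by split => //; exact: cF.
apply: (is_Ck_step (df := fun i x => (s * (i == j)%:R) *
  flat ('X ^+ 2 * (P - P^`())) (s * x ord0 j + c))); first exact: cF.
  by move=> i x; exact: is_derive_flat_coord.
by move=> i; apply: is_CkM; [exact: is_Ck_cst|exact: IH].
Qed.

(** The parameter k does not move the support: it rescales exp(-1/(k (x - a))), which tends to 1 for
    x > a, so that the bumps converge to the indicator of the open box. *)
Definition bump a b (k : R) x : R :=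
  \prod_(j < n) (flat 1 (k * x ord0 j + - (k * a j)) *
    flat 1 (- k * x ord0 j + k * b j)).

Lemma bump_ge0 a b k x : 0 <= bump a b k x.
Proof.
apply: prodr_ge0 => j _; rewrite mulr_ge0// /flat; case: ifP => // _;
  by rewrite hornerC mul1r expR_ge0.
Qed.

Lemma bump_le1 a b k x : bump a b k x <= 1.
Proof.
have f1 (y : R) : 0 <= flat 1 y <= 1.
  rewrite /flat; case: ifP => y0; last by rewrite lexx ler01.
  by rewrite hornerC mul1r expR_ge0 -expR0 ler_expR oppr_le0 invr_ge0 ltW.
have : forall j, true -> 0 <= flat 1 (k * x ord0 j + - (k * a j)) *
    flat 1 (- k * x ord0 j + k * b j) <= 1.
  by move=> j _; have /andP[? ?] := f1 (k * x ord0 j + - (k * a j));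
     have /andP[? ?] := f1 (- k * x ord0 j + k * b j); rewrite mulr_ge0//= mulr_ile1.
by move=> H; apply: prodr_ile1 => j _; exact: H.
Qed.

Lemma bump_eq0 a b k x : 0 < k -> ~ box (fun j => `]a j, b j[%classic) x ->
  bump a b k x = 0.
Proof.
move=> k0 /existsNP[j /=]; rewrite in_itv /= => /negP; rewrite negb_and -!leNgt => xab.
rewrite /bump (bigD1 j)//=; apply/eqP; rewrite !mulf_eq0; apply/orP; left.
apply/orP; case/orP: xab => xab; [left|right]; rewrite /flat ifF//; apply/negbTE.
  by rewrite -leNgt subr_le0 ler_pM2l.
by rewrite -leNgt mulNr addrC subr_le0 ler_pM2l.
Qed.

Lemma cvg_bump a b x : bump a b k.+1%:R x @[k --> \oo] -->
  ((x \in box (fun j => `]a j, b j[%classic))%:R : R).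
Proof.
case: (boolP (x \in box (fun j => `]a j, b j[%classic))) => /= xab; last first.
  rewrite notin_setE in xab.
  under eq_fun do rewrite bump_eq0//.
  exact: cvg_cst.
rewrite inE in xab.
have f1 (c : R) : 0 < c -> flat 1 (k.+1%:R * c) @[k --> \oo] --> (1 : R).
  move=> c0.
  have -> : (fun k => flat 1 (k.+1%:R * c)) =
      (fun k : nat => expR (- c^-1 * k.+1%:R^-1)).
    apply/funext => k; rewrite /flat mulr_gt0// hornerC mul1r invfM mulNr.
    by rewrite [_^-1 * _^-1]mulrC.
  rewrite -[X in _ --> X]expR0 -[in X in _ --> X](mulr0 (- c^-1)).
  apply: (@cvg_comp _ _ _ (fun k : nat => - c^-1 * k.+1%:R^-1) expR).
    apply: cvgM; first exact: cvg_cst.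
    exact: (@cvg_harmonic R).
  exact: continuous_expR.
rewrite [X in _ --> X](_ : _ = \prod_(j < n) (1 * 1 : R)); last first.
  by rewrite big1// => j _; rewrite mulr1.
apply: cvg_big; first exact: mul_continuous.
move=> j _; have := xab j; rewrite /= in_itv /= => /andP[ax xb].
apply: cvgM.
  under eq_fun do rewrite -mulrBr; apply: f1; rewrite subr_gt0//.
under eq_fun do rewrite mulNr addrC -mulrBr; apply: f1; rewrite subr_gt0//.
Qed.

Lemma test_function_bump (S : set 'rV[R]_n) a b k : 0 < k ->
  box (fun j => `[a j, b j]%classic) `<=` S -> test_function S (bump a b k).
Proof.
move=> k0 abS.
have cbox : compact (box (fun j => `[a j, b j]%classic)).
  by apply: rV_compact => j; exact: segment_compact.
have clbox : closed (box (fun j => `[a j, b j]%classic)).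
  by apply: compact_closed => //; exact: norm_hausdorff.
have sub : closure [set x | bump a b k x != 0] `<=` box (fun j => `[a j, b j]%classic).
  rewrite [X in _ `<=` X](closure_id _).1//; apply: closureS => x /= /eqP b0 j.
  have /= : box (fun j => `]a j, b j[%classic) x.
    by apply: contrapT => /(bump_eq0 k0).
  by move=> /(_ j) /=; rewrite !in_itv /= => /andP[/ltW-> /ltW->].
split.
- move=> m; apply: is_Ck_prod => j.
  by apply: is_CkM; exact: is_Ck_flat_coord.
- by apply: (subclosed_compact _ cbox) => //; exact: closed_closure.
- exact: subset_trans abS.
Qed.

End bump.

(** * Fundamental lemma of the calculus of variations *)

Section integrable_bounded.
Context d (T : measurableType d) (R : realType).
Variable mu : {measure set T -> \bar R}.

Lemma integrable_mul_bounded (D : set T) (f phi : T -> R) (C : R) :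
  measurable D -> mu.-integrable D (EFin \o f) -> measurable_fun D phi ->
  (forall x, `|phi x| <= C) -> mu.-integrable D (EFin \o (fun x => f x * phi x)).
Proof.
move=> mD fi mphi phiC.
have mf : measurable_fun D f by have /measurable_EFinP := measurable_int mu fi.
apply: (@le_integrable _ _ _ mu _ mD _ (EFin \o (fun x => C * f x))).
- by apply/measurable_EFinP; exact: measurable_funM.
- move=> x Dx /=; rewrite lee_fin !normrM mulrC ler_wpM2r//.
  exact: le_trans (phiC x) (ler_norm _).
- under [X in _.-integrable _ X]eq_fun do rewrite EFinM.
  exact: integrableZl.
Qed.

Lemma Rintegral_eq0 (D : set T) (f : T -> R) : measurable D ->
  mu.-integrable D (EFin \o f) -> \int[mu]_(x in D) f x = 0 ->
  (\int[mu]_(x in D) (f x)%:E = 0)%E.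
Proof.
by move=> mD fi f0; rewrite -[LHS]fineK ?integrable_fin_num// -/(Rintegral _ _ _) f0.
Qed.

End integrable_bounded.

Section open_boxes.
Context (R : realType) (n : nat).

Definition open_boxes : set (set 'rV[R]_n) :=
  [set B | exists a b : 'I_n -> R, B = box (fun j => `]a j, b j[%classic)].

Lemma setI_open_box (a b a' b' : 'I_n -> R) :
  box (fun j => `]a j, b j[%classic) `&` box (fun j => `]a' j, b' j[%classic) =
  box (fun j => `]Num.max (a j) (a' j), Num.min (b j) (b' j)[%classic).
Proof.
apply/seteqP; split => [x [ab ab'] j|x ab].
  have := ab j; have := ab' j; rewrite /= !in_itv/= => /andP[? ?] /andP[? ?].
  by rewrite gt_max lt_min; apply/andP; split; apply/andP.
split => j; have := ab j; rewrite /= !in_itv/= gt_max lt_min => /andP[/andP[? ?] /andP[? ?]];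
  exact/andP.
Qed.

Lemma setI_closed_open_boxes : setI_closed open_boxes.
Proof.
move=> _ _ [a [b ->]] [a' [b' ->]]; rewrite setI_open_box.
by exists (fun j => Num.max (a j) (a' j)), (fun j => Num.min (b j) (b' j)).
Qed.

(** The preimage of an open interval under a coordinate is open, hence a countable union of cubes,
    and every cube is an open box. *)
Lemma measurable_open_boxes : measurable `<=` <<s open_boxes >>.
Proof.
apply: smallest_sub; first exact: smallest_sigma_algebra.
move=> C; rewrite -bigcup_seq => -[i _ [Y mY <-]].
suff : measurable `<=`
    image_set_system setT (fun x : 'rV[R]_n => x ord0 i) <<s open_boxes >>.
  exact.
rewrite [X in X `<=` _]RGenOpens.measurableE.
apply: smallest_sub; first exact/sigma_algebra_image/smallest_sigma_algebra.
move=> _ [a [b ->]]; rewrite /image_set_system /= setTI.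
rewrite (open_bigcup_cubes (U := (fun x : 'rV[R]_n => x ord0 i) @^-1` `]a, b[)); last first.
  apply: open_comp; first by move=> x _; exact: coord_continuous.
  exact: itv_open.
have [s0 _ sU] := @smallest_sigma_algebra _ setT open_boxes.
rewrite bigcup_mkcond; apply: sU => k; case: ifP => _ //.
have [r0|r0] := ltP 0 (@rational_cube R n k).2.
  by apply: sub_sigma_algebra; rewrite ball_box//; do 2 eexists.
rewrite (_ : ball _ _ = set0)//; apply/seteqP; split => // y [].
by rewrite ltNge r0.
Qed.

End open_boxes.

Section flcv.
Context (R : realType) (n : nat).
Local Notation mu := (lebesgue_rV R n).
Variables (V : set 'rV[R]_n) (g : 'rV[R]_n -> R).
Hypotheses (oV : open V) (gi : mu.-integrable setT (EFin \o g)).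
Hypothesis g0 : forall phi, test_function V phi -> \int[mu]_x (g x * phi x) = 0.

(** Since the closed box lies in V, the bumps are test functions; they are bounded by 1 and tend to
    the indicator of the open box, so dominated convergence applies. *)
Let integral_box0 a b : box (fun j => `[a j, b j]%classic) `<=` V ->
  (\int[mu]_(x in box (fun j => `]a j, b j[%classic)) (g x)%:E = 0)%E.
Proof.
move=> abV; have mB : measurable (box (fun j => `]a j, b j[%classic)).
  by apply: measurable_box => j; exact: measurable_itv.
have mg : measurable_fun setT g by have /measurable_EFinP := measurable_int mu gi.
have mb k : measurable_fun setT (bump a b k.+1%:R).
  apply: continuous_measurable_rV; have [/(_ 0%N)[]] := test_function_bump (ltr0Sn R k) abV.
  by [].
have bi k : mu.-integrable setT (EFin \o (fun x => g x * bump a b k.+1%:R x)).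
  apply: (@integrable_mul_bounded _ _ _ mu setT g _ 1) => //.
  by move=> x; rewrite ger0_norm ?bump_ge0// bump_le1.
have [||||| _ _] := @dominated_convergence _ _ _ mu setT measurableT
  (fun k => EFin \o (fun x => g x * bump a b k.+1%:R x))
  (EFin \o (fun x => g x * (x \in box (fun j => `]a j, b j[%classic))%:R))
  (abse \o (EFin \o g)).
- by move=> k; exact: measurable_int (bi k).
- apply/measurable_EFinP; apply: measurable_funM => //.
  exact: (measurable_indic mB).
- apply: aeW => x _; apply: cvg_EFin; first exact: nearW.
  by apply: cvgM; [exact: cvg_cst|exact: cvg_bump].
- exact: integrable_abse.
- apply: aeW => x k _ /=; rewrite lee_fin normrM (ger0_norm (bump_ge0 _ _ _ _)).
  by rewrite ler_piMr// bump_le1.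
have E k : (\int[mu]_x (g x * bump a b k.+1%:R x)%:E = 0)%E.
  apply: Rintegral_eq0 => //.
  by apply: g0; exact: test_function_bump.
rewrite [X in X @ _ --> _ -> _](_ : _ = cst 0%E); last by apply/funext => k; exact: E.
move=> H; transitivity (\int[mu]_x (g x * (x \in box (fun j => `]a j, b j[%classic))%:R)%:E)%E.
  rewrite integral_mkcond; apply: eq_integral => x _; rewrite patchE.
  by case: ifP; rewrite ?mulr1 ?mulr0.
exact: (cvg_unique _ H (cvg_cst _)).
Qed.

(** Cutting g off outside the cube keeps its integral zero over every open box, because the box
    meets the cube in an open box with closure in V. The sets of zero integral form a Dynkin system,
    so all Borel sets follow. *)
Let ae0_cube c r : 0 < r -> ball c (r *+ 2) `<=` V ->
  {ae mu, forall x, ball c r x -> g x = 0}.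
Proof.
move=> r0 crV; pose Q := ball c r.
have mQ : measurable Q by exact: measurable_ball_rV.
pose h := (EFin \o g) \_ Q.
have hi : mu.-integrable setT h by exact/(integrable_mkcond _ mQ)/(integrableS measurableT).
have h0 A : measurable A -> (\int[mu]_(x in A) h x = 0)%E.
  have hiA B : measurable B -> mu.-integrable B h by move=> mB; exact: (integrableS measurableT).
  (* The total integral has to vanish for the class of sets to be closed under complements. *)
  have hQ : (\int[mu]_(x in setT) h x = 0)%E.
    rewrite -integral_mkcond /Q ball_box//; apply: integral_box0 => x cx.
    apply: crV; rewrite ball_box ?mulrn_wgt0// => j; have := cx j.
    by rewrite /= !in_itv/= mulr2n => /andP[? ?]; apply/andP; split; lra.
  move=> /measurable_open_boxes; move: A.
  suff : <<s @open_boxes R n >> `<=`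
    [set A | measurable A /\ (\int[mu]_(x in A) h x = 0)%E] by move=> + A => /[apply] -[].
  apply: lambda_system_subset => //; first exact: setI_closed_open_boxes.
    apply/dynkin_lambda_system; split => //=.
      move=> A [mA A0]; split; first exact: measurableC.
      have := hQ; rewrite -(setUv A) integral_setU //.
      - by rewrite A0 add0e.
      - exact: measurableC.
      - by rewrite setUv; exact: measurable_int hi.
      - exact/disj_setPCl.
    move=> F tF F0; split; first by apply: bigcup_measurable => k _; case: (F0 k).
    rewrite integral_bigcup//; first by rewrite eseries0// => k _ _; case: (F0 k).
      by move=> k; case: (F0 k).
    by apply: hiA; apply: bigcup_measurable => k _; case: (F0 k).
  move=> _ [a [b ->]]; have mB : measurable (box (fun j => `]a j, b j[%classic)).
    by apply: measurable_box => j; exact: measurable_itv.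
  split => //; rewrite /h -integral_mkcondr /Q ball_box// setI_open_box.
  apply: integral_box0 => x abx; apply: crV.
  rewrite ball_box ?mulrn_wgt0// => j; have := abx j.
  rewrite /= !in_itv/= mulr2n ge_max le_min.
  by move=> /andP[/andP[? ?] /andP[? ?]]; apply/andP; split; lra.
have : ae_eq mu setT h (cst 0%E).
  apply: integral_ae_eq => // A _ mA; rewrite h0// integral0//.
by apply: filterS => x /(_ I) + Qx; rewrite /h patchE mem_set//= => -[].
Qed.

Lemma fundamental_lemma : {ae mu, forall x, V x -> g x = 0}.
Proof.
have : {ae mu, forall x, forall k, ball (rational_cube R n k).1 (rational_cube R n k).2 x ->
    ball (rational_cube R n k).1 ((rational_cube R n k).2 *+ 2) `<=` V -> g x = 0}.
  apply/ae_foralln => k.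
  have [kV|kV] := pselect (ball (rational_cube R n k).1 ((rational_cube R n k).2 *+ 2) `<=` V).
    have [r0|r0] := ltP 0 (rational_cube R n k).2.
      by apply: filterS (ae0_cube r0 kV) => x + /[swap] _.
    by apply: aeW => x [+ _]; rewrite ltNge r0.
  exact: aeW.
apply: filterS => x gx Vx; move: Vx; rewrite (open_bigcup_cubes oV).
by move=> [k kV cx]; exact: gx cx kV.
Qed.

End flcv.

(** * Weak derivatives along segments *)

Section Rintegral_fubini.
Context d1 d2 (T1 : measurableType d1) (T2 : measurableType d2) (R : realType).
Variables (m1 : {sigma_finite_measure set T1 -> \bar R})
  (m2 : {sigma_finite_measure set T2 -> \bar R}).
Variable H : T1 * T2 -> R.
Hypothesis Hi : (m1 \x m2)%E.-integrable setT (EFin \o H).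

(** Partial integrals are finite only almost everywhere, and [fine] replaces infinite values by 0;
    neither integrability nor the integral is affected. *)
Let fine_integrable d (T : measurableType d) (m : {measure set T -> \bar R})
    (F : T -> \bar R) : m.-integrable setT F ->
  m.-integrable setT (EFin \o (fine \o F)) /\
  (\int[m]_x (fine (F x))%:E = \int[m]_x F x)%E.
Proof.
move=> Fi; have mF := measurable_int m Fi.
have mfF : measurable_fun setT (EFin \o (fine \o F)).
  by apply/measurable_EFinP; exact: measurableT_comp.
split.
  apply: (le_integrable measurableT mfF _ Fi) => x _ /=.
  by case: (F x) => [r| |]; rewrite /= ?leey// normr0.
apply: ae_eq_integral => //.
have := integrable_ae measurableT Fi; apply: filterS => x + _ => /(_ I).
by move/fineK.
Qed.

Lemma integrable_Rintegral1 :
  m1.-integrable setT (EFin \o (fun x => \int[m2]_y H (x, y))).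
Proof. by have [] := fine_integrable (integrable_fubini_F Hi). Qed.

Let integrable_fubini_G : m2.-integrable setT (fubini_G m1 (EFin \o H)).
Proof.
have mH := measurable_int _ Hi.
have mH' := measurableT_comp (@abse_measurable R setT) mH.
apply/integrableP; split; first exact: measurable_fubini_G Hi.
apply: le_lt_trans ((integrable21ltyP _ _ mH).1 Hi); apply: ge0_le_integral => //.
- by apply: measurableT_comp => //; exact: measurable_fubini_G Hi.
- by apply: (measurable_fun_fubini_tonelli_G (abse \o (EFin \o H))) => // x /=.
- move=> y _; apply: le_abse_integral => //.
  exact: (measurableT_comp mH (measurable_pair2 y)).
Qed.

Lemma integrable_Rintegral2 :
  m2.-integrable setT (EFin \o (fun y => \int[m1]_x H (x, y))).
Proof. by have [] := fine_integrable integrable_fubini_G. Qed.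

Lemma Rintegral_fubini :
  \int[m1]_x (\int[m2]_y H (x, y)) = \int[m2]_y (\int[m1]_x H (x, y)).
Proof.
have [_ E1] := fine_integrable (integrable_fubini_F Hi).
have [_ E2] := fine_integrable integrable_fubini_G.
rewrite /Rintegral; congr fine; rewrite -[LHS]/(\int[m1]_x (fine (fubini_F m2 (EFin \o H) x))%:E)%E E1.
rewrite -[RHS]/(\int[m2]_x (fine (fubini_G m1 (EFin \o H) x))%:E)%E E2.
exact: Fubini.
Qed.

End Rintegral_fubini.

Section one_dim.
Context (R : realType).
Implicit Types (F f : R -> R).

Lemma MVT_signed F f s t : (forall x : R, is_derive x 1 F (f x)) ->
  exists2 c, `|c - s| <= `|t| & F (s + t) - F s = f c * t.
Proof.
move=> dF.
have cF a b : {within `[a, b], continuous F}.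
  apply: continuous_subspaceT => x; apply: differentiable_continuous.
  by apply/derivable1_diffP; case: (dF x).
have [t0|t0] := leP 0 t.
  have [|c] := @MVT_segment R F f s (s + t) _ (fun x _ => dF x) (cF _ _).
    by rewrite lerDl.
  rewrite in_itv/= => /andP[sc cst] E; exists c.
    by rewrite !ger0_norm ?subr_ge0// lerBlDl.
  by rewrite E addrAC subrr add0r.
have [|c] := @MVT_segment R F f (s + t) s _ (fun x _ => dF x) (cF _ _).
  by rewrite gerDl ltW.
rewrite in_itv/= => /andP[stc cs] E; exists c.
  by rewrite ler0_norm ?subr_le0// ltr0_norm// opprB; lra.
by rewrite -opprB E; ring.
Qed.

Lemma lipschitz_continuous F K : (forall s t, `|F (s + t) - F s| <= K * `|t|) ->
  continuous F.
Proof.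
move=> FK s; apply/cvgrPdist_le => e e0.
have K0 : 0 <= K.
  by have := FK 0 1; rewrite normr1 mulr1; exact: le_trans.
have K1 : 0 < K + 1 by rewrite ltr_wpDl.
exists (e / (K + 1)) => /= [|x]; first by rewrite divr_gt0.
rewrite /ball_/= distrC ltr_pdivlMr// => xs; rewrite distrC.
have := FK s (x - s); rewrite subrKC => /le_trans; apply.
apply: le_trans (ltW xs).
by rewrite mulrC ler_wpM2l// lerDl.
Qed.

Lemma is_derive_quadratic F s b K :
  (forall t, `|F (s + t) - F s - t * b| <= K * t ^+ 2) -> is_derive s 1 F b.
Proof.
move=> FK.
have K0 : 0 <= K.
  by have := FK 1; rewrite expr1n mulr1; exact: le_trans.
suff H : h^-1 *: ((F \o shift s) (h *: 1) - F s) @[h --> 0^'] --> b.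
  by split; [apply/cvg_ex; exists b|apply/cvg_lim].
apply/cvgrPdist_le => e e0; near=> h.
have h0 : h != 0 by near: h; exact: nbhs_dnbhs_neq.
have he : `|h| <= e / (K + 1).
  by near: h; apply: dnbhs0_le; rewrite divr_gt0// ltr_wpDl.
rewrite /= scaler1 -[b](mulKf h0) -mulrBr normrM normfV ler_pdivrMl ?normr_gt0//.
rewrite distrC [h + s]addrC; apply: (le_trans (FK h)).
move: he; rewrite ler_pdivlMr ?ltr_wpDl// => he.
rewrite -real_normK ?num_real// expr2 mulrCA ler_wpM2l//.
by apply: le_trans he; rewrite mulrDr mulr1 [K * _]mulrC lerDl.
Unshelve. all: by end_near. Qed.

End one_dim.

Section test_functions.
Context (R : realType) (n : nat).
Implicit Types (S V : set 'rV[R]_n) (phi : 'rV[R]_n -> R) (h x : 'rV[R]_n).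
Local Notation e i := (delta_mx ord0 i : 'rV[R]_n).

Lemma test_function_shift V S phi h : test_function V phi ->
  (forall x, V x -> S (x + h)) -> test_function S (fun y => phi (y - h)).
Proof.
move=> [phiC cphi sphi] VS.
have cI : compact ((fun x => x + h) @` closure [set x | phi x != 0]).
  apply: continuous_compact => //; apply: continuous_subspaceT => x.
  by apply: (@continuousD _ _ _ idfun (cst h)); [move=> ?; exact: cvg_id|exact: cst_continuous].
have sub : closure [set y | phi (y - h) != 0] `<=`
    (fun x => x + h) @` closure [set x | phi x != 0].
  rewrite [X in _ `<=` X](closure_id _).1; last first.
    by apply: compact_closed => //; exact: norm_hausdorff.
  apply: closureS => y /= py; exists (y - h); last by rewrite subrK.
  exact: subset_closure.
split.
- by move=> m; exact: is_Ck_shift.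
- by apply: (subclosed_compact _ cI) => //; exact: closed_closure.
- by apply: (subset_trans sub) => _ [x /sphi Vx <-]; exact: VS.
Qed.

Lemma test_function_partial S phi i : test_function S phi ->
  test_function S (partial i phi).
Proof.
move=> [phiC cphi sphi].
have sub : closure [set y | partial i phi y != 0] `<=` closure [set x | phi x != 0].
  rewrite [X in _ `<=` X](closure_id _).1; last exact: closed_closure.
  apply: closureS => x /= px; apply: contrapT => nx; move/eqP: px; apply.
  have oC : open (~` closure [set x | phi x != 0]) by apply: closed_openC; exact: closed_closure.
  rewrite /partial (near_eq_derive _ (g := cst 0)) ?derive_cst//.
  have : nbhs x (~` closure [set x | phi x != 0]) by exact: open_nbhs_nbhs.
  apply: filterS => y ny; apply/eqP/negPn/negP => py; apply: ny.
  exact: subset_closure.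
split.
- by move=> m; apply: is_Ck_partial; exact: phiC.
- by apply: (subclosed_compact _ cphi) => //; exact: closed_closure.
- exact: subset_trans sphi.
Qed.

Lemma test_function_bounded S phi : test_function S phi ->
  exists2 C, 0 <= C & forall x, `|phi x| <= C.
Proof.
move=> [phiC cphi _].
have cc : {within closure [set x | phi x != 0], continuous phi}.
  by apply: continuous_subspaceT; exact: is_Ck_cont (phiC 0%N).
have [M [_ HM]] := compact_bounded (continuous_compact cc cphi).
exists (`|M| + 1) => [|x]; first by rewrite addr_ge0.
have [->|p0] := eqVneq (phi x) 0; first by rewrite normr0 addr_ge0.
apply: HM; first by rewrite ltr_pwDr// ler_norm.
by exists x => //; exact: subset_closure.
Qed.

Lemma test_function_measurable S phi : test_function S phi ->
  measurable_fun setT phi.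
Proof. by move=> [/(_ 0%N)/is_Ck_cont + _ _]; exact: continuous_measurable_rV. Qed.

Lemma test_function_lipschitz S phi i : test_function S phi ->
  exists2 C, 0 <= C &
    forall x (t : R), `|phi (x + t *: e i) - phi x| <= C * `|t|.
Proof.
move=> tp; have [C C0 pC] := test_function_bounded (test_function_partial i tp).
exists C => // x t; have [/(_ 1%N) phi1 _ _] := tp.
have [c _] := @MVT_signed R _ _ 0 t (fun s => is_Ck_line i x s phi1).
by rewrite add0r scale0r addr0 => ->; rewrite normrM ler_wpM2r.
Qed.

Lemma test_function_taylor S phi i : test_function S phi ->
  exists2 C, 0 <= C & forall x (t : R),
    `|phi (x + t *: e i) - phi x - t * partial i phi x| <= C * t ^+ 2.
Proof.
move=> tp; have [C C0 pC] := test_function_lipschitz i (test_function_partial i tp).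
exists C => // x t; have [/(_ 1%N) phi1 _ _] := tp.
have [c] := @MVT_signed R _ _ 0 t (fun s => is_Ck_line i x s phi1).
rewrite subr0 add0r scale0r addr0 => ct ->; rewrite [t * _]mulrC -mulrBl normrM.
rewrite -real_normK ?num_real// expr2 mulrA ler_wpM2r//.
by apply: (le_trans (pC _ _)); rewrite ler_wpM2l.
Qed.

End test_functions.

Section lines.
Context (R : realType) (n : nat) (i : 'I_n).
Local Notation mu := (lebesgue_rV R n).
Local Notation lambda := (@lebesgue_measure R).
Local Notation e := (delta_mx ord0 i : 'rV[R]_n).
Implicit Types (f G phi : 'rV[R]_n -> R) (x : 'rV[R]_n) (h s t : R).

Lemma measurable_along_line :
  measurable_fun setT (fun z : 'rV[R]_n * measurableTypeR R => z.1 + z.2 *: e).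
Proof.
apply: measurable_fun_rV => j; under eq_fun do rewrite !mxE.
apply: measurable_funD.
  exact: (measurableT_comp (@measurable_coord R n j) measurable_fst).
by apply: measurable_funM; [exact: measurable_snd|exact: measurable_cst].
Qed.

(** By Tonelli: for each s in [0, h] the slice is a translate of G and has the same L^1 norm. *)
Lemma integrable_along_line G h : mu.-integrable setT (EFin \o G) ->
  (mu \x lambda)%E.-integrable setT
    (EFin \o (fun z => G (z.1 + z.2 *: e) * \1_(`[0, h]%classic) z.2)).
Proof.
move=> Gi; have /measurable_EFinP mG := measurable_int mu Gi.
have mH : measurable_fun setT (EFin \o (fun z : 'rV[R]_n * measurableTypeR R =>
    G (z.1 + z.2 *: e) * \1_(`[0, h]%classic) z.2)).
  apply/measurable_EFinP; apply: measurable_funM.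
    exact: (measurableT_comp mG measurable_along_line).
  apply: (measurableT_comp _ measurable_snd).
  exact: (measurable_indic (measurable_itv _)).
apply/(integrable21ltyP _ _ mH).
rewrite [X in (X < _)%E](_ : _ =
  \int[lambda]_s ((\int[mu]_x `|(G x)%:E|) * (\1_(`[0, h]%classic) s)%:E))%E; last first.
  apply: eq_integral => s _.
  under eq_integral do rewrite /= normrM EFinM.
  rewrite ge0_integralZr//.
  - rewrite (ge0_integral_translation (s *: e) (f := fun x => (`|G x|)%:E))//.
      by rewrite ger0_norm.
    by apply/measurable_EFinP; exact: measurableT_comp.
  - apply/measurable_EFinP; apply: measurableT_comp => //.
    exact: (measurableT_comp mG (measurable_translation (s *: e))).
have Gfin : (\int[mu]_x `|(G x)%:E|)%E \is a fin_num.
  by rewrite ge0_fin_numE ?integral_ge0//; exact: (integrableP _ _ _ Gi).2.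
rewrite ge0_integralZl//; last 2 first.
- by apply/measurable_EFinP; exact: (measurable_indic (measurable_itv _)).
- exact: integral_ge0.
rewrite integral_indic// setIT lte_mul_pinfty ?integral_ge0//.
suff : (lambda `[0%R, h]%classic < +oo)%E by [].
by rewrite lebesgue_measure_itv/=; case: ifP => _; rewrite ?ltry// -EFinB ltry.
Qed.

Definition line_integral G h x : R := \int[lambda]_(s in `[0, h]) G (x + s *: e).

Lemma line_integralE G h x :
  line_integral G h x = \int[lambda]_s (G (x + s *: e) * \1_(`[0, h]%classic) s).
Proof.
rewrite /line_integral Rintegral_mkcond; apply: eq_Rintegral => s _.
by rewrite patchE indicE; case: ifP; rewrite ?mulr1 ?mulr0.
Qed.

Lemma integrable_line_integral G h : mu.-integrable setT (EFin \o G) ->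
  mu.-integrable setT (EFin \o line_integral G h).
Proof.
move=> Gi; have := integrable_Rintegral1 (integrable_along_line h Gi).
by congr (mu.-integrable _ (_ \o _)); apply/funext => x; rewrite line_integralE.
Qed.

Lemma Rintegral_line_integral G phi C h : mu.-integrable setT (EFin \o G) ->
  measurable_fun setT phi -> (forall x, `|phi x| <= C) ->
  \int[mu]_x (line_integral G h x * phi x) =
  \int[lambda]_(s in `[0, h]) (\int[mu]_x (G (x + s *: e) * phi x)).
Proof.
move=> Gi mphi phiC.
have Hi := integrable_along_line h Gi.
have Hphi : (mu \x lambda)%E.-integrable setT (EFin \o (fun z =>
    G (z.1 + z.2 *: e) * \1_(`[0, h]%classic) z.2 * phi z.1)).
  apply: (integrable_mul_bounded measurableT Hi) => [|z]; last exact: phiC.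
  exact: (measurableT_comp mphi measurable_fst).
transitivity (\int[mu]_x \int[lambda]_s
    (G (x + s *: e) * \1_(`[0, h]%classic) s * phi x)).
  have := ae_integrable1 Hi.
  move=> ae1; rewrite /Rintegral; congr fine; apply: ae_eq_integral => //.
  - have /measurable_EFinP ml := measurable_int _ (integrable_line_integral h Gi).
    by apply/measurable_EFinP; exact: measurable_funM.
  - exact: measurable_int (integrable_Rintegral1 Hphi).
  apply: filterS ae1 => x Hx _; congr EFin; rewrite line_integralE -RintegralZr//.
rewrite (Rintegral_fubini Hphi) [RHS]Rintegral_mkcond; apply: eq_Rintegral => s _.
rewrite patchE; case: ifPn => hs.
  by apply: eq_Rintegral => x _; rewrite indicE hs mulr1.
transitivity (\int[mu]_x (0 : R)); last by rewrite Rintegral_cst// mul0r.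
apply: eq_Rintegral => x _; by rewrite indicE (negbTE hs) mulr0 mul0r.
Qed.

Lemma integrable_line_pairing G phi C h : mu.-integrable setT (EFin \o G) ->
  measurable_fun setT phi -> (forall x, `|phi x| <= C) ->
  lambda.-integrable `[0, h] (EFin \o (fun s => \int[mu]_x (G (x + s *: e) * phi x))).
Proof.
move=> Gi mphi phiC.
have Hphi : (mu \x lambda)%E.-integrable setT (EFin \o (fun z =>
    G (z.1 + z.2 *: e) * \1_(`[0, h]%classic) z.2 * phi z.1)).
  apply: (integrable_mul_bounded measurableT (integrable_along_line h Gi)) => [|z]; last exact: phiC.
  exact: (measurableT_comp mphi measurable_fst).
apply/integrable_mkcond => //; apply: eq_integrable (integrable_Rintegral2 Hphi) => // s _.
rewrite patchE /=; case: ifPn => hs.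
  by congr EFin; apply: eq_Rintegral => x _; rewrite indicE hs mulr1.
congr EFin; transitivity (\int[mu]_x (0 : R)); last by rewrite Rintegral_cst// mul0r.
by apply: eq_Rintegral => x _; rewrite indicE (negbTE hs) mulr0 mul0r.
Qed.

End lines.

Section Rintegral_mul_bound.
Context d (T : measurableType d) (R : realType) (mu : {measure set T -> \bar R}).

Lemma Rintegral_mul_bound (f w : T -> R) (K : R) :
  mu.-integrable setT (EFin \o f) -> measurable_fun setT w ->
  (forall x, `|w x| <= K) ->
  `|\int[mu]_x (f x * w x)| <= K * \int[mu]_x `|f x|.
Proof.
move=> fi mw wK; have fwi := integrable_mul_bounded measurableT fi mw wK.
apply: (le_trans (le_normr_Rintegral measurableT fwi)).
have fai := integrable_norm fi.
rewrite -RintegralZl//; apply: le_Rintegral => //.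
- exact: integrable_norm fwi.
- by under [X in _.-integrable _ X]eq_fun do rewrite /= EFinM; exact: integrableZl.
- by move=> x _; rewrite normrM mulrC ler_wpM2r.
Qed.

End Rintegral_mul_bound.

(** The integrals run over the whole space while the test functions live in S. This form suits
    extensions by zero, to which translations can be applied without leaving the domain. *)
Definition weak_partial (R : realType) n (S : set 'rV[R]_n) (i : 'I_n)
    (f G : 'rV[R]_n -> R) :=
  forall phi, test_function S phi ->
    \int[lebesgue_rV R n]_x (f x * partial i phi x) =
    - \int[lebesgue_rV R n]_x (G x * phi x).

Section weak_partial_line.
Context (R : realType) (n : nat) (i : 'I_n).
Local Notation mu := (lebesgue_rV R n).
Local Notation e := (delta_mx ord0 i : 'rV[R]_n).
Variables (S V : set 'rV[R]_n) (f G : 'rV[R]_n -> R) (h : R).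
Hypotheses (fi : mu.-integrable setT (EFin \o f)) (Gi : mu.-integrable setT (EFin \o G)).
Hypotheses (fG : weak_partial S i f G) (oV : open V) (h0 : 0 <= h).
Hypothesis VS : forall x s, V x -> 0 <= s <= h -> S (x + s *: e).

Section against_test_function.
Variables (phi : 'rV[R]_n -> R).
Hypothesis tphi : test_function V phi.

Let pairing (F : 'rV[R]_n -> R) s := \int[mu]_y (F y * phi (y - s *: e)).

Let mshift h' : measurable_fun [set: 'rV[R]_n] (fun y => phi (y - h')).
Proof.
exact: (measurableT_comp (test_function_measurable tphi) (measurable_translation (- h'))).
Qed.

Let pairing_integrable (F : 'rV[R]_n -> R) s : mu.-integrable setT (EFin \o F) ->
  mu.-integrable setT (EFin \o (fun y => F y * phi (y - s *: e))).
Proof.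
move=> Fi; have [C _ phiC] := test_function_bounded tphi.
by apply: (integrable_mul_bounded measurableT Fi).
Qed.

Let shiftD y s t : y - (s + t) *: e = y - s *: e + (- t) *: e.
Proof. by rewrite scalerDl scaleNr opprD addrA. Qed.

Let pairing_continuous (F : 'rV[R]_n -> R) : mu.-integrable setT (EFin \o F) ->
  continuous (pairing F).
Proof.
move=> Fi; have [C C0 phiC] := test_function_lipschitz i tphi.
apply: (@lipschitz_continuous _ _ (C * \int[mu]_x `|F x|)) => s t.
rewrite /pairing -RintegralB//; try exact: pairing_integrable.
under eq_Rintegral do rewrite -mulrBr.
apply: (le_trans (Rintegral_mul_bound (K := C * `|t|) Fi _ _)).
- exact: measurable_funB.
- by move=> y; rewrite shiftD; apply: le_trans (phiC _ _) _; rewrite normrN.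
- by rewrite mulrAC.
Qed.

(** The s-derivative falls on the translated test function, which is admissible for S because V
    shifted by s e stays in S; the weak derivative then moves it to G. The Taylor remainder is
    quadratic in t uniformly in the space variable, so integrating it against f is harmless. *)
Let pairing_derive s : 0 <= s <= h -> is_derive s 1 (pairing f) (pairing G s).
Proof.
move=> sh; have [C C0 phiC] := test_function_taylor i tphi.
have tps : test_function S (fun y => phi (y - s *: e)).
  by apply: (test_function_shift tphi) => x Vx; exact: VS.
have [/(_ 1%N) phi1 _ _] := tphi.
have mp : measurable_fun [set: 'rV[R]_n] (fun y => partial i phi (y - s *: e)).
  exact: (measurableT_comp (test_function_measurable (test_function_partial i tphi))
    (measurable_translation (- (s *: e)))).
have fpi : mu.-integrable setT (EFin \o (fun y => f y * partial i phi (y - s *: e))).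
  have [C' _ phiC'] := test_function_bounded (test_function_partial i tphi).
  by apply: (integrable_mul_bounded measurableT fi mp).
have bE : pairing G s = - \int[mu]_y (f y * partial i phi (y - s *: e)).
  apply: oppr_inj; rewrite opprK; apply: (etrans (esym (fG tps))).
  apply: eq_Rintegral => y _; congr (_ * _).
  exact: (@partial_shift R n 0 phi (- (s *: e)) i y phi1).
apply: (@is_derive_quadratic _ _ _ _ (C * \int[mu]_x `|f x|)) => t.
rewrite bE mulrN opprK /pairing -RintegralZl// -RintegralB//; try exact: pairing_integrable.
rewrite -RintegralD//; last first.
- by under [X in _.-integrable _ X]eq_fun do rewrite /= EFinM; exact: integrableZl.
- by rewrite (_ : _ \o _ = (fun y => (f y * phi (y - (s + t) *: e))%:E) \-
    (fun y => (f y * phi (y - s *: e))%:E))%E//; apply: integrableB => //;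
    exact: pairing_integrable.
rewrite (_ : \int[mu]_x _ = \int[mu]_x (f x * (phi (x - (s + t) *: e) - phi (x - s *: e) +
    t * partial i phi (x - s *: e)))); last first.
  by apply: eq_Rintegral => y _; ring.
apply: (le_trans (Rintegral_mul_bound (K := C * t ^+ 2) fi _ _)).
- apply: measurable_funD; first exact: measurable_funB.
  by apply: measurable_funM.
- move=> y; rewrite shiftD; have := phiC (y - s *: e) (- t).
  by rewrite mulNr opprK sqrrN.
- by rewrite mulrAC.
Qed.

(** The fundamental theorem of calculus for the pairing in s, with Fubini's theorem to recognise its
    right-hand side as the pairing of the line integral. *)
Lemma weak_partial_pairing : 0 < h ->
  \int[mu]_x ((f (x + h *: e) - f x - line_integral i G h x) * phi x) = 0.
Proof.
move=> hgt0; have [C C0 phiC] := test_function_bounded tphi.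
have mphi := test_function_measurable tphi.
have pairing_shift (F : 'rV[R]_n -> R) s : mu.-integrable setT (EFin \o F) ->
    pairing F s = \int[mu]_x (F (x + s *: e) * phi x).
  move=> Fi.
  apply: (etrans (esym (Rintegral_translation (s *: e) (pairing_integrable s Fi)))).
  by apply: eq_Rintegral => x _; rewrite addrK.
have ftc : \int[@lebesgue_measure R]_(s in `[0, h]) pairing G s = pairing f h - pairing f 0.
  rewrite /Rintegral (@continuous_FTC2 _ _ (pairing f))//.
  - by apply: continuous_subspaceT; exact: pairing_continuous.
  - split.
    + move=> s; rewrite in_itv/= => /andP[s0 sh].
      have /pairing_derive[//] : 0 <= s <= h by rewrite !ltW.
    + by apply: cvg_at_right_filter; exact: pairing_continuous.
    + by apply: cvg_at_left_filter; exact: pairing_continuous.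
  - move=> s; rewrite in_itv/= => /andP[s0 sh]; rewrite derive1E.
    have /pairing_derive[_ ->//] : 0 <= s <= h by rewrite !ltW.
have lE : \int[mu]_x (line_integral i G h x * phi x) = pairing f h - pairing f 0.
  rewrite (Rintegral_line_integral i h Gi mphi phiC) -ftc.
  by apply: eq_Rintegral => s _; rewrite -pairing_shift.
have fhi := integrable_translation (h *: e) fi.
have muli F : mu.-integrable setT (EFin \o F) ->
    mu.-integrable setT (EFin \o (fun x => F x * phi x)).
  by move=> Fi; exact: (integrable_mul_bounded measurableT Fi).
under eq_Rintegral do rewrite 2!mulrBl.
rewrite RintegralB//.
- rewrite RintegralB//; [|exact: muli|exact: muli].
  rewrite lE (pairing_shift _ _ fi) (pairing_shift _ _ fi).
  rewrite [X in _ - X - _](_ : _ = \int[mu]_x (f (x + 0 *: e) * phi x)) ?subrr//.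
  by apply: eq_Rintegral => x _; rewrite scale0r addr0.
- rewrite (_ : _ \o _ = (fun y => (f (y + h *: e) * phi y)%:E) \-
    (fun y => (f y * phi y)%:E))%E//; apply: integrableB => //; first exact: (muli _ fhi).
  exact: muli.
- exact/muli/integrable_line_integral.
Qed.

End against_test_function.

(** The pairing identity holds for all test functions of V, so the fundamental lemma yields it
    pointwise. The exceptional null set depends on h. *)
Lemma weak_partial_line :
  {ae mu, forall x, V x -> f (x + h *: e) - f x = line_integral i G h x}.
Proof.
move: h0; rewrite le_eqVlt => /orP[/eqP h0'|hgt0].
  apply: aeW => x _; rewrite -h0' scale0r addr0 subrr /line_integral set_itv1.
  by rewrite Rintegral_set1.
have gi : mu.-integrable setT
    (EFin \o (fun x => f (x + h *: e) - f x - line_integral i G h x)).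
  rewrite (_ : _ \o _ = ((fun y => (f (y + h *: e))%:E) \-
    (fun y => (f y)%:E)) \- (EFin \o line_integral i G h))%E//.
  apply: integrableB => //; last exact: integrable_line_integral.
  by apply: integrableB => //; exact: (integrable_translation (h *: e) fi).
apply: filterS (fundamental_lemma oV gi _) => [x gx Vx|phi tphi].
  exact/subr0_eq/gx.
exact: weak_partial_pairing.
Qed.

End weak_partial_line.

Section Rintegral_extra.
Context d (T : measurableType d) (R : realType) (mu : {measure set T -> \bar R}).
Implicit Types f g : T -> R.

Lemma integrable_measurableR (D : set T) f : mu.-integrable D (EFin \o f) ->
  measurable_fun D f.
Proof. by move=> fi; have /measurable_EFinP := measurable_int mu fi. Qed.

Lemma integrableRD (D : set T) f g : measurable D -> mu.-integrable D (EFin \o f) ->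
  mu.-integrable D (EFin \o g) -> mu.-integrable D (EFin \o (fun x => f x + g x)).
Proof.
move=> mD fi gi; rewrite (_ : _ \o _ = (EFin \o f) \+ (EFin \o g))%E//.
exact: integrableD.
Qed.

Lemma integrableRB (D : set T) f g : measurable D -> mu.-integrable D (EFin \o f) ->
  mu.-integrable D (EFin \o g) -> mu.-integrable D (EFin \o (fun x => f x - g x)).
Proof.
move=> mD fi gi; rewrite (_ : _ \o _ = (EFin \o f) \- (EFin \o g))%E//.
exact: integrableB.
Qed.

Lemma integrableRZ (D : set T) (k : R) f : measurable D -> mu.-integrable D (EFin \o f) ->
  mu.-integrable D (EFin \o (fun x => k * f x)).
Proof.
move=> mD fi; under [X in _.-integrable _ X]eq_fun do rewrite /= EFinM.
exact: integrableZl.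
Qed.

Lemma integrableR_le (D : set T) f g : measurable D -> measurable_fun D f ->
  mu.-integrable D (EFin \o g) -> (forall x, D x -> `|f x| <= g x) ->
  mu.-integrable D (EFin \o f).
Proof.
move=> mD mf gi fg; apply: (le_integrable mD _ _ gi); first exact/measurable_EFinP.
by move=> x Dx /=; rewrite lee_fin (le_trans (fg x Dx))// ler_norm.
Qed.

Lemma ae_eq_Rintegral f g : measurable_fun setT f -> measurable_fun setT g ->
  {ae mu, forall x, f x = g x} -> \int[mu]_x f x = \int[mu]_x g x.
Proof.
move=> mf mg fg; rewrite /Rintegral; congr fine; apply: ae_eq_integral => //.
- exact/measurable_EFinP.
- exact/measurable_EFinP.
- by apply: filterS fg => x -> _.
Qed.

Lemma ae_le_Rintegral f g : mu.-integrable setT (EFin \o f) ->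
  mu.-integrable setT (EFin \o g) -> {ae mu, forall x, f x <= g x} ->
  \int[mu]_x f x <= \int[mu]_x g x.
Proof.
move=> fi gi fg.
have [mf mg] := (integrable_measurableR fi, integrable_measurableR gi).
have mfg : measurable_fun setT (fun x => Num.min (f x) (g x)) by exact: measurable_minr.
rewrite (@ae_eq_Rintegral f (fun x => Num.min (f x) (g x)))//; last first.
  by apply: filterS fg => x fgx; rewrite min_l.
apply: le_Rintegral => //; last by move=> x _; rewrite ge_min lexx orbT.
apply: (integrableR_le _ mfg (integrableRD _ (integrable_norm fi) (integrable_norm gi))) => // x _.
by case: (leP (f x) (g x)) => _ /=; rewrite ?lerDl ?lerDr ?normr_ge0.
Qed.

Definition tail f (M : R) (x : T) : R := `|f x| * (M < `|f x|)%R%:R.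

Lemma measurable_tail f M : measurable_fun setT f -> measurable_fun setT (tail f M).
Proof.
move=> mf; have mnf : measurable_fun setT (fun x => `|f x|) by exact: measurableT_comp.
apply: measurable_funM => //.
have mA : measurable [set x | M < `|f x|].
  rewrite (_ : mkset _ = (fun x => `|f x|) @^-1` `]M, +oo[); last first.
    by apply/seteqP; split => x /=; rewrite in_itv/= andbT.
  by rewrite -[X in measurable X]setTI; apply: mnf.
rewrite (_ : (fun x => _) = \1_[set x | M < `|f x|]); first exact: measurable_indic.
apply/funext => x; rewrite indicE; congr (nat_of_bool _)%:R.
by apply/idP/idP => [h|]; rewrite inE.
Qed.

Lemma tail_ge0 f M x : 0 <= tail f M x.
Proof. by rewrite mulr_ge0. Qed.

Lemma tail_le f M x : tail f M x <= `|f x|.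
Proof. by rewrite /tail; case: ltP => _; rewrite ?mulr1 ?mulr0. Qed.

Lemma integrable_tail f M : mu.-integrable setT (EFin \o f) ->
  mu.-integrable setT (EFin \o tail f M).
Proof.
move=> fi; apply: (integrableR_le _ _ (integrable_norm fi)) => // [|x _].
  exact/measurable_tail/integrable_measurableR.
by rewrite ger0_norm ?tail_ge0// tail_le.
Qed.

Lemma norm_le_tail f M x : 0 <= M -> `|f x| <= M + tail f M x.
Proof.
by rewrite /tail; case: ltP => fM M0; rewrite ?mulr1 ?mulr0 ?addr0// lerDr.
Qed.

Lemma cvg_tail f : mu.-integrable setT (EFin \o f) ->
  (\int[mu]_x tail f k%:R x) @[k --> \oo] --> 0.
Proof.
move=> fi; have mf := integrable_measurableR fi.
have [||||| _ _] := @dominated_convergence _ _ _ mu setT measurableT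
  (fun k => EFin \o tail f k%:R) (cst 0%E) (abse \o (EFin \o f)).
- by move=> k; apply/measurable_EFinP; exact: measurable_tail.
- exact: measurable_cst.
- apply: aeW => x _; apply: cvg_near_cst; near=> k.
  rewrite /= /tail ltNge (_ : `|f x| <= k%:R) ?mulr0//.
  near: k; exact: nbhs_infty_ger.
- exact: integrable_abse.
- by apply: aeW => x k _; rewrite lee_fin ger0_norm ?tail_ge0// tail_le.
rewrite integral0 => H; rewrite -[X in _ --> X]/(fine 0%E).
by apply: fine_cvg; apply: H.
Unshelve. all: by end_near. Qed.

End Rintegral_extra.

Section line_estimates.
Context (R : realType) (n : nat) (i : 'I_n).
Local Notation mu := (lebesgue_rV R n).
Local Notation lambda := (@lebesgue_measure R).
Local Notation e := (delta_mx ord0 i : 'rV[R]_n).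
Implicit Types (f G : 'rV[R]_n -> R) (x : 'rV[R]_n) (h s M : R).

Lemma lebesgue_itv0 h : 0 <= h -> lambda `[0, h]%classic = h%:E.
Proof.
by rewrite lebesgue_measure_itv/= lte_fin; case: ltgtP => //= [_ _|<-]; rewrite ?sube0.
Qed.

Lemma itv0_integrable_cst h M : lambda.-integrable `[0, h] (EFin \o (fun=> M)).
Proof.
apply: continuous_compact_integrable; first exact: segment_compact.
by apply: continuous_subspaceT => x; exact: cst_continuous.
Qed.

Lemma ae_line_integrable G h : mu.-integrable setT (EFin \o G) ->
  {ae mu, forall x, lambda.-integrable `[0, h] (EFin \o (fun s => G (x + s *: e)))}.
Proof.
move=> Gi; apply: filterS (ae_integrable1 (integrable_along_line i h Gi)) => x xi.
apply/integrable_mkcond => //; apply: eq_integrable xi => // s _.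
by rewrite patchE /= indicE; case: ifP => _; rewrite ?mulr1 ?mulr0.
Qed.

Lemma Rintegral_line_integral1 G h : 0 <= h -> mu.-integrable setT (EFin \o G) ->
  \int[mu]_x line_integral i G h x = h * \int[mu]_x G x.
Proof.
move=> h0 Gi; transitivity (\int[mu]_x (line_integral i G h x * cst 1 x)).
  by apply: eq_Rintegral => x _; rewrite mulr1.
rewrite (@Rintegral_line_integral _ _ _ _ _ 1)//; last by move=> x; rewrite normr1.
under eq_Rintegral do under eq_Rintegral do rewrite mulr1.
under eq_Rintegral do rewrite (Rintegral_translation _ Gi).
rewrite Rintegral_cst// mulrC; congr (_ * _).
exact: (congr1 fine (lebesgue_itv0 h0)).
Qed.

Lemma ae_norm_line_integral_le G h M : 0 <= h -> 0 <= M -> mu.-integrable setT (EFin \o G) ->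
  {ae mu, forall x, `|line_integral i G h x| <= M * h + line_integral i (tail G M) h x}.
Proof.
move=> h0 M0 Gi; have Ti := integrable_tail M Gi.
apply: filterS2 (ae_line_integrable h Gi) (ae_line_integrable h Ti) => x xG xT.
rewrite /line_integral; apply: (le_trans (le_normr_Rintegral _ xG)) => //.
have ci := itv0_integrable_cst h M.
apply: (@le_trans _ _ (\int[lambda]_(s in `[0, h]) (M + tail G M (x + s *: e)))).
  apply: le_Rintegral => //; [exact: integrable_norm|exact: integrableRD|].
  by move=> s _; exact: norm_le_tail.
rewrite RintegralD// Rintegral_cst// lerD2r ler_wpM2l//.
by rewrite le_eqVlt; apply/orP; left; apply/eqP; exact: (congr1 fine (lebesgue_itv0 h0)).
Qed.

(** The increment is a line integral of G on V, and the line integral of |G| has total mass h times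
    the norm of G. Only V is seen on the left, because segments starting elsewhere may leave S. *)
Lemma Rintegral_shift_le (S V : set 'rV[R]_n) f G h :
  mu.-integrable setT (EFin \o f) -> mu.-integrable setT (EFin \o G) ->
  weak_partial S i f G -> open V -> 0 <= h ->
  (forall x s, V x -> 0 <= s <= h -> S (x + s *: e)) ->
  \int[mu]_x (`|f (x + h *: e) - f x| * \1_V x) <= h * \int[mu]_x `|G x|.
Proof.
move=> fi Gi fG oV h0 VS; have Ni := integrable_norm Gi.
rewrite -Rintegral_line_integral1//; apply: ae_le_Rintegral.
- apply: (@integrable_mul_bounded _ _ _ _ _ _ _ 1) => //.
  + apply: integrable_norm; apply: integrableRB => //.
    exact: (integrable_translation (h *: e) fi).
  + by apply: measurable_indic; exact: open_measurable_rV.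
  + by move=> x; rewrite indicE; case: (_ \in _); rewrite ?normr1 ?normr0.
- exact: integrable_line_integral.
have := weak_partial_line fi Gi fG oV h0 VS.
apply: filterS2 (ae_line_integrable h Gi) => x xG xV.
have L0 : 0 <= line_integral i (fun x => `|G x|) h x by apply: Rintegral_ge0.
rewrite indicE; case: (boolP (x \in V)) => [/set_mem xV'|_]; last by rewrite mulr0.
by rewrite mulr1 xV//; exact: le_normr_Rintegral.
Qed.

End line_estimates.

(** * Chain rule for weak derivatives *)

Section margin.
Context (R : realType) (n : nat).
Implicit Types (S : set 'rV[R]_n).

Lemma test_function_margin S phi : open S -> test_function S phi ->
  exists V, exists2 r : R, 0 < r & [/\ open V, forall x, phi x != 0 -> V x &
    forall x (h : 'rV[R]_n), V x -> `|h| <= r -> S (x + h)].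
Proof.
move=> oS [_ cphi sphi].
have [r r0 rS] : exists2 r : R, 0 < r &
    forall x, closure [set x | phi x != 0] x -> ball x r `<=` S.
  have H x : closure [set x | phi x != 0] x ->
      \forall x' \near x & r \near (0 : R)^'+, ball x' r `<=` S.
    move=> /sphi Sx; have /nbhs_ballP[r /= r0 xrS] := open_nbhs_nbhs (conj oS Sx).
    near=> y s.
    have sr : s <= r / 2 by near: s; apply: nbhs_right_le; exact: divr_gt0.
    move=> z yz; apply: xrS; rewrite (splitr r).
    apply: (@ball_triangle _ _ y); first by near: y; apply: nbhsx_ballx; rewrite divr_gt0.
    exact: le_ball yz.
  have C := (compact_near_coveringP _).1 cphi R (0 : R)^'+ (fun r x => ball x r `<=` S) _ H.
  by have [r [r0 rS]] := filter_ex (filterI (nbhs_right_gt 0) (C _)); exists r.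
(* Points of V are within r / 2 of the support and a shift adds at most r / 4, which stays below the
   uniform margin r. *)
exists (\bigcup_(x in closure [set x | phi x != 0]) ball x (r / 2)), (r / 4).
  by rewrite divr_gt0.
split.
- by apply: bigcup_open => x _; exact: ball_open.
- move=> x px; exists x; first exact: subset_closure.
  by apply: ballxx; rewrite divr_gt0.
- move=> x h [y Cy yx] hr; apply: (rS y) => //.
  rewrite (splitr r); apply: ball_triangle yx _.
  rewrite -ball_normE /= opprD addrA subrr sub0r normrN.
  by apply: le_lt_trans hr _; lra.
Unshelve. all: by end_near. Qed.

End margin.

Lemma half_le (R : realFieldType) (eps K : R) : 0 <= K -> 0 < eps ->
  eps / (2 * (K + 1)) * K <= eps / 2.
Proof.
move=> K0 eps0; have K1 : 0 < K + 1 by rewrite ltr_wpDl.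
rewrite mulrAC ler_pdivrMr ?mulr_gt0// (_ : _ / 2 * _ = eps * (K + 1)); last by field.
by rewrite ler_wpM2l ?lerDl// ltW.
Qed.

Section chain_rule.
Context (R : realType) (n : nat) (i : 'I_n).
Local Notation mu := (lebesgue_rV R n).
Local Notation lambda := (@lebesgue_measure R).
Local Notation e := (delta_mx ord0 i : 'rV[R]_n).
Variables (S : set 'rV[R]_n) (f G : 'rV[R]_n -> R) (q dq : R -> R) (L B : R).
Hypotheses (oS : open S) (fi : mu.-integrable setT (EFin \o f))
  (Gi : mu.-integrable setT (EFin \o G)) (fG : weak_partial S i f G).
Hypotheses (q0 : q 0 = 0) (qdq : forall y : R, is_derive y 1 q (dq y)).
Hypotheses (dqL : forall y z, `|dq y - dq z| <= L * `|y - z|) (dqB : forall y, `|dq y| <= B).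

Let L0 : 0 <= L.
Proof. by have := dqL 1 0; rewrite subr0 normr1 mulr1; exact: le_trans. Qed.

Let B0 : 0 <= B.
Proof. exact: le_trans (dqB 0). Qed.

Let q_lipschitz a b : `|q b - q a| <= B * `|b - a|.
Proof.
have [c _] := MVT_signed a (b - a) qdq.
by rewrite subrKC => ->; rewrite normrM ler_wpM2r.
Qed.

Let q_taylor a b : `|q b - q a - dq a * (b - a)| <=
  Num.min (2 * B) (L * `|b - a|) * `|b - a|.
Proof.
have [c ca] := MVT_signed a (b - a) qdq.
rewrite subrKC => ->; rewrite -mulrBl normrM ler_wpM2r// le_min.
apply/andP; split; last by rewrite (le_trans (dqL _ _))// ler_wpM2l.
by apply: (le_trans (ler_normB _ _)); rewrite mulr_natl mulr2n lerD.
Qed.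

Let mq : measurable_fun setT q.
Proof.
apply: continuous_measurable_fun => x; apply: differentiable_continuous.
by apply/derivable1_diffP; case: (qdq x).
Qed.

Let mdq : measurable_fun setT dq.
Proof.
apply: continuous_measurable_fun; apply: (@lipschitz_continuous _ _ L) => s t.
by apply: (le_trans (dqL _ _)); rewrite addrAC subrr add0r.
Qed.

Let mf := integrable_measurableR fi.

Let qfi : mu.-integrable setT (EFin \o (q \o f)).
Proof.
apply: (integrableR_le _ (measurableT_comp mq mf)
  (integrableRZ B measurableT (integrable_norm fi))) => // x _ /=.
by have := q_lipschitz 0 (f x); rewrite q0 !subr0.
Qed.

Section test.
Variable phi : 'rV[R]_n -> R.
Hypothesis tphi : test_function S phi.

Let w x := dq (f x) * phi x.

Let mphi := test_function_measurable tphi.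

Let mw : measurable_fun setT w.
Proof. by apply: measurable_funM => //; exact: (measurableT_comp mdq mf). Qed.

Let W := \int[mu]_x (q (f x) * partial i phi x).
Let Z := \int[mu]_x (G x * w x).

(* Compares the difference quotients of q o f with those of f. The factor G is
   split at height M because a merely integrable G does not control the product
   of two small increments. *)
Lemma chain_rule_defect : exists2 r : R, 0 < r &
  exists2 c, 0 <= c & forall M, 0 <= M -> exists2 K, 0 <= K &
  forall h, 0 < h <= r -> `|W + Z| <= h * K + c * \int[mu]_x tail G M x.
Proof.
have [V [r r0 [oV phiV VS]]] := test_function_margin oS tphi.
(* The bound 2 on the sup norm is crude; it is compensated by admitting only steps up to r / 2. *)
have ne : `|e| <= 2.
  have : ball (0 : 'rV[R]_n) 2 e.
    split => // k j; rewrite /ball/= !mxE sub0r normrN.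
    by case: (_ && _); rewrite ?normr1 ?normr0// ltr1n.
  by rewrite -ball_normE /= sub0r normrN => /ltW.
have VSe x s h : h <= r / 2 -> V x -> 0 <= s <= h -> S (x + s *: e).
  move=> hr Vx /andP[s0 sh]; apply: VS => //; rewrite normrZ ger0_norm//.
  rewrite -(divfK (_ : 2 != 0 :> R) r)//; apply: ler_pM => //.
  exact: le_trans hr.
have [C C0 phiC] := test_function_bounded tphi.
have [C1 C10 phiC1] := test_function_lipschitz i tphi.
have [C2 C20 phiC2] := test_function_taylor i tphi.
have wC x : `|w x| <= B * C by rewrite normrM ler_pM.
pose N := \int[mu]_x `|G x|; pose Q := \int[mu]_x `|q (f x)|.
have N0 : 0 <= N by exact: Rintegral_ge0.
have Q0 : 0 <= Q by exact: Rintegral_ge0.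
exists (r / 2); first by rewrite divr_gt0.
(* The two terms are the tail coefficients of [stepb] and [stepd]. In the next witness, the first
   term comes from [stepa], the second from [stepb] and the bracket from [stepd], each divided by
   h. *)
exists (C * (2 * B) + 2 * B * C) => [|M M0]; first by rewrite addr_ge0// !mulr_ge0.
exists (C2 * Q + C * (L * M * N) + (B * C1 * N + M * L * C * N)) => [|h /andP[h0 hr]].
  by rewrite !addr_ge0// !mulr_ge0.
pose tau := \int[mu]_x tail G M x.
have Ti := integrable_tail M Gi.
have hh0 := ltW h0.
pose D x := f (x + h *: e) - f x.
pose qD x := q (f (x + h *: e)) - q (f x).
have Di : mu.-integrable setT (EFin \o D).
  by apply: integrableRB => //; exact: (integrable_translation (h *: e) fi).
have qDi : mu.-integrable setT (EFin \o qD).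
  by apply: integrableRB => //; exact: (integrable_translation (h *: e) qfi).
have mulphi F : mu.-integrable setT (EFin \o F) ->
    mu.-integrable setT (EFin \o (fun x => F x * phi x)).
  by move=> Fi; exact: (integrable_mul_bounded measurableT Fi).
have mulw F : mu.-integrable setT (EFin \o F) ->
    mu.-integrable setT (EFin \o (fun x => F x * w x)).
  by move=> Fi; exact: (integrable_mul_bounded measurableT Fi).
pose A := \int[mu]_x (qD x * phi x).
have mshift (F : 'rV[R]_n -> R) : measurable_fun setT F ->
    measurable_fun setT (fun x : 'rV[R]_n => F (x - h *: e)).
  by move=> mF; exact: (measurableT_comp mF (measurable_translation (- (h *: e)))).
(* Moving the translation onto phi shows that A is - h W up to a second-order Taylor error. *)
have stepa : `|A + h * W| <= C2 * h ^+ 2 * Q.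
  have i1 : mu.-integrable setT (EFin \o (fun y => q (f y) * phi (y - h *: e))).
    apply: (integrable_mul_bounded measurableT qfi (C := C)) => //.
    exact: (mshift phi).
  have mp := test_function_measurable (test_function_partial i tphi).
  have i2 : mu.-integrable setT (EFin \o (fun y => q (f y) * partial i phi y)).
    have [C3 _ pC3] := test_function_bounded (test_function_partial i tphi).
    exact: (integrable_mul_bounded measurableT qfi mp pC3).
  have i3 := mulphi _ qfi.
  have -> : A = \int[mu]_y (q (f y) * phi (y - h *: e)) - \int[mu]_y (q (f y) * phi y).
    rewrite /A; under eq_Rintegral do rewrite mulrBl.
    rewrite RintegralB//; last exact: (mulphi _ (integrable_translation (h *: e) qfi)).
    congr (_ - _); apply: (etrans _ (Rintegral_translation (h *: e) i1)).
    by apply: eq_Rintegral => x _; rewrite addrK.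
  rewrite /W -RintegralB// -RintegralZl// -RintegralD//; last 2 first.
    exact: integrableRB.
    exact: integrableRZ.
  rewrite (_ : \int[mu]_x _ = \int[mu]_x (q (f x) * (phi (x - h *: e) - phi x +
      h * partial i phi x))); last by apply: eq_Rintegral => y _; ring.
  apply: (Rintegral_mul_bound qfi).
  - by apply: measurable_funD; [apply: measurable_funB => //; exact: (mshift phi)|exact: measurable_funM].
  - by move=> y; have := phiC2 y (- h); rewrite scaleNr mulNr opprK sqrrN.
(* The Taylor error of q is at most min(2 B, L |D|) |D|, where |D| is at most M h plus the line
   integral of the tail of G. The part M h is paired with L |D|, whose integral is of order h; the
   tail part is paired with 2 B. *)
have stepb : `|A - \int[mu]_x (D x * w x)| <= C * (L * M * h * (h * N) + 2 * B * (h * tau)).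
  have DVi : mu.-integrable setT (EFin \o (fun x => `|D x| * \1_V x)).
    apply: (@integrable_mul_bounded _ _ _ _ _ _ _ 1) => //.
    - exact: integrable_norm.
    - by apply: measurable_indic; exact: open_measurable_rV.
    - by move=> x; rewrite indicE; case: (_ \in _); rewrite ?normr1 ?normr0.
  have Li := integrable_line_integral i h Ti.
  have Ri : mu.-integrable setT (EFin \o (fun x =>
      C * ((L * M * h) * (`|D x| * \1_V x) + 2 * B * line_integral i (tail G M) h x))).
    by apply: integrableRZ => //; apply: integrableRD => //; exact: integrableRZ.
  rewrite /A -RintegralB//; [|exact: mulphi|exact: mulw].
  have di : mu.-integrable setT (EFin \o (fun x => qD x * phi x - D x * w x)).
    by apply: integrableRB => //; [exact: mulphi|exact: mulw].
  apply: (le_trans (le_normr_Rintegral measurableT di)).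
  apply: (@le_trans _ _ (\int[mu]_x (C * ((L * M * h) * (`|D x| * \1_V x) +
      2 * B * line_integral i (tail G M) h x)))).
    apply: ae_le_Rintegral => //; first exact: integrable_norm.
    apply: filterS2 (weak_partial_line fi Gi fG oV hh0 (fun x s => @VSe x s h hr))
      (ae_norm_line_integral_le i hh0 M0 Gi) => x xV xM.
    have L1 : 0 <= line_integral i (tail G M) h x.
      by apply: Rintegral_ge0 => s _; exact: tail_ge0.
    rewrite /w mulrA -mulrBl normrM mulrC.
    have [p0|p0] := eqVneq (phi x) 0.
      by rewrite p0 normr0 mul0r mulr_ge0// addr_ge0// !mulr_ge0// indicE.
    apply: ler_pM => //.
    rewrite indicE mem_set ?mulr1; last exact: phiV.
    rewrite /qD /D mulrC; apply: (le_trans (q_taylor _ _)).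
    have DM : `|f (x + h *: e) - f x| <= M * h + line_integral i (tail G M) h x.
      by rewrite xV//; exact: phiV.
    set d := `|_ - _| in DM *.
    have d0 : 0 <= d by rewrite normr_ge0.
    have m0 : 0 <= Num.min (2 * B) (L * d) by rewrite le_min !mulr_ge0.
    apply: (le_trans (ler_wpM2l m0 DM)); rewrite mulrDr; apply: lerD.
      rewrite [X in _ <= X](_ : _ = (L * d) * (M * h)); last by ring.
      by rewrite ler_wpM2r ?mulr_ge0// ge_min lexx orbT.
    by rewrite ler_wpM2r// ge_min lexx.
  rewrite RintegralZl//; last by apply: integrableRD => //; exact: integrableRZ.
  rewrite RintegralD// ?RintegralZl//; try exact: integrableRZ.
  rewrite ler_wpM2l// lerD// ler_wpM2l ?mulr_ge0//.
    exact: (Rintegral_shift_le fi Gi fG oV hh0 (fun x s => @VSe x s h hr)).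
  by rewrite Rintegral_line_integral1.
pose b s := \int[mu]_x (G (x + s *: e) * w x).
have stepc : \int[mu]_x (D x * w x) = \int[lambda]_(s in `[0, h]) b s.
  rewrite -(Rintegral_line_integral i h Gi mw wC).
  have Li := integrable_line_integral i h Gi.
  apply: ae_eq_Rintegral; [exact/integrable_measurableR/mulw|exact/integrable_measurableR/mulw|].
  apply: filterS (weak_partial_line fi Gi fG oV hh0 (fun x s => @VSe x s h hr)) => x xV.
  rewrite /w; have [->|p0] := eqVneq (phi x) 0; first by rewrite !mulr0.
  by rewrite /D xV//; exact: phiV.
(* After translating back, G stays in place and only w moves. Where |G| <= M, the increment of dq o
   f is controlled by L times that of f, which has L^1 norm at most s N; elsewhere it is bounded by
   2 B. *)
have stepd s : 0 <= s <= h ->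
    `|b s - Z| <= h * (B * C1 * N + M * L * C * N) + 2 * B * C * tau.
  move=> /andP[s0 sh].
  have sr : s <= r / 2 by exact: le_trans hr.
  have mws : measurable_fun setT (fun y : 'rV[R]_n => w (y - s *: e)).
    exact: (measurableT_comp mw (measurable_translation (- (s *: e)))).
  have i1 : mu.-integrable setT (EFin \o (fun y => G y * w (y - s *: e))).
    exact: (integrable_mul_bounded measurableT Gi mws (fun y => wC _)).
  have -> : b s = \int[mu]_y (G y * w (y - s *: e)).
    apply: (etrans _ (Rintegral_translation (s *: e) i1)).
    by apply: eq_Rintegral => x _; rewrite addrK.
  rewrite /Z -RintegralB//; last exact: mulw.
  have di : mu.-integrable setT (EFin \o (fun y => G y * w (y - s *: e) - G y * w y)).
    by apply: integrableRB => //; exact: mulw.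
  apply: (le_trans (le_normr_Rintegral measurableT di)).
  pose dV x := `|f (x + s *: e) - f x| * \1_V x.
  have dVi : mu.-integrable setT (EFin \o dV).
    apply: (@integrable_mul_bounded _ _ _ _ _ _ _ 1) => //.
    - apply: integrable_norm; apply: integrableRB => //.
      exact: (integrable_translation (s *: e) fi).
    - by apply: measurable_indic; exact: open_measurable_rV.
    - by move=> x; rewrite indicE; case: (_ \in _); rewrite ?normr1 ?normr0.
  have dVi' := integrable_translation (- (s *: e)) dVi.
  have Ni := integrable_norm Gi.
  apply: (@le_trans _ _ (\int[mu]_y ((B * C1 * s) * `|G y| +
      ((M * L * C) * dV (y - s *: e) + (2 * B * C) * tail G M y)))).
    have r2 : mu.-integrable setT (EFin \o (fun y =>
        (M * L * C) * dV (y - s *: e) + (2 * B * C) * tail G M y)).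
      by apply: integrableRD => //; exact: integrableRZ.
    apply: le_Rintegral => //; first exact: integrable_norm.
      by apply: integrableRD => //; exact: integrableRZ.
    move=> y _; rewrite -mulrBr normrM.
    have dphi : `|phi (y - s *: e) - phi y| <= C1 * s.
      by have := phiC1 y (- s); rewrite scaleNr normrN (ger0_norm s0).
    have -> : w (y - s *: e) - w y = dq (f y) * (phi (y - s *: e) - phi y) +
        phi (y - s *: e) * (dq (f (y - s *: e)) - dq (f y)) by rewrite /w; ring.
    apply: (@le_trans _ _ (`|G y| * (B * (C1 * s) + C * Num.min (2 * B) (L *
        (`|f y - f (y - s *: e)| * \1_V (y - s *: e)))))).
      rewrite ler_wpM2l// (le_trans (ler_normD _ _))//.
      apply: lerD; rewrite normrM; first exact: ler_pM.
      have [p0|p0] := eqVneq (phi (y - s *: e)) 0.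
        by rewrite p0 normr0 mul0r mulr_ge0// le_min !mulr_ge0// indicE.
      rewrite ler_pM// le_min; apply/andP; split.
        by apply: (le_trans (ler_normB _ _)); rewrite mulr_natl mulr2n lerD.
      rewrite indicE mem_set ?mulr1; last exact: phiV.
      by rewrite (le_trans (dqL _ _))// distrC.
    rewrite /dV subrK; set dd := _ * \1_V _.
    have dd0 : 0 <= dd by rewrite mulr_ge0// indicE.
    rewrite mulrDr lerD//; first by rewrite le_eqVlt; apply/orP; left; apply/eqP; ring.
    rewrite /tail; case: ltP => GM; rewrite ?mulr1 ?mulr0 ?addr0.
      apply: (@le_trans _ _ (2 * B * C * `|G y|)); last by rewrite lerDr !mulr_ge0.
      rewrite [X in _ <= X](_ : _ = `|G y| * (C * (2 * B))); last by ring.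
      by rewrite ler_wpM2l// ler_wpM2l// ge_min lexx.
    rewrite [X in _ <= X](_ : _ = M * (C * (L * dd))); last by ring.
    apply: ler_pM => //; first by rewrite mulr_ge0// le_min !mulr_ge0.
    by rewrite ler_wpM2l// ge_min lexx orbT.
  rewrite RintegralD//; [|exact: integrableRZ|by apply: integrableRD => //; exact: integrableRZ].
  rewrite RintegralD//; [|exact: integrableRZ|exact: integrableRZ].
  rewrite !RintegralZl// (Rintegral_translation _ dVi).
  have dVs : \int[mu]_x dV x <= s * N.
    exact: (Rintegral_shift_le fi Gi fG oV s0 (fun x t => @VSe x t s sr)).
  rewrite -/N -/tau addrA lerD2r mulrDr lerD//.
    rewrite [X in _ <= X](_ : _ = B * C1 * h * N); last by ring.
    by rewrite ler_wpM2r// ler_wpM2l// mulr_ge0.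
  rewrite [X in _ <= X](_ : _ = (M * L * C) * (h * N)); last by ring.
  rewrite ler_wpM2l ?mulr_ge0//; apply: (le_trans dVs).
  by rewrite ler_wpM2r.
have stepe : `|\int[lambda]_(s in `[0, h]) b s - h * Z| <=
    h * (h * (B * C1 * N + M * L * C * N) + 2 * B * C * tau).
  have bi := integrable_line_pairing i h Gi mw wC.
  have lh : fine (lambda `[0, h]) = h by exact: (congr1 fine (lebesgue_itv0 hh0)).
  have -> : h * Z = \int[lambda]_(s in `[0, h]) Z by rewrite Rintegral_cst// mulrC lh.
  have ci := itv0_integrable_cst h.
  rewrite -RintegralB//.
  have di : lambda.-integrable `[0, h] (EFin \o (fun s => b s - Z)) by exact: integrableRB.
  apply: (le_trans (le_normr_Rintegral _ di)) => //.
  rewrite [X in _ <= X](_ : _ = \int[lambda]_(s in `[0, h])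
    (h * (B * C1 * N + M * L * C * N) + 2 * B * C * tau)); last first.
    by rewrite Rintegral_cst// mulrC lh.
  by apply: le_Rintegral => //; exact: integrable_norm.
rewrite -(ler_pM2l h0) -[X in X * `|_|]ger0_norm// -normrM.
have -> : h * (W + Z) = (A + h * W) - (A - \int[mu]_x (D x * w x)) -
   (\int[lambda]_(s in `[0, h]) b s - h * Z) by rewrite -stepc; ring.
apply: (le_trans (ler_normB _ _)).
have dist := le_trans (ler_normB (A + h * W) _) (lerD stepa stepb).
apply: (le_trans (lerD dist stepe)).
by rewrite le_eqVlt; apply/orP; left; apply/eqP; rewrite -/tau; ring.
Qed.

Lemma chain_rule_test : W = - Z.
Proof.
have [r r0 [c c0 H]] := chain_rule_defect.
apply/eqP; rewrite -addr_eq0 -normr_le0; apply/ler_addgt0Pl => eps eps0.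
rewrite addr0.
have := cvg_tail Gi; move/cvgrPdist_lt => /(_ (eps / (2 * (c + 1)))).
have c1 : 0 < c + 1 by rewrite ltr_wpDl.
have e2 : 0 < eps / (2 * (c + 1)) by rewrite divr_gt0// mulr_gt0.
move=> /(_ e2)[k _ /(_ k (leqnn k))]; rewrite sub0r normrN => tk.
(* The height is fixed before the step h, because K depends on it. *)
have [K K0 HK] := H k%:R (ler0n _ _).
pose h := Num.min r (eps / (2 * (K + 1))).
have K1 : 0 < K + 1 by rewrite ltr_wpDl.
have h0 : 0 < h by rewrite lt_min r0 divr_gt0// mulr_gt0.
have hr : 0 < h <= r by rewrite h0 ge_min lexx.
apply: (le_trans (HK h hr)).
have hK : h * K <= eps / 2.
  apply: (@le_trans _ _ (eps / (2 * (K + 1)) * K)).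
    by rewrite ler_wpM2r// ge_min lexx orbT.
  exact: half_le.
have ct : c * \int[mu]_x tail G k%:R x <= eps / 2.
  apply: (@le_trans _ _ (c * (eps / (2 * (c + 1))))).
    by rewrite ler_wpM2l// (le_trans (ler_norm _))// ltW.
  by rewrite mulrC half_le.
rewrite [eps]splitr lerD//.
Qed.

End test.

Lemma weak_partial_chain : weak_partial S i (q \o f) (fun x => dq (f x) * G x).
Proof.
move=> phi tphi; rewrite (chain_rule_test tphi); congr (- _).
by apply: eq_Rintegral => x _; ring.
Qed.

End chain_rule.

(** * Limits of weak derivatives, indicators and clamps *)

Lemma integrable_indic_lty d (T : measurableType d) (R : realType)
    (mu : {measure set T -> \bar R}) (A : set T) : measurable A ->
  (mu A < +oo)%E -> mu.-integrable setT (EFin \o (\1_A : T -> R)).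
Proof.
move=> mA Afin; apply/integrableP; split.
  by apply/measurable_EFinP; exact: measurable_indic.
under eq_integral do rewrite /= ger0_norm//.
by rewrite integral_indic// setIT.
Qed.

Section weak_partial_limits.
Context (R : realType) (n : nat) (i : 'I_n).
Local Notation mu := (lebesgue_rV R n).
Local Notation e := (delta_mx ord0 i : 'rV[R]_n).
Variable S : set 'rV[R]_n.

Lemma cvg_Rintegral_dominated (F : nat -> 'rV[R]_n -> R) (f g w : 'rV[R]_n -> R) C :
  (forall k, measurable_fun setT (F k)) -> measurable_fun setT f ->
  (forall x, F k x @[k --> \oo] --> f x) ->
  mu.-integrable setT (EFin \o g) -> (forall k x, `|F k x| <= g x) ->
  measurable_fun setT w -> (forall x, `|w x| <= C) ->
  \int[mu]_x (F k x * w x) @[k --> \oo] --> \int[mu]_x (f x * w x).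
Proof.
move=> mF mf Ff gi Fg mw wC.
have [||||| Hi _ H] := @dominated_convergence _ _ _ mu setT measurableT
  (fun k => EFin \o (fun x => F k x * w x)) (EFin \o (fun x => f x * w x))
  (EFin \o (fun x => C * g x)).
- by move=> k; apply/measurable_EFinP; exact: measurable_funM.
- by apply/measurable_EFinP; exact: measurable_funM.
- apply: aeW => x _; apply: cvg_EFin; first exact: nearW.
  by apply: cvgMr_tmp; exact: Ff.
- exact: integrableRZ.
- apply: aeW => x k _; rewrite lee_fin /= normrM mulrC ler_pM//.
by apply: fine_cvg; rewrite fineK ?integrable_fin_num.
Qed.

Lemma weak_partial_cvg (F G : nat -> 'rV[R]_n -> R) (f g gF gG : 'rV[R]_n -> R) :
  (forall k, weak_partial S i (F k) (G k)) ->
  (forall k, measurable_fun setT (F k)) -> measurable_fun setT f ->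
  (forall k, measurable_fun setT (G k)) -> measurable_fun setT g ->
  (forall x, F k x @[k --> \oo] --> f x) -> (forall x, G k x @[k --> \oo] --> g x) ->
  mu.-integrable setT (EFin \o gF) -> mu.-integrable setT (EFin \o gG) ->
  (forall k x, `|F k x| <= gF x) -> (forall k x, `|G k x| <= gG x) ->
  weak_partial S i f g.
Proof.
move=> FG mF mf mG mg Ff Gg gFi gGi FgF GgG phi tphi.
have [C _ phiC] := test_function_bounded tphi.
have [C' _ phiC'] := test_function_bounded (test_function_partial i tphi).
have mphi := test_function_measurable tphi.
have mdphi := test_function_measurable (test_function_partial i tphi).
have c1 := cvg_Rintegral_dominated mF mf Ff gFi FgF mdphi phiC'.
have c2 := cvg_Rintegral_dominated mG mg Gg gGi GgG mphi phiC.
have E : (fun k => \int[mu]_x (F k x * partial i phi x)) =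
    (fun k => - \int[mu]_x (G k x * phi x)) by apply/funext => k; exact: FG.
by rewrite E in c1; exact: (cvg_unique _ c1 (cvgN c2)).
Qed.

(** The indicator equals 1 near the support of phi, so translating phi by a small h e does not
    change its integral over S; comparing with the Taylor expansion bounds the integral of the
    partial derivative by a multiple of h. *)
Lemma weak_partial_indic : open S -> (mu S < +oo)%E -> weak_partial S i \1_S (cst 0).
Proof.
move=> oS Sfin phi tphi; have mS := open_measurable_rV oS.
have [V [r r0 [oV phiV VS]]] := test_function_margin oS tphi.
have [C2 C20 phiC2] := test_function_taylor i tphi.
have mphi := test_function_measurable tphi.
have [C C0 phiC] := test_function_bounded tphi.
have [C' C'0 phiC'] := test_function_bounded (test_function_partial i tphi).
have mdphi := test_function_measurable (test_function_partial i tphi).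
have Si : mu.-integrable setT (EFin \o (\1_S : _ -> R)).
  exact: integrable_indic_lty.
rewrite [X in _ = - X](_ : _ = 0); last first.
  transitivity (\int[mu]_x (0 : R)); last by rewrite Rintegral_cst// mul0r.
  by apply: eq_Rintegral => x _; rewrite mul0r.
rewrite oppr0; set W := \int[mu]_x _; pose N := \int[mu]_x `|\1_S x : R|.
have ne : 0 < `|e| + 1 by rewrite ltr_wpDl.
suff H h : 0 < h <= r / (`|e| + 1) -> `|W| <= h * (C2 * N).
  apply/eqP; rewrite -normr_le0; apply/ler_addgt0Pl => eps eps0; rewrite addr0.
  have K0 : 0 <= C2 * N by rewrite mulr_ge0// Rintegral_ge0.
  pose h := Num.min (r / (`|e| + 1)) (eps / (2 * (C2 * N + 1))).
  apply: (le_trans (H h _)).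
    by rewrite ge_min lexx lt_min !divr_gt0// mulr_gt0// ltr_wpDl.
  apply: (@le_trans _ _ (eps / (2 * (C2 * N + 1)) * (C2 * N))).
    by rewrite ler_wpM2r// ge_min lexx orbT.
  by apply: (le_trans (half_le K0 eps0)); lra.
move=> /andP[h0 hr].
have ms : measurable_fun setT (fun y : 'rV[R]_n => phi (y - h *: e)).
  exact: (measurableT_comp mphi (measurable_translation (- (h *: e)))).
have i1 : mu.-integrable setT (EFin \o (fun y => \1_S y * phi (y - h *: e))).
  exact: (integrable_mul_bounded measurableT Si ms (fun=> phiC _)).
have i2 : mu.-integrable setT (EFin \o (fun y => \1_S y * phi y)).
  exact: (integrable_mul_bounded measurableT Si mphi phiC).
have i3 : mu.-integrable setT (EFin \o (fun y => \1_S y * partial i phi y)).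
  exact: (integrable_mul_bounded measurableT Si mdphi phiC').
have E : \int[mu]_y (\1_S y * phi (y - h *: e)) = \int[mu]_y (\1_S y * phi y).
  apply: (etrans (esym (Rintegral_translation (h *: e) i1))).
  apply: eq_Rintegral => y _; rewrite addrK !indicE.
  have [->|py] := eqVneq (phi y) 0; first by rewrite !mulr0.
  have Vy := phiV _ py; rewrite !mem_set//.
    by rewrite -[y]addr0; apply: VS => //; rewrite normr0 ltW.
  apply: VS => //; rewrite normrZ gtr0_norm//.
  move: hr; rewrite ler_pdivlMr//; apply: le_trans.
  by rewrite ler_wpM2l ?ltW// ltrDl.
rewrite -(ler_pM2l h0) -[X in X * `|_|]gtr0_norm// -normrM.
have -> : h * W = \int[mu]_y (\1_S y * (phi (y - h *: e) - phi y + h * partial i phi y)).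
  rewrite -[LHS]add0r -(subrr (\int[mu]_y (\1_S y * phi y))) -{1}E.
  rewrite /W -RintegralB// -RintegralZl// -RintegralD//; last 2 first.
    exact: integrableRB.
    exact: integrableRZ.
  by apply: eq_Rintegral => y _; ring.
rewrite [X in _ <= X](_ : _ = (C2 * h ^+ 2) * N); last by ring.
apply: Rintegral_mul_bound => //.
- by apply: measurable_funD; [exact: measurable_funB|exact: measurable_funM].
- by move=> y; have := phiC2 y (- h); rewrite scaleNr mulNr opprK sqrrN.
Qed.

Lemma weak_partialD f G g H : mu.-integrable setT (EFin \o f) ->
  mu.-integrable setT (EFin \o G) -> mu.-integrable setT (EFin \o g) ->
  mu.-integrable setT (EFin \o H) ->
  weak_partial S i f G -> weak_partial S i g H ->
  weak_partial S i (fun x => f x + g x) (fun x => G x + H x).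
Proof.
move=> fi Gi gi Hi fG gH phi tphi.
have mphi := test_function_measurable tphi.
have [C C0 phiC] := test_function_bounded tphi.
have [C' C'0 phiC'] := test_function_bounded (test_function_partial i tphi).
have mdphi := test_function_measurable (test_function_partial i tphi).
under eq_Rintegral do rewrite mulrDl.
rewrite RintegralD//; [|exact: (integrable_mul_bounded measurableT fi mdphi phiC')
                       |exact: (integrable_mul_bounded measurableT gi mdphi phiC')].
under [in RHS]eq_Rintegral do rewrite mulrDl.
rewrite RintegralD//; [|exact: (integrable_mul_bounded measurableT Gi mphi phiC)
                       |exact: (integrable_mul_bounded measurableT Hi mphi phiC)].
by rewrite opprD (fG _ tphi) (gH _ tphi).
Qed.

Lemma weak_partialZ c f G : mu.-integrable setT (EFin \o f) ->
  mu.-integrable setT (EFin \o G) -> weak_partial S i f G ->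
  weak_partial S i (fun x => c * f x) (fun x => c * G x).
Proof.
move=> fi Gi fG phi tphi.
have mphi := test_function_measurable tphi.
have [C C0 phiC] := test_function_bounded tphi.
have [C' C'0 phiC'] := test_function_bounded (test_function_partial i tphi).
have mdphi := test_function_measurable (test_function_partial i tphi).
under eq_Rintegral do rewrite -mulrA.
rewrite RintegralZl//; last exact: (integrable_mul_bounded measurableT fi mdphi phiC').
under [in RHS]eq_Rintegral do rewrite -mulrA.
rewrite RintegralZl//; last exact: (integrable_mul_bounded measurableT Gi mphi phiC).
by rewrite (fG _ tphi) mulrN.
Qed.

End weak_partial_limits.

Section positive_part.
Context (R : realType).
Implicit Types y z a b s t : R.

Definition pos y : R := Num.max y 0.

Lemma ler_pos y z : y <= z -> pos y <= pos z.
Proof. by move=> yz; rewrite /pos ge_max !le_max yz lexx !orbT. Qed.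

Lemma pos_lipschitz y z : `|pos y - pos z| <= `|y - z|.
Proof.
have H u v : u <= v -> pos v - pos u <= v - u.
  by rewrite /pos; case: (leP v 0); case: (leP u 0); lra.
have [yz|/ltW yz] := leP y z.
  by rewrite distrC [leRHS]distrC !ger0_norm ?subr_ge0 ?ler_pos// H.
by rewrite !ger0_norm ?subr_ge0 ?ler_pos// H.
Qed.

Lemma pos_le0 y : y <= 0 -> pos y = 0. Proof. exact: max_r. Qed.

Lemma pos_id y : 0 <= y -> pos y = y. Proof. exact: max_l. Qed.

(** A primitive of [pos]. Its derivative is Lipschitz, as the chain rule requires, which fails for
    [pos] itself. *)
Definition sqpos y : R := pos y ^+ 2 / 2.

Lemma sqpos_taylor s t : 0 <= sqpos (s + t) - sqpos s - t * pos s <= t ^+ 2.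
Proof.
rewrite /sqpos /pos; case: (leP s 0) => s0; case: (leP (s + t) 0) => st0.
- by rewrite expr0n/= mul0r subr0 mulr0 subr0 lexx sqr_ge0.
- by apply/andP; split; nra.
- by apply/andP; split; nra.
- by apply/andP; split; nra.
Qed.

Lemma is_derive_sqpos y : is_derive y 1 sqpos (pos y).
Proof.
apply: (@is_derive_quadratic _ _ _ _ 1) => t.
by have /andP[? ?] := sqpos_taylor y t; rewrite ger0_norm// mul1r.
Qed.

Lemma is_derive_sqpos_shift a y : is_derive y 1 (fun z => sqpos (z - a)) (pos (y - a)).
Proof.
have := @is_derive1_comp R sqpos (fun z => z - a) y _ _ (is_derive_sqpos (y - a))
  (is_deriveB (is_derive_id y 1) (is_derive_cst a y 1)).
by rewrite subr0 mulr1.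
Qed.

End positive_part.

Section trapezoid.
Context (R : realType) (a b : R).
Hypothesis ab : a < b.
Implicit Types (y z : R) (k : nat).

(* Antiderivative of the trapezoid that rises from 0 to 1 on [a, a + 1/k] and
   falls back to 0 on [b - 1/k, b]. *)
Definition trap k y : R := k.+1%:R *
  (sqpos (y - a) - sqpos (y - (a + k.+1%:R^-1)) -
   sqpos (y - (b - k.+1%:R^-1)) + sqpos (y - b)).

Definition dtrap k y : R := k.+1%:R *
  (pos (y - a) - pos (y - (a + k.+1%:R^-1)) -
   pos (y - (b - k.+1%:R^-1)) + pos (y - b)).

Lemma is_derive_trap k y : is_derive y 1 (fun z => trap k z - trap k 0) (dtrap k y).
Proof.
have H := is_deriveB (is_deriveZ (k.+1%:R : R) (is_deriveD (is_deriveB (is_deriveB (is_derive_sqpos_shift a y)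
  (is_derive_sqpos_shift (a + k.+1%:R^-1) y)) (is_derive_sqpos_shift (b - k.+1%:R^-1) y))
  (is_derive_sqpos_shift b y))) (is_derive_cst (trap k 0) y 1).
by rewrite subr0 in H.
Qed.

Lemma dtrap_lipschitz k y z : `|dtrap k y - dtrap k z| <= 4 * k.+1%:R * `|y - z|.
Proof.
have P c := pos_lipschitz (y - c) (z - c).
have E c : y - c - (z - c) = y - z by ring.
rewrite /dtrap -mulrBr normrM ger0_norm// [4 * _]mulrC -mulrA ler_wpM2l//.
set d := `|y - z|.
have {P E} P c : `|pos (y - c) - pos (z - c)| <= d by rewrite (le_trans (P c))// E.
have := P a; have := P b; have := P (a + k.+1%:R^-1); have := P (b - k.+1%:R^-1).
rewrite !ler_norml => /andP[? ?] /andP[? ?] /andP[? ?] /andP[? ?].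
by apply/andP; split; lra.
Qed.

Lemma dtrap_bounded k y : `|dtrap k y| <= 2.
Proof.
have k0 : 0 < k.+1%:R :> R by rewrite ltr0n.
rewrite /dtrap normrM gtr0_norm// mulrC -ler_pdivlMr//.
have d0 : 0 <= k.+1%:R^-1 :> R by rewrite invr_ge0.
set d := k.+1%:R^-1 in d0 *.
have := pos_lipschitz (y - a) (y - (a + d)).
rewrite (_ : y - a - (y - (a + d)) = d); last by ring.
have := pos_lipschitz (y - b) (y - (b - d)).
rewrite (_ : y - b - (y - (b - d)) = - d); last by ring.
rewrite normrN (ger0_norm d0) !ler_norml => /andP[? ?] /andP[? ?].
by apply/andP; split; lra.
Qed.

Lemma cvg_dtrap y : dtrap k y @[k --> \oo] --> ((a < y < b)%R%:R : R).
Proof.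
have inv0 (d : R) : 0 < d -> \forall k \near \oo, k.+1%:R^-1 < d.
  move=> d0; have := @cvg_harmonic R; move/cvgrPdist_lt => /(_ _ d0).
  by apply: filterS => k; rewrite sub0r normrN ger0_norm ?invr_ge0.
have [ya|ya] := leP y a; rewrite /=.
  apply: cvg_near_cst; near=> k.
  have kb : k.+1%:R^-1 < b - a by near: k; apply: inv0; rewrite subr_gt0.
  have k0 : 0 < k.+1%:R^-1 :> R by rewrite invr_gt0.
  rewrite /dtrap; set d := k.+1%:R^-1 in kb k0 *; clearbody d.
  rewrite !pos_le0; [ring|lra|lra|lra|lra].
have [yb|yb] := ltP y b.
  apply: cvg_near_cst; near=> k.
  have kb : k.+1%:R^-1 < b - y by near: k; apply: inv0; rewrite subr_gt0.
  have ka : k.+1%:R^-1 < y - a by near: k; apply: inv0; rewrite subr_gt0.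
  have k0 : 0 < k.+1%:R^-1 :> R by rewrite invr_gt0.
  rewrite /dtrap; set K := k.+1%:R in kb ka k0 *.
  have KK : K * K^-1 = 1 by rewrite mulfV// pnatr_eq0.
  clearbody K; set d := K^-1 in kb ka k0 KK *; clearbody d.
  rewrite (@pos_id _ (y - a)); last by lra.
  rewrite (@pos_id _ (y - (a + _))); last by lra.
  rewrite !pos_le0; [|lra|lra].
  rewrite subr0 addr0 (_ : _ - _ = d); last by ring.
  exact: KK.
apply: cvg_near_cst; near=> k.
have ka : k.+1%:R^-1 < y - a by near: k; apply: inv0; rewrite subr_gt0.
have k0 : 0 < k.+1%:R^-1 :> R by rewrite invr_gt0.
rewrite /dtrap; set d := k.+1%:R^-1 in ka k0 *; clearbody d; rewrite !pos_id; [|lra|lra|lra|lra].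
by rewrite (_ : _ - _ - _ + _ = 0 :> R) ?mulr0//; ring.
Unshelve. all: by end_near. Qed.

(** Each pair of terms is a difference quotient of [sqpos] with step 1/(k + 1), hence within 1/(k +
    1) of the value of [pos] by [sqpos_taylor]. *)
Lemma cvg_trap y : trap k y @[k --> \oo] --> pos (y - a) - pos (y - b).
Proof.
apply/cvgrPdist_le => eps eps0.
have := @cvg_harmonic R; move/cvgrPdist_le => /(_ (eps / 2)).
have e2 : 0 < eps / 2 by rewrite divr_gt0.
move=> /(_ e2); apply: filterS => k; rewrite sub0r normrN.
have k0 : 0 < k.+1%:R :> R by rewrite ltr0n.
have i0 : 0 < k.+1%:R^-1 :> R by rewrite invr_gt0.
rewrite gtr0_norm//= => ke.
have := sqpos_taylor (y - a) (- k.+1%:R^-1); have := sqpos_taylor (y - b) k.+1%:R^-1.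
rewrite (_ : y - a - _ = y - (a + k.+1%:R^-1)); last by ring.
rewrite (_ : y - b + _ = y - (b - k.+1%:R^-1)); last by ring.
rewrite /trap; set A := sqpos (y - a); set A' := sqpos (y - (a + _)).
set B := sqpos (y - b); set B' := sqpos (y - (b - _)).
set K := k.+1%:R in k0 i0 ke *; move=> /andP[B1 B2] /andP[A1 A2].
have Kn0 : K != 0 by rewrite gt_eqF.
have KK : K * K^-1 = 1 by rewrite mulfV.
clearbody A A' B B'; clearbody K.
have A1' : 0 <= K * (A' - A) + pos (y - a).
  have -> : K * (A' - A) + pos (y - a) = K * (A' - A - - K^-1 * pos (y - a)).
    by field.
  by rewrite mulr_ge0// ltW.
have A2' : K * (A' - A) + pos (y - a) <= K^-1.
  have -> : K * (A' - A) + pos (y - a) = K * (A' - A - - K^-1 * pos (y - a)).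
    by field.
  rewrite -[X in _ <= X]mul1r -KK -mulrA ler_wpM2l ?(ltW k0)//.
  by apply: le_trans A2 _; rewrite sqrrN expr2.
have B1' : 0 <= K * (B' - B) - pos (y - b).
  have -> : K * (B' - B) - pos (y - b) = K * (B' - B - K^-1 * pos (y - b)).
    by field.
  by rewrite mulr_ge0// ltW.
have B2' : K * (B' - B) - pos (y - b) <= K^-1.
  have -> : K * (B' - B) - pos (y - b) = K * (B' - B - K^-1 * pos (y - b)).
    by field.
  by rewrite -[X in _ <= X]mul1r -KK -mulrA ler_wpM2l ?(ltW k0).
rewrite ler_norml; apply/andP; split.
  by move: A1' A2' B1' B2'; rewrite !mulrDr !mulrN; lra.
by move: A1' A2' B1' B2'; rewrite !mulrDr !mulrN; lra.
Qed.

End trapezoid.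

Section clamp.
Context (R : realType) (n : nat) (i : 'I_n).
Local Notation mu := (lebesgue_rV R n).
Variables (S : set 'rV[R]_n) (f G : 'rV[R]_n -> R) (a b : R).
Hypotheses (ab : a < b) (oS : open S) (fi : mu.-integrable setT (EFin \o f))
  (Gi : mu.-integrable setT (EFin \o G)) (fG : weak_partial S i f G).

(** The clamp is not differentiable at a and b; it is reached through [trap] by dominated
    convergence. The subtracted constant makes it vanish at 0, so that its composition with f is
    integrable over the whole space. *)
Lemma weak_partial_clamp :
  weak_partial S i (fun x => pos (f x - a) - pos (f x - b) - (pos (- a) - pos (- b)))
    (fun x => (a < f x < b)%R%:R * G x).
Proof.
have mf := integrable_measurableR fi; have mG := integrable_measurableR Gi.
have cpos : continuous (@pos R).
  apply: (@lipschitz_continuous _ _ 1) => s t.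
  by rewrite mul1r (le_trans (pos_lipschitz _ _))// addrAC subrr add0r.
have mpos c : measurable_fun setT (fun x => pos (f x - c)).
  apply: (measurableT_comp (continuous_measurable_fun cpos)).
  by apply: measurable_funB.
have mdtrap k : measurable_fun setT (fun x => dtrap a b k (f x)).
  apply: (measurableT_comp _ mf); apply: continuous_measurable_fun.
  apply: (@lipschitz_continuous _ _ (4 * k.+1%:R)) => s t.
  by rewrite (le_trans (dtrap_lipschitz _ _ _ _ _))// addrAC subrr add0r.
have trapB k y : `|trap a b k y - trap a b k 0| <= 2 * `|y|.
  have [c _] := MVT_signed 0 y (@is_derive_trap R a b k).
  rewrite add0r subrr subr0 => ->; rewrite normrM ler_wpM2r//.
  exact: dtrap_bounded.
have mtrap k : measurable_fun setT (fun x => trap a b k (f x) - trap a b k 0).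
  apply: (@measurableT_comp _ _ _ _ _ _ (fun z => trap a b k z - trap a b k 0) _ f) => //.
  apply: continuous_measurable_fun => y; apply: differentiable_continuous.
  by apply/derivable1_diffP; case: (is_derive_trap a b k y).
have ml : measurable_fun setT (fun x => (a < f x < b)%R%:R * G x).
  apply: measurable_funM => //.
  have mA : measurable [set x | a < f x < b].
    rewrite (_ : mkset _ = f @^-1` `]a, b[); last first.
      by apply/seteqP; split => x /=; rewrite in_itv.
    by rewrite -[X in measurable X]setTI; apply: mf.
  rewrite (_ : (fun x => _) = \1_[set x | a < f x < b]); first exact: measurable_indic.
  apply/funext => x; rewrite indicE; congr (nat_of_bool _)%:R.
  by apply/idP/idP => [h|]; rewrite inE.
apply: (@weak_partial_cvg _ _ _ _ (fun k x => trap a b k (f x) - trap a b k 0)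
   (fun k x => dtrap a b k (f x) * G x) _ _ (fun x => 2 * `|f x|) (fun x => 2 * `|G x|)) => //.
- move=> k; apply: (@weak_partial_chain _ _ _ _ _ _ (fun z => trap a b k z - trap a b k 0)
    (dtrap a b k) (4 * k.+1%:R) 2) => //.
  + by rewrite subrr.
  + exact: is_derive_trap.
  + exact: dtrap_lipschitz.
  + exact: dtrap_bounded.
- by apply: measurable_funB => //; exact: measurable_funB.
- by move=> k; exact: measurable_funM.
- move=> x; apply: cvgB; first exact: cvg_trap.
  by rewrite -[- a]add0r -[- b]add0r; exact: cvg_trap.
- by move=> x; apply: cvgMr_tmp; exact: cvg_dtrap.
- exact/integrableRZ/integrable_norm.
- exact/integrableRZ/integrable_norm.
- by move=> k x; rewrite normrM ler_wpM2r// dtrap_bounded.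
Qed.

End clamp.

(** * Weak and generalized gradients on S *)

Section weak_gradient_theory.
Context (R : realType) (n : nat).
Local Notation mu := (lebesgue_rV R n).
Implicit Types (S K : set 'rV[R]_n) (f g phi : 'rV[R]_n -> R) (F : 'rV[R]_n -> 'rV[R]_n).

Lemma compact_measurable_rV K : compact K -> measurable K.
Proof.
move=> cK; rewrite -(setCK K); apply: measurableC; apply: open_measurable_rV.
by apply: closed_openC; apply: compact_closed => //; exact: norm_hausdorff.
Qed.

Lemma integrable_L1loc S g : measurable S -> mu.-integrable S (EFin \o g) -> L1loc S g.
Proof.
move=> mS gi; split; first exact: integrable_measurableR gi.
move=> K cK KS; apply: (integrableS mS _ KS) => //.
exact: compact_measurable_rV.
Qed.

Lemma bounded_set_lebesgue_lty S : bounded_set S -> open S -> (mu S < +oo)%E.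
Proof.
move=> [M [_ HM]] oS; have mS := open_measurable_rV oS.
apply: le_lt_trans (lebesgue_rV_bounded_box n (- (`|M| + 2)) (`|M| + 2)).
apply: le_measure; rewrite ?inE//; first by apply: measurable_box => j; exact: measurable_itv.
move=> x Sx j /=; rewrite in_itv /= -ltr_norml.
have xM : `|x| <= `|M| + 1 by apply: HM => //; rewrite (le_lt_trans (ler_norm M))// ltrDl.
have : ball 0 (`|M| + 2) x.
  by rewrite -ball_normE /= sub0r normrN (le_lt_trans xM)// ltrD2l ltr1n.
by move=> [_ /(_ ord0 j)]; rewrite /ball/= mxE sub0r normrN.
Qed.

Lemma test_function_sub S S' phi : S `<=` S' -> test_function S phi -> test_function S' phi.
Proof. by move=> SS' [? ? sphi]; split => //; exact: subset_trans SS'. Qed.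

Lemma test_function_supp S phi x : test_function S phi -> phi x != 0 -> S x.
Proof. by move=> [_ _ sphi] p; apply: sphi; exact: subset_closure. Qed.

Lemma Rintegral_test S f phi : test_function S phi ->
  \int[mu]_(x in S) (f x * phi x) = \int[mu]_x ((f \_ S) x * phi x).
Proof.
move=> tphi; rewrite Rintegral_mkcond; apply: eq_Rintegral => x _.
by rewrite !patchE; case: ifPn => // _; rewrite mul0r.
Qed.

(** A locally integrable g is cut off to closed cubes inside S, where it is integrable, and
    countably many cubes cover S. *)
Lemma fundamental_lemma_loc S g : open S -> L1loc S g ->
  (forall phi, test_function S phi -> \int[mu]_(x in S) (g x * phi x) = 0) ->
  {ae mu, forall x, S x -> g x = 0}.
Proof.
move=> oS [mg gK] g0.
have H : {ae mu, forall x, forall k, ball (rational_cube R n k).1 (rational_cube R n k).2 x ->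
    ball (rational_cube R n k).1 ((rational_cube R n k).2 *+ 2) `<=` S -> g x = 0}.
  apply/ae_foralln => k; case: (rational_cube R n k) => c r /=.
  have [kS|kS] := pselect (ball c (r *+ 2) `<=` S); last exact: aeW.
  have [r0|r0] := ltP 0 r; last by apply: aeW => x [+ _]; rewrite ltNge r0.
  pose K := box (fun j => `[c ord0 j - r, c ord0 j + r]%classic).
  have cK : compact K by apply: rV_compact => j; exact: segment_compact.
  have KS : K `<=` S.
    move=> x Kx; apply: kS; rewrite ball_box ?mulrn_wgt0// => j; have := Kx j.
    by rewrite /= !in_itv/= mulr2n => /andP[? ?]; apply/andP; split; lra.
  have VK : ball c r `<=` K.
    rewrite ball_box// => x Vx j; have := Vx j.
    by rewrite /= !in_itv/= => /andP[/ltW-> /ltW->].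
  have mK := compact_measurable_rV cK.
  have gi : mu.-integrable setT (EFin \o (g \_ K)).
    by rewrite -restrict_EFin; apply/(integrable_mkcond _ mK); exact: gK.
  have := fundamental_lemma (ball_open c r) gi.
  have -> : (forall phi, test_function (ball c r) phi ->
      \int[mu]_x ((g \_ K) x * phi x) = 0) = True.
    apply/propext; split => // _ phi tphi.
    rewrite -(g0 phi); last by apply: test_function_sub tphi; exact: subset_trans VK KS.
    rewrite [RHS]Rintegral_mkcond; apply: eq_Rintegral => x _; rewrite !patchE.
    have [->|p0] := eqVneq (phi x) 0; first by rewrite !mulr0; case: ifP.
    have Vx := test_function_supp tphi p0.
    by rewrite !mem_set//; [exact/KS/VK|exact: VK].
  move=> /(_ Logic.I); apply: filterS => x gx Vx _; have := gx Vx.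
  by rewrite patchE mem_set//; exact: VK.
apply: filterS H => x gx; rewrite {1}(open_bigcup_cubes oS).
by move=> [k kV cx]; exact: gx cx kV.
Qed.

Lemma integrable_L1loc_test S g phi : open S -> L1loc S g -> test_function S phi ->
  mu.-integrable S (EFin \o (fun x => g x * phi x)).
Proof.
move=> oS [mg gK] tphi; have mS := open_measurable_rV oS.
have [C _ phiC] := test_function_bounded tphi; have mphi := test_function_measurable tphi.
have [_ cphi sphi] := tphi; have mK := compact_measurable_rV cphi.
apply/(integrable_mkcond _ mS).
have : mu.-integrable (closure [set x | phi x != 0]) (EFin \o (fun x => g x * phi x)).
  by apply: (integrable_mul_bounded mK (gK _ cphi sphi) _ phiC); exact: measurable_funTS.
move=> /(integrable_mkcond _ mK); apply: eq_integrable => // x _; rewrite !patchE.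
have [p0|p0] := eqVneq (phi x) 0; first by rewrite /= p0 !mulr0; case: ifP; case: ifP.
have Kx : closure [set x | phi x != 0] x by exact: subset_closure.
by rewrite !mem_set//; exact: sphi.
Qed.

Lemma weak_gradient_unique S f F F' : open S ->
  is_weak_gradient S f F -> is_weak_gradient S f F' ->
  {ae mu, forall x, S x -> F x = F' x}.
Proof.
move=> oS [_ LF dF] [_ LF' dF']; have mS := open_measurable_rV oS.
have H i : {ae mu, forall x, S x -> F x ord0 i - F' x ord0 i = 0}.
  apply: (@fundamental_lemma_loc _ (fun x => F x ord0 i - F' x ord0 i)) => //.
    have [m1 i1] := LF i; have [m2 i2] := LF' i; split; first exact: measurable_funB.
    move=> K cK KS; apply: integrableRB; [exact: compact_measurable_rV|exact: i1|exact: i2].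
  move=> phi tphi; under eq_Rintegral do rewrite mulrBl.
  rewrite RintegralB//; [|exact: integrable_L1loc_test|exact: integrable_L1loc_test].
  by apply/eqP; rewrite subr_eq0 -eqr_opp -dF// -dF'.
have : {ae mu, forall x, forall i, S x -> F x ord0 i - F' x ord0 i = 0} by exact: filter_forall.
by apply: filterS => x Fx Sx; apply/rowP => i; apply/subr0_eq/Fx.
Qed.

Lemma weak_gradientP S f : weakly_differentiable S f ->
  is_weak_gradient S f (weak_gradient S f).
Proof. by move=> /(xgetPex (fun=> 0)). Qed.

Lemma weak_gradient_ae S f F : open S -> is_weak_gradient S f F ->
  {ae mu, forall x, S x -> weak_gradient S f x = F x}.
Proof.
move=> oS fF; apply: weak_gradient_unique (fF) => //.
by apply: weak_gradientP; exists F.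
Qed.

Lemma is_weak_gradientP S f F : measurable S -> mu.-integrable S (EFin \o f) ->
  (forall i, mu.-integrable S (EFin \o (fun x => F x ord0 i))) ->
  is_weak_gradient S f F <->
  forall i, weak_partial S i (f \_ S) ((fun x => F x ord0 i) \_ S).
Proof.
move=> mS fi Fi; split => [[_ _ H] i phi tphi|H].
  rewrite -(Rintegral_test _ (test_function_partial i tphi)) -(Rintegral_test _ tphi).
  exact: H.
split; [exact: integrable_L1loc|by move=> i; exact: integrable_L1loc|].
move=> phi tphi i.
rewrite (Rintegral_test _ (test_function_partial i tphi)) (Rintegral_test _ tphi).
exact: H.
Qed.

Lemma truncate_pos (k y : R) : 0 < k -> truncate k y = pos (y + k) - pos (y - k) - k.
Proof.
move=> k0; rewrite /truncate; case: ltP => [|].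
  by rewrite ltr_norml => /andP[? ?]; rewrite pos_id ?pos_le0; [ring|lra|lra].
have [y0|y0|->] := ltgtP y 0; last by rewrite normr0 leNgt k0.
  rewrite ltr0_norm// ltr0_sg// mulrN1 => ?.
  by rewrite !pos_le0; [ring|lra|lra].
rewrite gtr0_norm// gtr0_sg// mulr1 => ?.
by rewrite !pos_id; [ring|lra|lra].
Qed.

Lemma truncate_gradient S f F (k c : R) : open S -> (mu S < +oo)%E ->
  mu.-integrable S (EFin \o f) ->
  (forall i, mu.-integrable S (EFin \o (fun x => F x ord0 i))) ->
  is_weak_gradient S f F -> 0 < k ->
  is_weak_gradient S (truncate k \o (fun x => f x - c))
    (fun x => if `|f x - c| < k then F x else 0).
Proof.
move=> oS Sfin fi Fi fF k0; have mS := open_measurable_rV oS.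
have mf := integrable_measurableR fi.
have fiS : mu.-integrable setT (EFin \o (f \_ S)).
  by rewrite -restrict_EFin; apply/(integrable_mkcond _ mS).
have FiS i : mu.-integrable setT (EFin \o ((fun x => F x ord0 i) \_ S)).
  by rewrite -restrict_EFin; apply/(integrable_mkcond _ mS).
have mD : measurable (S `&` [set x | `|f x - c| < k]).
  rewrite (_ : [set x | _] = (fun x => f x - c) @^-1` `]- k, k[); last first.
    by apply/seteqP; split => x /=; rewrite in_itv /= -ltr_norml.
  by apply: measurable_funB => //; exact: measurable_cst.
have t1 : mu.-integrable S (EFin \o (truncate k \o (fun x => f x - c))).
  apply: (integrableR_le mS (g := fun=> k)) => //.
  - rewrite (_ : _ \o _ = fun x => pos (f x - c + k) - pos (f x - c - k) - k); last first.
      by apply/funext => x /=; rewrite truncate_pos.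
    have cpos : continuous (@pos R).
      apply: (@lipschitz_continuous _ _ 1) => s t.
      by rewrite mul1r (le_trans (pos_lipschitz _ _))// addrAC subrr add0r.
    have mpos := continuous_measurable_fun cpos.
    apply: measurable_funB => //; apply: measurable_funB; apply: (measurableT_comp mpos).
      by apply: measurable_funD => //; exact: measurable_funB.
    by apply: measurable_funB => //; exact: measurable_funB.
  - apply/integrable_mkcond => //.
    have := integrableRZ k measurableT (integrable_indic_lty mS Sfin).
    apply: eq_integrable => // x _; rewrite patchE /= indicE.
    by case: ifP; rewrite ?mulr1 ?mulr0.
  - move=> x _ /=; rewrite /truncate; case: ltP => [/ltW//|_].
    rewrite normrM normr_sg gtr0_norm// ler_piMr ?(ltW k0)//.
    by case: (_ != 0); rewrite ?ler01.
have t2 i : mu.-integrable S (EFin \o (fun x => (if `|f x - c| < k then F x else 0) ord0 i)).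
  apply: (integrableR_le mS _ (integrable_norm (Fi i))).
  - apply: (@eq_measurable_fun _ _ _ _ _
      (fun x => \1_(S `&` [set x | `|f x - c| < k]) x * F x ord0 i)).
      move=> x; rewrite inE => Sx; rewrite indicE; case: ifPn => fk.
        by rewrite mem_set// mul1r.
      by rewrite memNset ?mul0r ?mxE// => -[_ /=]; apply/negP.
    apply: measurable_funM; last exact: integrable_measurableR (Fi i).
    by apply: measurable_funTS; exact: measurable_indic.
  - by move=> x _ /=; case: ifP => _; rewrite ?mxE ?normr0.
apply/is_weak_gradientP => // i.
(* This is [truncate k (- c)], the constant that [weak_partial_clamp] normalises away. It is put
   back as a multiple of the indicator of S, whose weak gradient in S is 0. *)
pose C := pos (- (c - k)) - pos (- (c + k)) - k.
have ab : c - k < c + k by lra.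
have wc := weak_partial_clamp ab oS fiS (FiS i) ((is_weak_gradientP mS fi Fi).1 fF i).
have E1 : (truncate k \o (fun x => f x - c)) \_ S =
    (fun x => (pos ((f \_ S) x - (c - k)) - pos ((f \_ S) x - (c + k)) -
      (pos (- (c - k)) - pos (- (c + k)))) + C * \1_S x).
  apply/funext => x; rewrite !patchE indicE; case: ifPn => Sx; last first.
    by rewrite !sub0r subrr mulr0 addr0.
  rewrite /= truncate_pos// mulr1 /C (_ : f x - c + k = f x - (c - k)); last by ring.
  by rewrite (_ : f x - c - k = f x - (c + k)); ring.
have E2 : (fun x => (if `|f x - c| < k then F x else 0) ord0 i) \_ S =
    (fun x => (c - k < (f \_ S) x < c + k)%R%:R * ((fun x => F x ord0 i) \_ S) x + C * 0).
  apply/funext => x; rewrite !patchE mulr0 addr0; case: ifPn => Sx; last by rewrite mulr0.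
  have -> : (c - k < f x < c + k) = (`|f x - c| < k).
    by rewrite ltr_distl; congr (_ && _); rewrite ltrBlDr.
  by case: ifP; rewrite ?mul1r ?mul0r ?mxE.
have Si := integrable_indic_lty mS Sfin.
have t1' : mu.-integrable setT (EFin \o ((truncate k \o (fun x => f x - c)) \_ S)).
  by rewrite -restrict_EFin; apply/(integrable_mkcond _ mS).
have t2' : mu.-integrable setT (EFin \o
    ((fun x => (if `|f x - c| < k then F x else 0) ord0 i) \_ S)).
  by rewrite -restrict_EFin; apply/(integrable_mkcond _ mS).
have zi : mu.-integrable setT (EFin \o (fun=> 0 : R)) by exact: integrable0.
have z1 := integrableRZ C measurableT Si.
rewrite E1 E2; apply: weak_partialD.
- have := integrableRB measurableT t1' z1; rewrite E1; apply: eq_integrable => // x _.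
  by rewrite /= addrK.
- by move: t2'; rewrite E2; apply: eq_integrable => // x _; rewrite /= mulr0 addr0.
- exact: z1.
- exact: integrableRZ.
- exact: wc.
- exact: (weak_partialZ C Si zi (weak_partial_indic i oS Sfin)).
Qed.

Lemma cst_gradient S (c : R) : open S -> (mu S < +oo)%E ->
  is_weak_gradient S (fun=> c) (fun=> 0).
Proof.
move=> oS Sfin; have mS := open_measurable_rV oS.
have Si := integrable_indic_lty mS Sfin.
have zi D : mu.-integrable D (EFin \o (fun=> 0 : R)) by exact: integrable0.
have ciE : (fun=> c) \_ S = (fun x => c * \1_S x).
  by apply/funext => x; rewrite patchE indicE; case: ifP; rewrite ?mulr1 ?mulr0.
have ci : mu.-integrable S (EFin \o (fun=> c)).
  apply/(integrable_mkcond _ mS); rewrite restrict_EFin ciE.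
  exact: integrableRZ.
apply/is_weak_gradientP => //= i; first by under eq_fun do rewrite mxE.
rewrite ciE (_ : _ \_ _ = (fun x => c * 0)); last first.
  by apply/funext => x; rewrite patchE mulr0; case: ifP; rewrite ?mxE.
exact: (weak_partialZ c Si (zi _) (weak_partial_indic i oS Sfin)).
Qed.

End weak_gradient_theory.

Section truncate_facts.
Context (R : realType).
Implicit Types (k m c y : R).

Lemma continuous_pos : continuous (@pos R).
Proof.
apply: (@lipschitz_continuous _ _ 1) => s t.
by rewrite mul1r (le_trans (pos_lipschitz _ _))// addrAC subrr add0r.
Qed.

Lemma truncate_le k y : 0 < k -> `|truncate k y| <= k.
Proof.
move=> k0; rewrite /truncate; case: ltP => [/ltW//|_].
rewrite normrM normr_sg gtr0_norm// ler_piMr ?(ltW k0)//.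
by case: (_ != 0); rewrite ?ler01.
Qed.

Lemma measurable_truncate k : 0 < k -> measurable_fun setT (truncate k).
Proof.
move=> k0; rewrite (_ : truncate k = fun y => pos (y + k) - pos (y - k) - k); last first.
  by apply/funext => y; rewrite truncate_pos.
have mpos := continuous_measurable_fun continuous_pos.
apply: measurable_funB => //; apply: measurable_funB; apply: (measurableT_comp mpos).
  exact: measurable_funD.
exact: measurable_funB.
Qed.

Lemma truncate_id k y : `|y| < k -> truncate k y = y.
Proof. by rewrite /truncate => ->. Qed.

Lemma truncate_ge k y : 0 < k -> k <= y -> truncate k y = k.
Proof.
move=> k0 ky; have y0 : 0 < y by exact: lt_le_trans ky.
by rewrite /truncate gtr0_norm// ltNge ky/= gtr0_sg// mulr1.
Qed.

Lemma truncate_leN k y : 0 < k -> y <= - k -> truncate k y = - k.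
Proof.
move=> k0 ky; have y0 : y < 0 by apply: le_lt_trans ky _; rewrite oppr_lt0.
by rewrite /truncate ltr0_norm// ltNge lerNr ky/= ltr0_sg// mulrN1.
Qed.

(** A height m >= |c| + k is invisible to a truncation at k around c. Hence shifted truncations of
    f, which itself need not be weakly differentiable, are truncations of [truncate m o f], which
    is. *)
Lemma truncate_shift_truncate k m c y : 0 < k -> `|c| + k <= m ->
  truncate k (truncate m y - c) = truncate k (y - c) /\
  (`|truncate m y - c| < k) = (`|y - c| < k).
Proof.
move=> k0 ckm; have m0 : 0 < m by apply: lt_le_trans ckm; rewrite ltr_wpDl.
have := ler_norm c; have := ler_norm (- c); rewrite normrN => c1 c2.
have [ym|] := ltP `|y| m; first by rewrite (truncate_id ym).
rewrite ler_normr => /orP[my|my].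
  have h1 : k <= m - c by lra.
  have h2 : k <= y - c by lra.
  rewrite (truncate_ge m0 my) (truncate_ge k0 h1) (truncate_ge k0 h2).
  by rewrite !ltNge !ler_normr h1 h2.
have {}my : y <= - m by lra.
have h1 : - m - c <= - k by lra.
have h2 : y - c <= - k by lra.
rewrite (truncate_leN m0 my) (truncate_leN k0 h1) (truncate_leN k0 h2).
by rewrite !ltNge !ler_normr [k <= - (- m - c)]lerNr h1 [k <= - (y - c)]lerNr h2 !orbT.
Qed.

End truncate_facts.

Lemma bounded_integrable d (T : measurableType d) (R : realType)
    (mu : {measure set T -> \bar R}) (S : set T) (g : T -> R) (k : R) :
  measurable S -> (mu S < +oo)%E -> measurable_fun S g ->
  (forall x, S x -> `|g x| <= k) -> mu.-integrable S (EFin \o g).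
Proof.
move=> mS Sfin mg gk; apply: (integrableR_le mS mg (g := fun=> k)) => //.
apply/(integrable_mkcond _ mS).
have := integrableRZ k measurableT (integrable_indic_lty mS Sfin).
apply: eq_integrable => // x _; rewrite patchE /= indicE.
by case: ifP; rewrite ?mulr1 ?mulr0.
Qed.

Section gen_gradient_theory.
Context (R : realType) (n : nat).
Local Notation mu := (lebesgue_rV R n).
Variables (S : set 'rV[R]_n) (f : 'rV[R]_n -> R).
Hypotheses (oS : open S) (Sfin : (mu S < +oo)%E) (mf : measurable_fun S f).
Hypothesis dW : forall k, 0 < k -> weakly_differentiable S (truncate k \o f).
Local Notation W k := (weak_gradient S (truncate k \o f)).
Hypothesis iW : forall k i, 0 < k -> mu.-integrable S (EFin \o (fun x => W k x ord0 i)).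

Let mS := open_measurable_rV oS.

Let is_weak_gradient_shift (k c m : R) : 0 < k -> `|c| + k <= m ->
  is_weak_gradient S (truncate k \o (fun x => f x - c))
    (fun x => if `|f x - c| < k then W m x else 0).
Proof.
move=> k0 ckm; have m0 : 0 < m by apply: lt_le_trans ckm; rewrite ltr_wpDl.
have ti : mu.-integrable S (EFin \o (truncate m \o f)).
  apply: (bounded_integrable mS Sfin (k := m)) => [|x _]; last exact: truncate_le.
  exact: (measurableT_comp (measurable_truncate m0) mf).
have := truncate_gradient c oS Sfin ti (fun i => iW i m0) (weak_gradientP (dW m0)) k0.
congr (is_weak_gradient S _ _); apply/funext => x /=.
  by have [-> _] := truncate_shift_truncate (f x) k0 ckm.
by have [_ ->] := truncate_shift_truncate (f x) k0 ckm.
Qed.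

Lemma weakly_differentiable_truncate_shift (k c : R) : 0 < k ->
  weakly_differentiable S (truncate k \o (fun x => f x - c)).
Proof. by move=> k0; eexists; exact: (is_weak_gradient_shift k0 (lexx _)). Qed.

Let weak_gradient_shift (k c m : R) : 0 < k -> `|c| + k <= m ->
  {ae mu, forall x, S x -> weak_gradient S (truncate k \o (fun x => f x - c)) x =
    if `|f x - c| < k then W m x else 0}.
Proof. by move=> k0 ckm; apply: weak_gradient_ae => //; exact: is_weak_gradient_shift. Qed.

Let weak_gradient_level (k m : R) : 0 < k -> k <= m ->
  {ae mu, forall x, S x -> W k x = if `|f x| < k then W m x else 0}.
Proof.
move=> k0 km; have := @weak_gradient_shift k 0 m k0; rewrite normr0 add0r => /(_ km).
rewrite (_ : (fun x => f x - 0) = f); last by apply/funext => x; rewrite subr0.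
by apply: filterS => x; rewrite subr0.
Qed.

(* On the level set j <= |f| < j + 1 take the gradient of the truncation at height j + 1. *)
Let G x := W (Num.truncn `|f x|).+1%:R x.

Let measurable_G i : measurable_fun S (fun x => G x ord0 i).
Proof.
pose E j := S `&` [set x | Num.truncn `|f x| = j].
have SE : S = \bigcup_j E j.
  by apply/seteqP; split => [x Sx|x [j _ []]//]; exists (Num.truncn `|f x|).
have mE j : measurable (E j).
  rewrite (_ : E j = S `&` (fun x => `|f x|) @^-1` `[j%:R, j.+1%:R[%classic).
    by apply: (measurableT_comp _ mf) => //; exact: measurable_itv.
  apply/seteqP; split => x [Sx] /=; rewrite in_itv /= => H; split => //.
    by have := truncn_itv (normr_ge0 (f x)); rewrite H.
  by apply/eqP; rewrite truncn_eq.
move=> mS' Y mY; rewrite {1}SE setI_bigcupl; apply: bigcupT_measurable => j.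
have -> : E j `&` (fun x => G x ord0 i) @^-1` Y =
    E j `&` (S `&` (fun x => W j.+1%:R x ord0 i) @^-1` Y).
  by apply/seteqP; split => x [[Sx jx]] /=; rewrite /G jx => H; split => //; case: H.
apply: measurableI => //.
exact: (integrable_measurableR (iW i (ltr0Sn R j))).
Qed.

Lemma gen_gradientP : is_gen_gradient S f (gen_gradient S f).
Proof.
suff : exists G, is_gen_gradient S f G by move=> /(xgetPex (fun=> 0)).
exists G; split => [|k k0]; first exact: measurable_G.
split; first exact: dW.
(* A height above k and above all levels that occur where |f| < k, so that every gradient involved
   is compared with the single W m. *)
pose m : nat := (Num.truncn k).+2.
have km : k <= m%:R.
  by apply/ltW/(lt_trans (truncnS_gt k)); rewrite ltr_nat.
have H : {ae mu, forall x, forall j, (j < m)%N -> S x ->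
    W j.+1%:R x = if `|f x| < j.+1%:R then W m%:R x else 0}.
  apply/ae_foralln => j; have [jm|jm] := ltnP j m; last exact: aeW.
  have jm' : j.+1%:R <= m%:R :> R by rewrite ler_nat.
  by apply: filterS (weak_gradient_level (ltr0Sn R j) jm') => x H _ Sx; exact: H.
apply: filterS2 H (weak_gradient_level k0 km) => x H Hk Sx.
rewrite (Hk Sx); case: ifPn => // fk; rewrite /G H//.
  by rewrite truncnS_gt.
by rewrite ltnS leqW// le_truncn// ltW.
Qed.

Lemma weak_gradient_truncate_shift (k c : R) : 0 < k ->
  {ae mu, forall x, S x -> weak_gradient S (truncate k \o (fun x => f x - c)) x =
    if `|f x - c| < k then gen_gradient S f x else 0}.
Proof.
move=> k0; have m0 : 0 < `|c| + k by rewrite ltr_wpDl.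
have [_ /(_ _ m0)[_ H]] := gen_gradientP.
apply: filterS2 H (weak_gradient_shift k0 (lexx (`|c| + k))) => x Hm Hk Sx.
rewrite (Hk Sx); case: ifPn => // fk; rewrite (Hm Sx) ifT//.
by have := ler_normD (f x - c) c; rewrite subrK; lra.
Qed.

End gen_gradient_theory.

(** * Weighted integrability and the inequality defining [calA] *)

(** Put v = w^(1/(1 - p)), so that w = v^(1 - p). Either g <= eta v, or (g / (eta v))^(p - 1) >= 1,
    and multiplying by g gives the second summand. *)
Lemma young_weight (R : realType) (p eta w g : R) : 1 < p -> 0 < eta -> 0 < w -> 0 <= g ->
  g <= eta * w `^ (1 / (1 - p)) + eta `^ (1 - p) * (w * g `^ p).
Proof.
move=> p1 eta0 w0 g0.
have [gw|gw] := leP g (eta * w `^ (1 / (1 - p))).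
  by rewrite (le_trans gw)// lerDl !mulr_ge0 ?powR_ge0// ltW.
rewrite (@le_trans _ _ (eta `^ (1 - p) * (w * g `^ p)))//; last first.
  by rewrite lerDr mulr_ge0 ?powR_ge0// ltW.
have g0' : 0 < g by apply: le_lt_trans gw; rewrite mulr_ge0 ?powR_ge0// ltW.
set v := w `^ (1 / (1 - p)) in gw.
have v0 : 0 < v by exact: powR_gt0.
have p1' : 1 - p != 0 by rewrite subr_eq0 lt_eqF.
have -> : w = v `^ (1 - p) by rewrite /v -powRrM mul1r mulVf// powRr1// ltW.
rewrite mulrA -powRM ?(ltW v0) ?(ltW eta0)//.
have -> : g `^ p = g * g `^ (p - 1).
  by rewrite -{2}[g]powRr1 ?(ltW g0')// -powRD ?subrKC// (gt_eqF g0') implybT.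
rewrite mulrCA ler_peMr ?(ltW g0')// -[1 - p]opprB powRN mulrC.
rewrite ler_pdivlMr ?powR_gt0 ?mulr_gt0// mul1r.
by rewrite ge0_ler_powR ?nnegrE ?subr_ge0 ?mulr_ge0// ltW.
Qed.

Section Lq_facts.
Context (R : realType) (n : nat).
Local Notation mu := (lebesgue_rV R n).
Variable S : set 'rV[R]_n.
Hypothesis mS : measurable S.
Implicit Types (f : 'rV[R]_n -> R).

Lemma Lq_measurable (q : \bar R) f : Lq S q f -> measurable_fun S f.
Proof.
move=> /sub_Lfun_mfun; rewrite inE => mf.
by have := (measurable_restrict f mS measurableT).2 mf; rewrite setTI.
Qed.

Lemma Lq1P f : Lq S 1 f <-> mu.-integrable S (EFin \o f).
Proof.
rewrite /Lq; split.
  by move=> /Lfun1_integrable; rewrite -restrict_EFin => /(integrable_mkcond _ mS).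
by move=> /(integrable_mkcond _ mS) H; apply/Lfun1_integrable; rewrite -restrict_EFin.
Qed.

Lemma Lq_normE (q : R) f : 0 < q ->
  Lq_norm S q%:E f = ((\int[mu]_(x in S) (`|f x| `^ q)%:E) `^ q^-1)%E.
Proof.
move=> q0; rewrite /Lq_norm unlock /=; congr (_ `^ _)%E.
rewrite [RHS]integral_mkcond; apply: eq_integral => x _.
rewrite !patchE; case: ifPn => _; first by rewrite -poweR_EFin.
by rewrite normr0 powR0// gt_eqF.
Qed.

Lemma LqP (q : R) f : 0 < q -> Lq S q%:E f <->
  measurable_fun S f /\ (\int[mu]_(x in S) (`|f x| `^ q)%:E < +oo)%E.
Proof.
move=> q0; split.
  move=> fq; split; first exact: Lq_measurable fq.
  have : (Lq_norm S q%:E f < +oo)%E.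
    by move/sub_Lfun_finLfun : fq; rewrite inE.
  rewrite Lq_normE//; set I := (\int[_]_(_ in _) _)%E.
  have : (0 <= I)%E by apply: integral_ge0.
  case: I => [r _ _|_|]; rewrite ?ltry//.
  by rewrite /= invr_eq0 gt_eqF.
move=> [mf fq]; rewrite /Lq; apply/andP; split; rewrite inE.
  by apply/(measurable_restrict f mS measurableT); rewrite setTI.
have : (Lq_norm S q%:E f < +oo)%E by rewrite Lq_normE// poweR_lty.
exact.
Qed.

Lemma Lq_cst (c : R) (q : \bar R) : (mu S < +oo)%E -> (1 <= q)%E -> Lq S q (fun=> c).
Proof.
move=> Sfin; have mc : measurable_fun S (fun=> c) by [].
case: q => [q|_|//].
  rewrite lee_fin => q1; have q0 : 0 < q by exact: lt_le_trans q1.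
  apply/LqP => //; split => //.
  rewrite integral_cst//.
  by rewrite lte_mul_pinfty// lee_fin powR_ge0.
rewrite /Lq; apply/andP; split; rewrite inE.
  by apply/(measurable_restrict _ mS measurableT); rewrite setTI.
rewrite /= /finite_norm unlock /=; case: ifP => [S0|_]; last exact: ltry.
apply: (@le_lt_trans _ _ (`|c|%:E)); last exact: ltry.
apply/ess_sup_inf.ess_supP; apply: aeW => x /=; rewrite patchE lee_fin.
by case: ifP; rewrite ?normr0.
Qed.

End Lq_facts.

Section enorm_facts.
Context (R : realType) (n : nat).
Local Notation mu := (lebesgue_rV R n).
Implicit Types (x y : 'rV[R]_n).

Lemma dot_ge0 x : 0 <= dot x x.
Proof. by apply: sumr_ge0 => i _; rewrite -expr2 sqr_ge0. Qed.

Lemma enorm_ge0 x : 0 <= enorm x. Proof. exact: sqrtr_ge0. Qed.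

Lemma enorm_sqr x : enorm x ^+ 2 = dot x x.
Proof. by rewrite sqr_sqrtr// dot_ge0. Qed.

Lemma coord_le_enorm x i : `|x ord0 i| <= enorm x.
Proof.
rewrite -(ler_pXn2r (_ : 0 < 2)%N) ?nnegrE ?enorm_ge0// enorm_sqr.
rewrite real_normK ?num_real// /dot (bigD1 i)//= expr2 lerDl.
by apply: sumr_ge0 => j _; rewrite -expr2 sqr_ge0.
Qed.

Lemma dot0 x : dot x 0 = 0.
Proof. by rewrite /dot big1// => i _; rewrite mxE mulr0. Qed.

Lemma enorm_powR_dot (p : R) x : 0 < p -> enorm x `^ (p - 2) * dot x x = enorm x `^ p.
Proof.
move=> p0; rewrite -enorm_sqr -powR_mulrn ?enorm_ge0//.
have [->|x0] := eqVneq (enorm x) 0.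
  by rewrite [0 `^ 2%:R]powR0 ?mulr0 ?powR0 ?gt_eqF// pnatr_eq0.
by rewrite -powRD ?subrK// x0 implybT.
Qed.

Lemma measurable_dot (S : set 'rV[R]_n) (F G : 'rV[R]_n -> 'rV[R]_n) :
  (forall i, measurable_fun S (fun x => F x ord0 i)) ->
  (forall i, measurable_fun S (fun x => G x ord0 i)) ->
  measurable_fun S (fun x => dot (F x) (G x)).
Proof.
move=> mF mG; rewrite /dot; apply: measurable_sum => i.
exact: measurable_funM.
Qed.

Lemma measurable_enorm (S : set 'rV[R]_n) (F : 'rV[R]_n -> 'rV[R]_n) :
  (forall i, measurable_fun S (fun x => F x ord0 i)) ->
  measurable_fun S (fun x => enorm (F x)).
Proof.
move=> mF; apply: (@measurableT_comp _ _ _ _ _ _ (@Num.sqrt R)).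
  by apply: continuous_measurable_fun; exact: sqrt_continuous.
exact: measurable_dot.
Qed.

End enorm_facts.

Section weighted.
Context (R : realType) (n : nat).
Local Notation mu := (lebesgue_rV R n).
Variables (S : set 'rV[R]_n) (gamma : 'rV[R]_n -> R) (p : R).
Hypotheses (oS : open S) (Sfin : (mu S < +oo)%E) (p1 : 1 < p)
  (gamma0 : forall x, S x -> 0 < gamma x) (gammaoo : Lq S +oo gamma)
  (gammaL1 : Lq S 1 (fun x => gamma x `^ (1 / (1 - p)))).
Implicit Types (F : 'rV[R]_n -> 'rV[R]_n) (f g : 'rV[R]_n -> R).

Let mS := open_measurable_rV oS.
Let mgamma := Lq_measurable mS gammaoo.
Let p0 : 0 < p. Proof. exact: lt_trans p1. Qed.

Definition energy_density F x : R := gamma x * enorm (F x) `^ p.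

Lemma energy_density_ge0 F x : S x -> 0 <= energy_density F x.
Proof. by move=> Sx; rewrite mulr_ge0 ?powR_ge0// ltW// gamma0. Qed.

Lemma measurable_energy_density F : (forall i, measurable_fun S (fun x => F x ord0 i)) ->
  measurable_fun S (energy_density F).
Proof.
move=> mF; apply: measurable_funM => //.
exact: (measurableT_comp (measurable_powR p) (measurable_enorm mF)).
Qed.

Lemma integrable_energy_density F : Lp_weighted S gamma p F ->
  mu.-integrable S (EFin \o energy_density F).
Proof.
move=> [mF Foo]; apply/integrableP; split.
  by apply/measurable_EFinP; exact: measurable_energy_density.
apply: le_lt_trans Foo; rewrite le_eqVlt; apply/orP; left; apply/eqP.
by apply: eq_integral => x /set_mem Sx /=; rewrite ger0_norm// energy_density_ge0.
Qed.

Lemma Lp_weighted_integrable F i : Lp_weighted S gamma p F ->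
  mu.-integrable S (EFin \o (fun x => F x ord0 i)).
Proof.
move=> Fp; have [mF _] := Fp.
have gi := (Lq1P mS _).1 gammaL1.
apply: (integrableR_le mS (mF i) (integrableRD mS gi (integrable_energy_density Fp))) => x Sx.
apply: (le_trans (coord_le_enorm _ _)).
have := young_weight p1 ltr01 (gamma0 Sx) (enorm_ge0 (F x)).
by rewrite powR1 !mul1r.
Qed.

Lemma Rintegral_coord_le F i (eta : R) : 0 < eta -> Lp_weighted S gamma p F ->
  \int[mu]_(x in S) `|F x ord0 i| <=
  eta * \int[mu]_(x in S) (gamma x `^ (1 / (1 - p))) +
  eta `^ (1 - p) * \int[mu]_(x in S) energy_density F x.
Proof.
move=> eta0 Fp; have gi := (Lq1P mS _).1 gammaL1.
have ei := integrable_energy_density Fp.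
have [i1 i2] := (integrableRZ eta mS gi, integrableRZ (eta `^ (1 - p)) mS ei).
rewrite -!RintegralZl// -RintegralD//; apply: le_Rintegral => //.
- exact/integrable_norm/Lp_weighted_integrable.
- exact: integrableRD.
- by move=> x Sx; rewrite (le_trans (coord_le_enorm _ _))// young_weight// ?enorm_ge0// gamma0.
Qed.

Lemma W1p_cst (c : R) : W1p S gamma p (fun=> c).
Proof.
have dc := cst_gradient c oS Sfin.
have wc := weak_gradient_ae oS dc.
have wd : weakly_differentiable S (fun=> c) by exists (fun=> 0).
have [_ wL _] := weak_gradientP wd.
split => //; first by apply: Lq_cst => //; rewrite lee_fin ltW.
have mw i : measurable_fun S (fun x => weak_gradient S (fun=> c) x ord0 i) by have [] := wL i.
split => //.
rewrite (_ : (\int[mu]_(x in S) _)%E = \int[mu]_(x in S) (cst 0 x))%E; last first.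
  apply: ae_eq_integral => //.
  - by apply/measurable_EFinP; exact: (measurable_energy_density mw).
  - apply: filterS wc => x + Sx => /(_ Sx) ->.
    by rewrite /enorm dot0 sqrtr0 powR0 ?mulr0// gt_eqF.
by rewrite integral0 ltry.
Qed.

End weighted.

Section calA_inequalities.
Context (R : realType) (n : nat).
Local Notation mu := (lebesgue_rV R n).
Variables (S : set 'rV[R]_n) (gamma : 'rV[R]_n -> R) (p : R).
Hypotheses (oS : open S) (Sfin : (mu S < +oo)%E) (p1 : 1 < p)
  (gamma0 : forall x, S x -> 0 < gamma x) (gammaoo : Lq S +oo gamma)
  (gammaL1 : Lq S 1 (fun x => gamma x `^ (1 / (1 - p)))).
Variables f g : 'rV[R]_n -> R.
Hypothesis fg : calA S gamma p f g.
Local Notation W k := (weak_gradient S (truncate k \o f)).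
Local Notation gf := (gen_gradient S f).

Let mS := open_measurable_rV oS.
Let mgamma := Lq_measurable mS gammaoo.
Let p0 : 0 < p. Proof. exact: lt_trans p1. Qed.

Let fi : mu.-integrable S (EFin \o f).
Proof. by have [/(Lq1P mS)] := fg. Qed.

Let W1pW k : 0 < k -> W1p S gamma p (truncate k \o f).
Proof. by have [_ _ H _] := fg; exact: H. Qed.

Let mf := integrable_measurableR fi.

Let dW k : 0 < k -> weakly_differentiable S (truncate k \o f).
Proof. by move=> /W1pW[]. Qed.

Let iW k i : 0 < k -> mu.-integrable S (EFin \o (fun x => W k x ord0 i)).
Proof.
by move=> /W1pW[_ _ Wp]; exact: (Lp_weighted_integrable oS p1 gamma0 gammaoo gammaL1).
Qed.

Let lhs k c x := gamma x * enorm (gf x) `^ (p - 2) *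
  dot (gf x) (weak_gradient S (truncate k \o (fun x => f x - c)) x).

Let gfP : is_gen_gradient S f gf.
Proof. exact: gen_gradientP. Qed.

Let lhsE k c : 0 < k -> {ae mu, forall x, S x ->
  lhs k c x = if `|f x - c| < k then energy_density gamma p gf x else 0}.
Proof.
move=> k0; apply: filterS (weak_gradient_truncate_shift oS Sfin mf dW iW c k0) => x H Sx.
rewrite /lhs (H Sx) -mulrA; case: ifP => _; last by rewrite dot0 !mulr0.
by rewrite enorm_powR_dot.
Qed.

Let measurable_lhs k c : 0 < k -> measurable_fun S (lhs k c).
Proof.
move=> k0; have [mgf _] := gfP.
have [_ mw _] := weak_gradientP (weakly_differentiable_truncate_shift oS Sfin mf dW iW c k0).
apply: measurable_funM; last by apply: measurable_dot => // i; have [] := mw i.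
apply: measurable_funM => //.
exact: (measurableT_comp (measurable_powR (p - 2)) (measurable_enorm mgf)).
Qed.

Let measurable_cut k c : measurable_fun S (fun x =>
  if `|f x - c| < k then energy_density gamma p gf x else 0).
Proof.
have mD : measurable (S `&` [set x | `|f x - c| < k]).
  rewrite (_ : [set x | _] = (fun x => f x - c) @^-1` `]- k, k[); last first.
    by apply/seteqP; split => x /=; rewrite in_itv /= -ltr_norml.
  by apply: measurable_funB => //; exact: measurable_cst.
apply: (@eq_measurable_fun _ _ _ _ _
    (fun x => \1_(S `&` [set x | `|f x - c| < k]) x * energy_density gamma p gf x)).
  move=> x; rewrite inE => Sx; rewrite indicE; case: ifPn => fk.
    by rewrite mem_set// mul1r.
  by rewrite memNset ?mul0r// => -[_ /=]; apply/negP.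
apply: measurable_funM.
  by apply: measurable_funTS; exact: measurable_indic.
by have [mgf _] := gfP; exact: (measurable_energy_density p oS gammaoo).
Qed.

(** The constant c is an admissible phi, and the gradient of the truncation of f - c is the
    generalized gradient of f on |f - c| < k and 0 elsewhere; so the left side of the inequality
    becomes the energy on that level set. *)
Let calA_cut k c : 0 < k ->
  \int[mu]_(x in S) (if `|f x - c| < k then energy_density gamma p gf x else 0) <=
  \int[mu]_(x in S) (g x * truncate k (f x - c)).
Proof.
move=> k0; have [_ _ _ H] := fg.
have := H k (fun=> c) k0 (W1p_cst oS Sfin p1 gammaoo c) (Lq_cst mS c Sfin (leey _)).
apply: le_trans; rewrite le_eqVlt; apply/orP; left; apply/eqP.
rewrite /Rintegral; congr fine; apply: ae_eq_integral => //.
- by apply/measurable_EFinP; exact: measurable_cut.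
- by apply/measurable_EFinP; exact: (measurable_lhs c k0).
- by apply: filterS (lhsE c k0) => x H' Sx; rewrite -(H' Sx).
Qed.

Lemma calA_truncate_shift_ge0 k c : 0 < k ->
  0 <= \int[mu]_(x in S) (g x * truncate k (f x - c)).
Proof.
move=> k0; apply: le_trans (calA_cut c k0); apply: Rintegral_ge0 => x Sx.
by case: ifP => // _; exact: (energy_density_ge0 _ gamma0).
Qed.

Lemma calA_energy_le k : 0 < k ->
  \int[mu]_(x in S) energy_density gamma p (W k) x <=
  \int[mu]_(x in S) (g x * truncate k (f x)).
Proof.
move=> k0; have := calA_cut 0 k0.
have E : (fun x => g x * truncate k (f x - 0)) = (fun x => g x * truncate k (f x)).
  by apply/funext => x; rewrite subr0.
rewrite E; apply: le_trans; rewrite le_eqVlt; apply/orP; left; apply/eqP.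
have [_ mw _] := weak_gradientP (dW k0).
rewrite /Rintegral; congr fine; apply: ae_eq_integral => //.
- apply/measurable_EFinP; apply: (measurable_energy_density p oS gammaoo) => i.
  by have [] := mw i.
- by apply/measurable_EFinP; exact: measurable_cut.
have [_ /(_ _ k0)[_]] := gfP; apply: filterS => x H Sx; rewrite subr0.
rewrite /energy_density (H Sx); case: ifP => // _.
by rewrite /enorm dot0 sqrtr0 powR0 ?mulr0// gt_eqF.
Qed.

Lemma calA_integrable k i : 0 < k ->
  mu.-integrable S (EFin \o (fun x => W k x ord0 i)).
Proof. exact: iW. Qed.

End calA_inequalities.

(** * Integrating a left Dini bound that holds off a null set *)

Section ac_dini.
Context (R : realType).
Local Notation lambda := (@lebesgue_measure R).
Variables (E : R -> R) (a b d : R) (N : set R).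
Hypotheses (ab : a <= b) (d0 : 0 <= d) (mN : measurable N) (N0 : lambda N = 0%E).

Definition nonoverlapping_in (x y : R) (I : seq (R * R)) :=
  (forall J, J \in I -> [/\ x <= J.1, J.1 <= J.2 & J.2 <= y]) /\
  pairwise (fun J K : R * R => J.2 <= K.1) I.

Hypothesis ac : forall e, 0 < e -> exists2 delta, 0 < delta &
  forall I, nonoverlapping_in a b I -> \sum_(J <- I) (J.2 - J.1) < delta ->
    \sum_(J <- I) `|E J.2 - E J.1| < e.
Hypothesis dini : forall t, a < t <= b -> ~ N t -> forall eta, 0 < eta ->
  exists2 rho, 0 < rho & forall s, a <= s -> t - rho < s -> s < t ->
    E t - E s <= (- d + eta) * (t - s).

Let right_cont s e : a <= s <= b -> 0 < e -> exists2 delta, 0 < delta &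
  forall t, s <= t <= b -> t - s < delta -> `|E t - E s| < e.
Proof.
move=> /andP[as_ sb] e0; have [delta delta0 H] := ac e0.
exists delta => // t /andP[st tb] ts.
have := H [:: (s, t)]; rewrite !big_seq1 /=; apply => //.
by split => // J; rewrite inE => /eqP ->.
Qed.

Section with_cover.
Variables (U : set R) (eps : R).
Hypotheses (oU : open U) (NU : N `<=` U) (eps0 : 0 < eps).

(** Invariant of a real induction from b leftwards: E decreases at rate d - eps, except on the
    intervals of I, which absorb the points of N and are charged with their variation. The slack eta
    makes the property pass to limits. *)
Let P t := forall eta, 0 < eta -> exists I, [/\ nonoverlapping_in t b I,
  ((\sum_(J <- I) (J.2 - J.1))%:E <= lambda (U `&` `]t, b]))%E &
  E b - E t <= (- d + eps) * (b - t) + eta +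
    \sum_(J <- I) (`|E J.2 - E J.1| + d * (J.2 - J.1))].

Let nonoverlapping_widen x x' I : x' <= x -> nonoverlapping_in x b I ->
  nonoverlapping_in x' b I.
Proof.
by move=> xx' [HI pI]; split => // J /HI[? ? ?]; split => //; exact: le_trans xx' _.
Qed.

Let mU t t' : measurable (U `&` `]t, t']).
Proof. by apply: measurableI => //; exact: open_measurable. Qed.

Let Pb : P b.
Proof.
move=> eta eta0; exists [::]; split; first by split.
  by rewrite big_nil measure_ge0.
by rewrite !subrr mulr0 big_nil add0r addr0 ltW.
Qed.

(** Half of eta goes to P t; moving from t to s costs |E t - E s| and d (t - s), each at most eta /
    4. *)
Let P_closed s : a <= s <= b -> (forall e, 0 < e -> exists t, [/\ s <= t <= b, t - s < e & P t]) ->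
  P s.
Proof.
move=> sab H eta eta0.
have e0 : 0 < eta / 4 by rewrite divr_gt0.
have [delta delta0 Hd] := right_cont sab e0.
have d1 : 0 < d + 1 by rewrite ltr_wpDl.
have m0 : 0 < Num.min delta (eta / 4 / (d + 1)) by rewrite lt_min delta0 divr_gt0.
have [t [/andP[st tb] ts Pt]] := H _ m0.
have eta2 : 0 < eta / 2 by rewrite divr_gt0.
have [I [nI lI EI]] := Pt _ eta2; exists I; split.
- exact: nonoverlapping_widen nI.
- apply: (le_trans lI); apply: le_measure; rewrite ?inE; [exact: mU|exact: mU|].
  by apply: setIS => x /=; rewrite !in_itv/= => /andP[tx ->]; rewrite (le_lt_trans st).
have td : t - s < delta by rewrite (lt_le_trans ts)// ge_min lexx.
have tE : `|E t - E s| < eta / 4 by apply: Hd => //; rewrite st.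
have dts : d * (t - s) <= eta / 4.
  have : t - s < eta / 4 / (d + 1) by rewrite (lt_le_trans ts)// ge_min lexx orbT.
  rewrite ltr_pdivlMr// mulrDr mulr1 [d * _]mulrC.
  have : 0 <= t - s by rewrite subr_ge0.
  lra.
move: tE; rewrite ltr_norml => /andP[_ tE].
have ets : 0 <= eps * (t - s) by rewrite mulr_ge0 ?subr_ge0// ltW.
apply: (@le_trans _ _ (E b - E t + eta / 4)); first by lra.
rewrite (_ : (- d + eps) * (b - s) = (- d + eps) * (b - t) - d * (t - s) + eps * (t - s)); last by ring.
lra.
Qed.

(** At a point of N a short interval inside U is added to I; at any other point the Dini bound is
    applied with eps and I stays as it is. *)
Let P_step s : a < s <= b -> P s -> exists2 t, a <= t < s & P t.
Proof.
move=> /andP[as_ sb] Ps; have [Ns|Ns] := pselect (N s).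
  have /nbhs_ballP[r /= r0 sU] := open_nbhs_nbhs (conj oU (NU Ns)).
  pose t := Num.max a (s - r / 2).
  have ts : t < s by rewrite gt_max as_ /=; lra.
  exists t; first by rewrite ts le_max lexx.
  have tsU : `]t, s] `<=` U.
    move=> x /=; rewrite in_itv/= gt_max => /andP[/andP[ax sx] xs]; apply: sU.
    by rewrite /ball/= ger0_norm ?subr_ge0//; lra.
  move=> eta eta0; have [I [[HI pI] lI EI]] := Ps _ eta0.
  exists ((t, s) :: I); split.
  - split; last first.
      by rewrite /= pI andbT; apply/allP => J /HI[].
    move=> J; rewrite inE => /orP[/eqP -> /=|/HI[? ? ?]]; split => //; try exact: ltW.
    by rewrite (le_trans (ltW ts)).
  - rewrite big_cons EFinD.
    have -> : U `&` `]t, b] = `]t, s] `|` (U `&` `]s, b]).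
      apply/seteqP; split => [x [Ux]|x [tx|[Ux]]] /=.
      + rewrite in_itv/= => /andP[tx xb]; have [xs|xs] := leP x s.
          by left; rewrite /= in_itv/= tx xs.
        by right; split => //; rewrite /= in_itv/= xs xb.
      + split; first exact: tsU.
        by move: tx; rewrite /= !in_itv/= => /andP[-> xs]; rewrite (le_trans xs).
      + rewrite !in_itv/= => /andP[sx xb]; split => //.
        by rewrite (lt_trans ts sx) xb.
    rewrite measureU//; [|exact: mU|].
    + apply: leeD => //.
      by rewrite /= lebesgue_measure_itv/= lte_fin ts.
    + apply/seteqP; split => // x [] /=; rewrite !in_itv/= => /andP[_ xs] [_ /andP[sx _]].
      by move: (le_lt_trans xs sx); rewrite ltxx.
  - rewrite big_cons /=.
    have : E s - E t <= `|E s - E t| by exact: ler_norm.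
    have : 0 <= eps * (s - t) by rewrite mulr_ge0 ?subr_ge0// ltW.
    rewrite (_ : (- d + eps) * (b - t) = (- d + eps) * (b - s) - d * (s - t) + eps * (s - t)); last by ring.
    lra.
have [|rho rho0 H] := @dini s _ Ns eps eps0; first by rewrite as_.
pose t := Num.max a (s - rho / 2).
have ts : t < s by rewrite gt_max as_ /=; lra.
have at_ : a <= t by rewrite le_max lexx.
have rt : s - rho < t.
  by rewrite lt_max; apply/orP; right; lra.
exists t; first by rewrite ts at_.
move=> eta eta0; have [I [nI lI EI]] := Ps _ eta0; exists I; split.
- exact: nonoverlapping_widen (ltW ts) nI.
- apply: (le_trans lI); apply: le_measure; rewrite ?inE; [exact: mU|exact: mU|].
  by apply: setIS => x /=; rewrite !in_itv/= => /andP[tx ->]; rewrite (lt_trans ts tx).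
have := H t at_ rt ts.
rewrite (_ : (- d + eps) * (b - t) = (- d + eps) * (b - s) + (- d + eps) * (s - t)); last by ring.
lra.
Qed.

(** The infimum of the times at which P holds belongs to them by [P_closed], and [P_step] lets it be
    only a. *)
Lemma ac_dini_cover : P a.
Proof.
pose A := [set t | a <= t <= b /\ P t].
have Ab : A b by split; [rewrite ab lexx|exact: Pb].
have hA : has_inf A by split; [exists b|exists a => t [/andP[]]].
pose s := inf A.
have as_ : a <= s by apply: lb_le_inf; [exists b|move=> t [/andP[]]].
have sb : s <= b by apply: ge_inf => //; case: hA.
have Ps : P s.
  apply: P_closed; first by rewrite as_.
  move=> e e0; have [t [/andP[at_ tb] Pt] ts] := inf_adherent e0 hA.
  exists t; split => //; last by rewrite ltrBlDl.
  by rewrite tb andbT; apply: ge_inf; [case: hA|split => //; rewrite at_].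
move: as_; rewrite le_eqVlt => /orP[/eqP -> //|as_].
have [|t /andP[at_ ts] Pt] := P_step _ Ps; first by rewrite as_.
have : s <= t.
  apply: ge_inf; first by case: hA.
  by split => //; rewrite at_ (le_trans (ltW ts)).
by rewrite leNgt ts.
Qed.

End with_cover.

(* Off the null set N the left Dini bound applies; N itself is covered by an open
   set so small that absolute continuity controls the variation of E on it. *)
Lemma ac_dini_le : E b - E a <= - d * (b - a).
Proof.
apply/ler_addgt0Pl => e e0; rewrite [e + _]addrC.
have e4 : 0 < e / 4 by rewrite divr_gt0.
have [delta delta0 H] := ac e4.
have d1 : 0 < d + 1 by rewrite ltr_wpDl.
have m0 : 0 < Num.min delta (e / 4 / (d + 1)) by rewrite lt_min delta0 divr_gt0.
have [U [oU NU lU]] : exists U, [/\ open U, N `<=` U &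
    (lambda U < (Num.min delta (e / 4 / (d + 1)))%:E)%E].
  have Noo : (lambda N < +oo)%E by rewrite N0.
  have [U [oU NU lUN]] := lebesgue_regularity_outer mN Noo m0.
  exists U; split => //; rewrite (_ : U = N `|` (U `\` N)); last by rewrite setDUK.
  have mUU := open_measurable oU.
  rewrite measureU//; [|exact: measurableD|by rewrite setDIK].
  apply: (le_lt_trans _ lUN); rewrite [X in (X + _)%E](_ : _ = 0%E) ?add0e//.
have ba : 0 <= b - a by rewrite subr_ge0.
pose eps := e / 4 / (b - a + 1).
have b1 : 0 < b - a + 1 by rewrite ltr_wpDl.
have eps0 : 0 < eps by rewrite divr_gt0.
have [I [nI lI EI]] := ac_dini_cover oU NU eps0 e4.
have lI' : \sum_(J <- I) (J.2 - J.1) < Num.min delta (e / 4 / (d + 1)).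
  rewrite -lte_fin (le_lt_trans lI)// (le_lt_trans _ lU)//.
  apply: le_measure; rewrite ?inE//.
    by apply: measurableI => //; exact: open_measurable.
  exact: open_measurable.
apply: (le_trans EI); rewrite big_split /= -mulr_sumr.
have := H I nI (lt_le_trans lI' _); rewrite ge_min lexx => /(_ isT) sE.
have dl : d * \sum_(J <- I) (J.2 - J.1) <= e / 4.
  have : \sum_(J <- I) (J.2 - J.1) < e / 4 / (d + 1).
    by rewrite (lt_le_trans lI')// ge_min lexx orbT.
  rewrite ltr_pdivlMr// mulrDr mulr1 [d * _]mulrC.
  have : 0 <= \sum_(J <- I) (J.2 - J.1).
    rewrite big_seq; apply: sumr_ge0 => J JI; rewrite subr_ge0.
    by case: nI => + _ => /(_ _ JI)[].
  lra.
have ee : eps * (b - a) <= e / 4.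
  by rewrite /eps mulrAC ler_pdivrMr// ler_wpM2l ?(ltW e4)//; lra.
rewrite (_ : (- d + eps) * (b - a) = - d * (b - a) + eps * (b - a)); last by ring.
lra.
Qed.

End ac_dini.

(** * Huber energies along the solution *)

Section huber.
Context (R : realType).
Implicit Types (k y z c : R).

(* The antiderivative of truncate k. *)
Definition huber k y : R := truncate k y * y - truncate k y ^+ 2 / 2.

(** [huber k] is the supremum of the affine functions t y - t^2 / 2 over |t| <= k, attained at the
    truncation of y; convexity amounts to comparing two choices of t. *)
Lemma huber_ge k y (t : R) : 0 < k -> `|t| <= k -> t * y - t ^+ 2 / 2 <= huber k y.
Proof.
move=> k0; rewrite ler_norml => /andP[t1 t2]; rewrite /huber.
have [yk|] := ltP `|y| k.
  by rewrite truncate_id//; have := sqr_ge0 (y - t); rewrite sqrrB !expr2; lra.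
rewrite ler_normr => /orP[ky|ky].
  rewrite truncate_ge//.
  have : 0 <= (k - t) * (y - (k + t) / 2) by rewrite mulr_ge0//; lra.
  lra.
rewrite truncate_leN//; last by lra.
have : 0 <= (k + t) * (- y - (k - t) / 2) by rewrite mulr_ge0//; lra.
lra.
Qed.

Lemma huber_convex k y z : 0 < k -> huber k y - huber k z <= truncate k y * (y - z).
Proof.
move=> k0; have := huber_ge z k0 (truncate_le y k0); rewrite {2}/huber; lra.
Qed.

Lemma huber_lipschitz k y z : 0 < k -> `|huber k y - huber k z| <= k * `|y - z|.
Proof.
move=> k0.
have H u w : huber k u - huber k w <= k * `|u - w|.
  apply: (le_trans (huber_convex _ _ k0)); apply: (le_trans (ler_norm _)).
  by rewrite normrM ler_wpM2r// truncate_le.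
by rewrite ler_norml lerNl opprB H distrC H.
Qed.

Lemma huber0 k : 0 < k -> huber k 0 = 0.
Proof. by move=> k0; rewrite /huber truncate_id ?normr0// mulr0 expr0n/= mul0r subr0. Qed.

Lemma huber_ge0 k y : 0 < k -> 0 <= huber k y.
Proof.
move=> k0; have := @huber_ge k y 0 k0; rewrite normr0 mul0r expr0n/= mul0r subr0.
by apply; exact: ltW.
Qed.

Lemma huber_le k y : 0 < k -> huber k y <= k * `|y|.
Proof.
move=> k0; have := huber_lipschitz y 0 k0; rewrite huber0// !subr0.
by rewrite ger0_norm ?huber_ge0.
Qed.

(** Together with [huber_le]: after division by k, the Huber function differs from |y| by at most k
    / 2. *)
Lemma huber_lower k y : 0 < k -> k * `|y| - k ^+ 2 / 2 <= huber k y.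
Proof.
move=> k0; have [y0|y0] := leP 0 y.
  by rewrite ger0_norm//; apply: huber_ge; rewrite ?gtr0_norm.
rewrite ltr0_norm// mulrN -mulNr -sqrrN; apply: huber_ge => //.
by rewrite normrN gtr0_norm.
Qed.

End huber.

Lemma small_tail d (T : measurableType d) (R : realType)
    (mu : {measure set T -> \bar R}) (D : set T) (f : T -> R) (e : R) :
  measurable D -> mu.-integrable D (EFin \o f) -> 0 < e ->
  exists c : R, [/\ 0 <= c, mu.-integrable D (EFin \o tail f c) &
    \int[mu]_(x in D) tail f c x <= e].
Proof.
move=> mD fi e0.
have tE c : tail (f \_ D) c = (tail f c) \_ D.
  by apply/funext => x; rewrite /tail !patchE; case: ifP => // _; rewrite normr0 mul0r.
have fDi : mu.-integrable setT (EFin \o f \_ D).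
  by rewrite -restrict_EFin; apply/(integrable_mkcond _ mD).
have /cvgrPdist_le/(_ e e0)[k _ /(_ k (leqnn k))] := cvg_tail fDi.
rewrite sub0r normrN /= tE -Rintegral_mkcond => H.
exists k%:R; split => //; last exact: le_trans (ler_norm _) H.
by apply/(integrable_mkcond _ mD); rewrite restrict_EFin -tE; exact: integrable_tail.
Qed.

Section time_evolution.
Context (R : realType) (n : nat).
Local Notation mu := (lebesgue_rV R n).
Local Notation lambda := (@lebesgue_measure R).
Variables (S : set 'rV[R]_n) (gamma : 'rV[R]_n -> R) (p : R).
Hypotheses (oS : open S) (Sfin : (mu S < +oo)%E) (p1 : 1 < p)
  (gamma0 : forall x, S x -> 0 < gamma x) (gammaoo : Lq S +oo gamma)
  (gammaL1 : Lq S 1 (fun x => gamma x `^ (1 / (1 - p)))).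
Variables (u : 'rV[R]_n -> R) (v : R -> 'rV[R]_n -> R).
Hypothesis sol : strong_solution S gamma p u v.

Let mS := open_measurable_rV oS.

Lemma Lq_norm1E f : Lq_norm S 1 f = (\int[mu]_(x in S) (`|f x|)%:E)%E.
Proof.
rewrite -[1%E]/(1%:E) Lq_normE// invr1 poweRe1.
  by apply: eq_integral => x _; rewrite powRr1.
by apply: integral_ge0 => x _; rewrite lee_fin powR_ge0.
Qed.

Lemma Lq_norm1_Rintegral f : mu.-integrable S (EFin \o f) ->
  Lq_norm S 1 f = (\int[mu]_(x in S) `|f x|)%:E.
Proof.
move=> fi; rewrite Lq_norm1E /Rintegral fineK//.
exact: (integrable_fin_num mS (integrable_norm fi)).
Qed.

Lemma solution_integrable t : 0 <= t -> mu.-integrable S (EFin \o v t).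
Proof. by move=> t0; case: sol => H _ _ _ _; apply/(Lq1P mS); exact: H. Qed.

Lemma cst_integrable c : mu.-integrable S (EFin \o (fun=> c)).
Proof. by apply: (bounded_integrable (k := `|c|)). Qed.

Let diff_integrable s t : 0 <= s -> 0 <= t ->
  mu.-integrable S (EFin \o (fun x => v s x - v t x)).
Proof. by move=> s0 t0; exact: (integrableRB mS (solution_integrable s0) (solution_integrable t0)). Qed.

Section energy.
Variables (k c : R).
Hypothesis k0 : 0 < k.

Let hE t x := huber k (v t x - c).

Let mtr t : 0 <= t -> measurable_fun S (fun x => truncate k (v t x - c)).
Proof.
move=> t0; apply: (measurableT_comp (measurable_truncate k0)).
apply: measurable_funB => //; exact: integrable_measurableR (solution_integrable t0).
Qed.

Lemma huber_integrable t : 0 <= t -> mu.-integrable S (EFin \o hE t).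
Proof.
move=> t0; have ti := solution_integrable t0.
have tci := integrableRB mS ti (cst_integrable c).
have mh : measurable_fun S (hE t).
  apply: measurable_funB; first by apply: measurable_funM; [exact: mtr|exact: integrable_measurableR tci].
  by apply: measurable_funM => //; exact: measurable_funX (mtr t0).
apply: (integrableR_le mS mh (integrableRZ k mS (integrable_norm tci))) => x Sx.
by rewrite ger0_norm ?huber_ge0// huber_le.
Qed.

Definition huber_energy t := \int[mu]_(x in S) hE t x.

Lemma huber_energy_ge0 t : 0 <= huber_energy t.
Proof. by apply: Rintegral_ge0 => x _; exact: huber_ge0. Qed.

Lemma huber_energy_lipschitz s t : 0 <= s -> 0 <= t ->
  `|huber_energy s - huber_energy t| <= k * \int[mu]_(x in S) `|v s x - v t x|.
Proof.
move=> s0 t0; have [si ti] := (huber_integrable s0, huber_integrable t0).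
have sti := integrable_norm (diff_integrable s0 t0).
rewrite /huber_energy -RintegralB//.
apply: (le_trans (le_normr_Rintegral mS (integrableRB mS si ti))).
rewrite -RintegralZl//; apply: le_Rintegral => //.
- exact/integrable_norm/integrableRB.
- exact: (integrableRZ k mS sti).
- move=> x _; apply: (le_trans (huber_lipschitz _ _ k0)).
  by rewrite (_ : v s x - c - _ = v s x - v t x)//; ring.
Qed.

Lemma huber_energy_ac a b : 0 < a -> a <= b ->
  forall e, 0 < e -> exists2 delta, 0 < delta &
  forall I, nonoverlapping_in a b I -> \sum_(J <- I) (J.2 - J.1) < delta ->
    \sum_(J <- I) `|huber_energy J.2 - huber_energy J.1| < e.
Proof.
move=> a0 ab e e0; have ek0 : 0 < e / k by rewrite divr_gt0.
case: sol => _ _ H _ _; have [d d0 Hd] := H a b a0 ab (e / k) ek0.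
exists d => // I [HI pI] sI; have := Hd I HI pI sI.
have HI0 J : J \in I -> 0 <= J.1 /\ 0 <= J.2.
  by move=> /HI[aJ JJ _]; split; rewrite ?(le_trans _ JJ)// (le_trans (ltW a0)).
rewrite big_seq (eq_bigr (fun J => (\int[mu]_(x in S) `|v J.2 x - v J.1 x|)%:E)); last first.
  by move=> J /HI0[? ?]; rewrite Lq_norm1_Rintegral//; exact: diff_integrable.
rewrite -big_seq sumEFin lte_fin ltr_pdivlMr// mulrC; apply: le_lt_trans.
rewrite mulr_sumr big_seq [X in _ <= X]big_seq; apply: ler_sum => J /HI0[? ?].
exact: huber_energy_lipschitz.
Qed.

(** Convexity bounds the increment by the slope at its right end t, where the equation holds; hence
    only s < t is treated. The error of the difference quotient has L^1 norm below eta / k and meets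
    a slope bounded by k. *)
Lemma huber_energy_dini t w D : 0 < t -> L1_derivative S v t w ->
  D <= \int[mu]_(x in S) ((\- w) x * truncate k (v t x - c)) ->
  forall eta, 0 < eta -> exists2 rho, 0 < rho & forall s, 0 <= s ->
    t - rho < s -> s < t -> huber_energy t - huber_energy s <= (- D + eta) * (t - s).
Proof.
move=> t0 [/(Lq1P mS) wi wd] Dw eta eta0.
have ek0 : 0 < eta / k by rewrite divr_gt0.
pose r h x := h^-1 * (v (t + h) x - v t x) - w x.
have [rho rho0 Hrho] : exists2 rho, 0 < rho & forall h, h != 0 -> `|h| < rho ->
    (Lq_norm S 1 (r h) < (eta / k)%:E)%E.
  have /wd /nbhs_ballP[rho /= rho0 H] : nbhs 0%E [set y : \bar R | (y < (eta / k)%:E)%E].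
    by apply: open_nbhs_nbhs; split; [exact: open_ereal_lt_ereal|rewrite /= lte_fin].
  by exists rho => // h h0 hr; apply: H => //=; rewrite /ball /= sub0r normrN.
exists rho => // s s0 ts st; have s_t : 0 < t - s by rewrite subr_gt0.
have h0 : s - t != 0 by rewrite lt_eqF// subr_lt0.
have hr : `|s - t| < rho by rewrite ltr0_norm ?subr_lt0//; lra.
have ri : mu.-integrable S (EFin \o r (s - t)).
  apply: (integrableRB mS) => //; apply: (integrableRZ _ mS); rewrite addrC subrK.
  exact: diff_integrable s0 (ltW t0).
have := Hrho _ h0 hr; rewrite Lq_norm1_Rintegral// lte_fin => rk.
have [hti hsi] := (huber_integrable (ltW t0), huber_integrable s0).
have mt := mtr (ltW t0).
have wti : mu.-integrable S (EFin \o (fun x => (\- w) x * truncate k (v t x - c))).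
  apply: (integrable_mul_bounded mS _ mt) => [|x]; last exact: truncate_le.
  by have := integrableRZ (-1) mS wi; apply: eq_integrable => // x _ /=; rewrite mulN1r.
rewrite /huber_energy -RintegralB//.
apply: (@le_trans _ _ (\int[mu]_(x in S) ((t - s) * (k * `|r (s - t) x| -
    (\- w) x * truncate k (v t x - c))))).
  apply: le_Rintegral => //.
  - exact: integrableRB.
  - apply: (integrableRZ _ mS); apply: (integrableRB mS) => //.
    exact: (integrableRZ k mS (integrable_norm ri)).
  - move=> x Sx; apply: (le_trans (huber_convex _ _ k0)).
    have -> : v t x - c - (v s x - c) = (t - s) * (r (s - t) x + w x).
      rewrite /r addrCA subrr addr0 subrK mulrA -[t - s]opprB mulNr mulfV// mulN1r; ring.
    rewrite mulrCA ler_pM2l//= mulrDr lerD//; last by rewrite mulNr opprK mulrC.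
    by rewrite (le_trans (ler_norm _))// normrM ler_wpM2r// truncate_le.
rewrite RintegralZl//; last first.
  apply: (integrableRB mS) => //; exact: (integrableRZ k mS (integrable_norm ri)).
rewrite mulrC ler_wpM2r ?(ltW s_t)// RintegralB//; last first.
  exact: (integrableRZ k mS (integrable_norm ri)).
rewrite RintegralZl//; last exact: integrable_norm.
by move: rk; rewrite ltr_pdivlMr// mulrC => rk; lra.
Qed.

(** The times at which the equation fails form the exceptional set of [ac_dini_le]. The left end a
    is positive because the curve is absolutely continuous only locally in (0, oo). *)
Lemma huber_energy_decrease a b d : 0 < a -> a <= b -> 0 <= d ->
  (forall t w, 0 < t -> calA S gamma p (v t) (\- w) ->
    d <= \int[mu]_(x in S) ((\- w) x * truncate k (v t x - c))) ->
  huber_energy b - huber_energy a <= - d * (b - a).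
Proof.
move=> a0 ab d0 H; case: sol => _ _ _ [N [mN N0 HN]] _.
apply: (ac_dini_le ab d0 mN N0); first exact: huber_energy_ac.
move=> t /andP[at_ tb] Nt eta eta0; have t0 := lt_trans a0 at_.
have [w wd wA] : exists2 w, L1_derivative S v t w & calA S gamma p (v t) (\- w).
  by apply: contrapT => nw; apply: Nt; apply: HN => /= /(_ t0).
have [rho rho0 Hr] := huber_energy_dini t0 wd (H _ _ t0 wA) eta0.
by exists rho => // s as_; apply: Hr; exact: le_trans (ltW a0) as_.
Qed.

End energy.

Lemma huber_energy_nonincreasing k c a b : 0 < k -> 0 < a -> a <= b ->
  huber_energy k c b <= huber_energy k c a.
Proof.
move=> k0 a0 ab; rewrite -subr_le0.
have := huber_energy_decrease (d := 0) k0 a0 ab (lexx _).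
rewrite oppr0 mul0r; apply => t w t0 wA.
exact: (calA_truncate_shift_ge0 oS Sfin p1 gamma0 gammaoo gammaL1 wA).
Qed.

Let dist_integrable c t : 0 <= t -> mu.-integrable S (EFin \o (fun x => `|v t x - c|)).
Proof.
move=> t0; exact: integrable_norm (integrableRB mS (solution_integrable t0) (cst_integrable c)).
Qed.

Let L1_dist_cst_nonincreasing_pos c a b : 0 < a -> a <= b ->
  \int[mu]_(x in S) `|v b x - c| <= \int[mu]_(x in S) `|v a x - c|.
Proof.
move=> a0 ab; apply/ler_addgt0Pr => e e0.
have b0 := lt_le_trans a0 ab.
have m0 : 0 < fine (mu S) + 1 by rewrite ltr_wpDl// fine_ge0.
pose k := e / (fine (mu S) + 1); have k0 : 0 < k by rewrite divr_gt0.
have kS : k * fine (mu S) <= e.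
  by rewrite /k mulrAC ler_pdivrMr// ler_wpM2l ?(ltW e0)//; lra.
have := huber_energy_nonincreasing c k0 a0 ab; rewrite /huber_energy => H.
have [ai bi] := (dist_integrable c (ltW a0), dist_integrable c (ltW b0)).
have H1 : \int[mu]_(x in S) huber k (v a x - c) <= k * \int[mu]_(x in S) `|v a x - c|.
  rewrite -RintegralZl//; apply: le_Rintegral => //.
  - exact: huber_integrable (ltW a0).
  - exact: (integrableRZ k mS ai).
  - by move=> x _; exact: huber_le.
have H2 : k * \int[mu]_(x in S) `|v b x - c| - k ^+ 2 / 2 * fine (mu S) <=
    \int[mu]_(x in S) huber k (v b x - c).
  rewrite -RintegralZl// -Rintegral_cst// -RintegralB//; last 2 first.
  - exact: (integrableRZ k mS bi).
  - exact: cst_integrable.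
  apply: le_Rintegral => //.
  - apply: (integrableRB mS); first exact: (integrableRZ k mS bi).
    exact: cst_integrable.
  - exact: huber_integrable (ltW b0).
  - by move=> x _; exact: huber_lower.
rewrite -(ler_pM2l k0) mulrDr.
have : k ^+ 2 / 2 * fine (mu S) <= k * e.
  rewrite (_ : _ * _ = k * (k * fine (mu S) / 2)); last by rewrite expr2 -!mulrA [2^-1 * _]mulrC.
  by rewrite ler_wpM2l ?(ltW k0)//; lra.
lra.
Qed.

(** The initial time is out of reach of the energy argument and is added through continuity of the
    curve in L^1(S) at 0. *)
Lemma L1_dist_cst_nonincreasing c s t : 0 <= s -> s <= t ->
  \int[mu]_(x in S) `|v t x - c| <= \int[mu]_(x in S) `|v s x - c|.
Proof.
move=> s0 st; move: s0; rewrite le_eqVlt => /orP[/eqP s0|s0]; last exact: L1_dist_cst_nonincreasing_pos.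
subst s; move: st; rewrite le_eqVlt => /orP[/eqP <- //|t0].
case: sol => _ C _ _ _; apply/ler_addgt0Pr => e e0.
have [r [r0 rt Hr]] : exists r, [/\ 0 < r, r <= t & (Lq_norm S 1 (v r \- v 0)%R < e%:E)%E].
  have /(C 0 (lexx _)) /nbhs_ballP[rho /= rho0 H] : nbhs 0%E [set y : \bar R | (y < e%:E)%E].
    by apply: open_nbhs_nbhs; split; [exact: open_ereal_lt_ereal|rewrite /= lte_fin].
  have m0 : 0 < Num.min t (rho / 2) by rewrite lt_min t0 divr_gt0.
  exists (Num.min t (rho / 2)); split => //; first by rewrite ge_min lexx.
  apply: H => /=; last exact: ltW.
  rewrite /ball /= sub0r normrN gtr0_norm// (@le_lt_trans _ _ (rho / 2))//; last lra.
  by rewrite ge_min lexx orbT.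
apply: (le_trans (L1_dist_cst_nonincreasing_pos c r0 rt)).
have di := diff_integrable (ltW r0) (lexx 0).
move: Hr; rewrite Lq_norm1_Rintegral// lte_fin => Hr.
apply: (@le_trans _ _ (\int[mu]_(x in S) (`|v 0 x - c| + `|(v r \- v 0) x|))).
  apply: le_Rintegral => //.
  - exact: dist_integrable (ltW r0).
  - apply: integrableRD => //; [exact: dist_integrable|exact: integrable_norm].
  - move=> x _; apply: le_trans (ler_normD _ _).
    by rewrite /= (_ : v 0 x - c + _ = v r x - c)//; ring.
rewrite RintegralD//; [|exact: dist_integrable|exact: integrable_norm].
by rewrite lerD2l ltW.
Qed.

(** The integral of |v - c| is c |S| minus the mass plus twice the excess over c. For c large the
    excess at time s is negligible, while at time t it only needs to be nonnegative; monotonicity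
    bounds the loss of mass. The constant - c bounds the gain. *)
Let mass_le s t : 0 <= s -> s <= t -> forall e, 0 < e ->
  `|\int[mu]_(x in S) v s x - \int[mu]_(x in S) v t x| <= e.
Proof.
move=> s0 st e e0; have t0 := le_trans s0 st.
have si := solution_integrable s0; have ti := solution_integrable t0.
have e2 : 0 < e / 2 by rewrite divr_gt0.
have [c [c0 tci Hc]] := small_tail mS si e2.
have ci := cst_integrable c.
have tli : mu.-integrable S (EFin \o (fun x => 2 * tail (v s) c x)).
  exact: (integrableRZ _ mS tci).
have I1 := L1_dist_cst_nonincreasing c s0 st.
have I2 := L1_dist_cst_nonincreasing (- c) s0 st.
have H1 : c * fine (mu S) - \int[mu]_(x in S) v t x <= \int[mu]_(x in S) `|v t x - c|.
  rewrite -Rintegral_cst// -RintegralB//; apply: le_Rintegral => //.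
  - exact: integrableRB.
  - exact: dist_integrable.
  - by move=> x _; rewrite -normrN opprB ler_norm.
have H2 : c * fine (mu S) + \int[mu]_(x in S) v t x <= \int[mu]_(x in S) `|v t x - - c|.
  rewrite -Rintegral_cst// -RintegralD//; apply: le_Rintegral => //.
  - exact: integrableRD.
  - exact: dist_integrable.
  - by move=> x _; rewrite opprK addrC ler_norm.
have tlE : \int[mu]_(x in S) (2 * tail (v s) c x) <= e.
  by rewrite RintegralZl//; lra.
have H3 : \int[mu]_(x in S) `|v s x - c| <= c * fine (mu S) - \int[mu]_(x in S) v s x + e.
  apply: le_trans (lerD (lexx _) tlE).
  rewrite -Rintegral_cst// -RintegralB// -RintegralD//; last exact: integrableRB.
  apply: le_Rintegral => //.
  - exact: dist_integrable.
  - by apply: integrableRD => //; exact: integrableRB.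
  - move=> x _; have [vc|vc] := leP (v s x) c.
      by rewrite ler0_norm ?subr_le0// opprB lerDl mulr_ge0 ?tail_ge0.
    have vs := le_lt_trans c0 vc.
    rewrite gtr0_norm ?subr_gt0// /tail (gtr0_norm vs) vc mulr1; lra.
have H4 : \int[mu]_(x in S) `|v s x - - c| <= c * fine (mu S) + \int[mu]_(x in S) v s x + e.
  apply: le_trans (lerD (lexx _) tlE).
  rewrite -Rintegral_cst// -RintegralD// -RintegralD//; last exact: integrableRD.
  apply: le_Rintegral => //.
  - exact: dist_integrable.
  - by apply: integrableRD => //; exact: integrableRD.
  - move=> x _; have [vc|vc] := leP (- c) (v s x).
      by rewrite ger0_norm ?subr_ge0// opprK addrC lerDl mulr_ge0 ?tail_ge0.
    have vs : v s x < 0 by lra.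
    rewrite ltr0_norm ?subr_lt0// /tail (ltr0_norm vs) (_ : c < - v s x); last by lra.
    by rewrite mulr1; lra.
rewrite ler_norml; lra.
Qed.

Lemma mass_conservation t : 0 <= t ->
  \int[mu]_(x in S) v t x = \int[mu]_(x in S) v 0 x.
Proof.
move=> t0; apply/eqP; rewrite eq_sym -subr_eq0 -normr_le0; apply/ler_addgt0Pr => e e0.
by rewrite add0r; exact: mass_le.
Qed.

(** Pointwise, the excess of |y| over k equals (|y - k| + |y + k|) / 2 - k. *)
Lemma excess_nonincreasing k s t : 0 <= k -> 0 <= s -> s <= t ->
  \int[mu]_(x in S) Num.max (`|v t x| - k) 0 <= \int[mu]_(x in S) Num.max (`|v s x| - k) 0.
Proof.
move=> k0 s0 st; have t0 := le_trans s0 st.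
have E r : 0 <= r -> \int[mu]_(x in S) Num.max (`|v r x| - k) 0 =
    2^-1 * (\int[mu]_(x in S) `|v r x - k| + \int[mu]_(x in S) `|v r x - - k|) - k * fine (mu S).
  move=> r0; have [i1 i2] := (dist_integrable k r0, dist_integrable (- k) r0).
  have ki := cst_integrable k; have si := integrableRD mS i1 i2.
  rewrite -Rintegral_cst// -RintegralD// -RintegralZl// -RintegralB//; last exact: (integrableRZ _ mS si).
  apply: eq_Rintegral => x _; rewrite opprK.
  have [r1|r1] := leP 0 (v r x).
    have rk : 0 <= v r x + k by rewrite addr_ge0.
    rewrite (ger0_norm r1) (ger0_norm rk); case: (leP k (v r x)) => kr.
      by rewrite ger0_norm ?subr_ge0// max_l ?subr_ge0//; lra.
    by rewrite ltr0_norm ?subr_lt0// max_r ?subr_le0 ?(ltW kr)//; lra.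
  have rk : v r x - k <= 0 by lra.
  rewrite (ltr0_norm r1) (ler0_norm rk); case: (leP 0 (v r x + k)) => kr.
    by rewrite max_r; [rewrite (ger0_norm kr); lra|lra].
  by rewrite max_l; [rewrite (ltr0_norm kr); lra|lra].
rewrite !E// lerD2r ler_wpM2l// lerD// L1_dist_cst_nonincreasing//.
Qed.

(** Otherwise the Huber energy would decrease at rate at least delta from time 1 on; at the time b
    chosen below it would have lost its value at 1 plus 1, and be negative. *)
Lemma small_energy_time k delta : 0 < k -> 0 < delta -> exists t w, [/\ 0 < t,
  calA S gamma p (v t) (\- w) &
  \int[mu]_(x in S) energy_density gamma p (weak_gradient S (truncate k \o v t)) x < delta].
Proof.
move=> k0 delta0; apply: contrapT => H.
have H' t w : 0 < t -> calA S gamma p (v t) (\- w) ->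
    delta <= \int[mu]_(x in S) ((\- w) x * truncate k (v t x - 0)).
  move=> t0 wA; have := calA_energy_le oS Sfin p1 gamma0 gammaoo gammaL1 wA k0.
  rewrite (_ : (fun x => (\- w) x * truncate k (v t x - 0)) =
    (fun x => (\- w) x * truncate k (v t x))); last by apply/funext => x; rewrite subr0.
  apply: le_trans; rewrite leNgt; apply/negP => Hd; apply: H.
  by exists t, w.
pose b := 1 + (huber_energy k 0 1 + 1) / delta.
have E1 := huber_energy_ge0 0 k0 1.
have b1 : 1 <= b by rewrite lerDl divr_ge0 ?(ltW delta0)// addr_ge0.
have := huber_energy_decrease k0 ltr01 b1 (ltW delta0) H'.
rewrite /b addrAC subrr add0r mulNr mulrCA mulfV ?gt_eqF// mulr1.
by have := huber_energy_ge0 0 k0 b; rewrite /b; lra.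
Qed.

End time_evolution.

(** * Poincare inequality on cubes, and its globalisation by connectedness *)

Section local_poincare.
Context (R : realType) (n : nat).
Local Notation mu := (lebesgue_rV R n).
Local Notation e i := (delta_mx ord0 i : 'rV[R]_n).

Lemma ball_shift (z : 'rV[R]_n) i (h rho r : R) : `|h| <= r ->
  ball (z + h *: e i) rho `<=` ball z (rho + r).
Proof.
move=> hr y [rho0 zy]; have r0 := le_trans (normr_ge0 h) hr.
split; first by rewrite ltr_wpDr.
move=> j l; have := zy j l; rewrite !ord1 /ball /= !mxE eqxx /= => zyl.
apply: (@le_lt_trans _ _ (`|z ord0 l + h * (l == i)%:R - y ord0 l| + `|h|)); last exact: ltr_leD.
rewrite (_ : z ord0 l - y ord0 l = (z ord0 l + h * (l == i)%:R - y ord0 l) - h * (l == i)%:R); last by ring.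
apply: (le_trans (ler_normB _ _)); rewrite lerD2l normrM.
by case: (l == i); rewrite ?normr1 ?normr0 ?mulr1 ?mulr0.
Qed.

Lemma ball_translation (z x h : 'rV[R]_n) r : ball z r (x + h) = ball (z - h) r x.
Proof.
apply/propext; rewrite /ball /= /mx_ball; split => -[r0 H]; split => // i j; have := H i j;
  by rewrite /ball /= !mxE (_ : z i j - h i j - x i j = z i j - (x i j + h i j))//; ring.
Qed.

Lemma lebesgue_ball (z : 'rV[R]_n) r : 0 < r -> mu (ball z r) = ((r *+ 2) ^+ n)%:E.
Proof.
move=> r0; rewrite ball_box// lebesgue_box => [|i]; last exact: measurable_itv.
rewrite (eq_bigr (fun=> (r *+ 2)%:E)) => [|i _].
  by rewrite prodEFin prodr_const card_ord.
apply: etrans (lebesgue_measure_itv _) _; rewrite /= lte_fin.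
rewrite (_ : (_ < _) = true) -?EFinB; last lra.
by congr EFin; ring.
Qed.

Lemma lebesgue_ball_gt0 (z : 'rV[R]_n) r : 0 < r -> 0 < fine (mu (ball z r)).
Proof. by move=> r0; rewrite lebesgue_ball// exprn_gt0 ?pmulrn_lgt0. Qed.

Lemma indic_bounded (A : set 'rV[R]_n) x : `|\1_A x : R| <= 1.
Proof. by rewrite indicE; case: (_ \in _); rewrite ?normr1 ?normr0. Qed.

Variables (S : set 'rV[R]_n) (F : 'rV[R]_n -> R) (G : 'I_n -> 'rV[R]_n -> R) (k : R).
Hypotheses (Fi : mu.-integrable setT (EFin \o F))
  (Gi : forall i, mu.-integrable setT (EFin \o G i))
  (FG : forall i, weak_partial S i F (G i)) (Fk : forall x, `|F x| <= k).

Let mF := integrable_measurableR Fi.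

Let osc_integrable h (A : set 'rV[R]_n) : measurable A ->
  mu.-integrable setT (EFin \o (fun x => `|F (x + h) - F x| * \1_A x)).
Proof.
move=> mA.
have Fhi : mu.-integrable setT (EFin \o (fun x => F (x + h))) by exact: integrable_translation Fi.
apply: (integrable_mul_bounded measurableT _ _ (@indic_bounded A)).
  by apply: integrable_norm; exact: integrableRB.
exact: measurable_indic.
Qed.

(** For negative h the points x and x + h e exchange roles, and a translation carries the cube
    along. *)
Lemma Rintegral_shift_signed_le i z r h : ball z (r + `|h|) `<=` S ->
  \int[mu]_x (`|F (x + h *: e i) - F x| * \1_(ball z r) x) <= `|h| * \int[mu]_x `|G i x|.
Proof.
move=> zS; have [h0|h0] := leP 0 h.
  rewrite (ger0_norm h0) in zS *.
  apply: (Rintegral_shift_le Fi (Gi i) (FG i)) => //; first exact: ball_open.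
  move=> x s zx /andP[s0 sh]; apply: zS.
  apply: (@ball_shift z i s); first by rewrite ger0_norm.
  by rewrite ball_translation addrK.
rewrite -(Rintegral_translation (- h *: e i) (osc_integrable (h *: e i) (measurable_ball_rV z r))).
under eq_Rintegral => x _.
  rewrite -addrA -scalerDl addNr scale0r addr0 distrC.
  have -> : \1_(ball z r) (x + - h *: e i) = \1_(ball (z + h *: e i) r) x :> R.
    by rewrite !indicE; congr (nat_of_bool _)%:R; apply/idP/idP; rewrite !inE ball_translation scaleNr opprK.
  over.
rewrite (ltr0_norm h0) in zS *.
apply: (Rintegral_shift_le Fi (Gi i) (FG i)) => //; [exact: ball_open|by rewrite oppr_ge0 ltW|].
move=> x s zx /andP[s0 sh]; apply: zS.
apply: (@ball_shift z i (s + h)); first by rewrite ler_norml; lra.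
rewrite ball_translation (_ : _ - _ = z + h *: e i)//.
by rewrite scalerDl [s *: _ + _]addrC addrA addrK.
Qed.

(** A general shift is performed one coordinate at a time; each coordinate may displace the cube by
    a, which accounts for the enlarged radius. *)
Lemma Rintegral_shift_seq_le (s : seq 'I_n) (h : 'rV[R]_n) z r a : 0 <= a ->
  (forall i, `|h ord0 i| <= a) -> ball z (r + a *+ size s) `<=` S ->
  \int[mu]_x (`|F (x + \sum_(i <- s) h ord0 i *: e i) - F x| * \1_(ball z r) x) <=
  \sum_(i <- s) a * \int[mu]_x `|G i x|.
Proof.
move=> a0 ha; elim: s z => [|i s IH] z zS.
  rewrite !big_nil; under eq_Rintegral do rewrite addr0 subrr normr0 mul0r.
  by rewrite Rintegral_cst// mul0r.
rewrite !big_cons; set w := \sum_(j <- s) _.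
have hi := ha i; set hh := h ord0 i in hi *.
have mB z' : measurable (ball (z' : 'rV[R]_n) r) by exact: measurable_ball_rV.
have shift_indic x : \1_(ball (z + hh *: e i) r) (x + hh *: e i) = \1_(ball z r) x :> R.
  by rewrite !indicE; congr (nat_of_bool _)%:R; apply/idP/idP; rewrite !inE ball_translation addrK.
have I1 := osc_integrable (hh *: e i) (mB z).
have I2 := osc_integrable w (mB (z + hh *: e i)).
have I3 : mu.-integrable setT (EFin \o (fun x => `|F (x + hh *: e i + w) - F (x + hh *: e i)| * \1_(ball z r) x)).
  have := integrable_translation (hh *: e i) I2; apply: eq_integrable => // x _ /=.
  by rewrite shift_indic.
apply: (@le_trans _ _ (\int[mu]_x (`|F (x + hh *: e i) - F x| * \1_(ball z r) x +
    `|F (x + hh *: e i + w) - F (x + hh *: e i)| * \1_(ball z r) x))).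
  apply: le_Rintegral => //; [exact: osc_integrable|exact: integrableRD|].
  move=> x _; rewrite -mulrDl ler_wpM2r// addrA [X in _ <= X]addrC.
  rewrite (_ : F _ - F x = (F (x + hh *: e i + w) - F (x + hh *: e i)) + (F (x + hh *: e i) - F x)).
    exact: ler_normD.
  by rewrite addrA subrK.
rewrite RintegralD// lerD//.
  apply: (@le_trans _ _ (`|hh| * \int[mu]_x `|G i x|)).
    apply: Rintegral_shift_signed_le; apply: subset_trans zS; apply: le_ball; rewrite lerD2l /= mulrS.
    by rewrite (le_trans hi)// lerDl mulrn_wge0.
  by rewrite ler_wpM2r// Rintegral_ge0.
apply: (le_trans _ (IH (z + hh *: e i) _)).
  rewrite le_eqVlt; apply/orP; left; apply/eqP.
  rewrite -[RHS](Rintegral_translation (hh *: e i))//.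
  by apply: eq_Rintegral => x _; rewrite shift_indic.
apply: subset_trans zS; rewrite /= mulrS [a + _]addrC addrA; exact: ball_shift.
Qed.

(** The constant is a value F x with x in the cube, whence its bound by k. If every such x failed,
    the integral of |F y - F x| over pairs in the cube would be at least the right-hand side;
    written with h = y - x, which ranges over a cube of twice the radius, it is at most the
    right-hand side without eps. The summand eps produces the contradiction, since integration keeps
    only the weak inequality. *)
Lemma local_poincare z r eps : 0 < r -> ball z (r + (r *+ 2) *+ n) `<=` S -> 0 < eps ->
  exists2 c, `|c| <= k & fine (mu (ball z r)) * \int[mu]_y (`|F y - c| * \1_(ball z r) y) <=
    fine (mu (ball 0 (r *+ 2))) * (r *+ 2 * \sum_i \int[mu]_x `|G i x|) + eps.
Proof.
move=> r0 zS eps0; set B := ball z r; set D := ball 0 (r *+ 2).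
have mB : measurable B by exact: measurable_ball_rV.
have mD : measurable D by exact: measurable_ball_rV.
have Boo : (mu B < +oo)%E by rewrite /B lebesgue_ball// ltry.
have Doo : (mu D < +oo)%E by rewrite /D lebesgue_ball ?pmulrn_lgt0// ltry.
have Bi := integrable_indic_lty mB Boo.
have Di := integrable_indic_lty mD Doo.
set C := fine (mu D) * _.
(* Both ends of the pair are confined to the cube, so that H is bounded and supported in a set of
   finite measure. *)
pose H (xh : 'rV[R]_n * 'rV[R]_n) := `|F (xh.2 + xh.1) - F xh.1| * \1_B (xh.2 + xh.1) * \1_B xh.1.
have BD x h : B x -> B (x + h) -> D h.
  move=> [_ Bx] [_ Bxh]; split; first by rewrite pmulrn_lgt0.
  move=> i j; have := Bx i j; have := Bxh i j; rewrite /ball /= !mxE sub0r normrN mulr2n => H1 H2.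
  rewrite (_ : h i j = (z i j - x i j) - (z i j - (x i j + h i j))); last by ring.
  by rewrite (le_lt_trans (ler_normB _ _))// ltrD.
have mH : measurable_fun setT H.
  have m1 : measurable_fun setT (fun xh : 'rV[R]_n * 'rV[R]_n => xh.2 + xh.1).
    apply: measurable_fun_rV => i; under eq_fun do rewrite mxE.
    by apply: measurable_funD; apply: measurableT_comp (@measurable_coord R n i) _.
  have mB1 : measurable_fun setT (\1_B : _ -> R) by exact: measurable_indic.
  apply: measurable_funM; last by apply: (measurableT_comp mB1).
  apply: measurable_funM; last by apply: (measurableT_comp mB1).
  apply: measurableT_comp => //; apply: measurable_funB.
    exact: (measurableT_comp mF m1).
  exact: (measurableT_comp mF).
have k0 : 0 <= k by exact: le_trans (normr_ge0 _) (Fk 0).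
have H0 xh : 0 <= H xh by rewrite /H !mulr_ge0.
have Hi : (mu \x mu)%E.-integrable setT (EFin \o H).
  have BDi : (mu \x mu)%E.-integrable setT (EFin \o (\1_(B `*` D) : _ -> R)).
    apply: integrable_indic_lty; first exact: measurableX.
    apply: (@le_lt_trans _ _ ((mu \x mu)%E (B `*` D))) => //.
    by rewrite product_measure1E// lte_mul_pinfty// ge0_fin_numE.
  apply: (integrableR_le measurableT mH (integrableRZ (k *+ 2) measurableT BDi)) => -[x h] _.
  rewrite ger0_norm// /H /=.
  have [Bx|nBx] := pselect (B x); last by rewrite [\1_B x]indicE memNset// mulr0 mulr_ge0// mulrn_wge0.
  have [Bxh|nBxh] := pselect (B (h + x)); last first.
    by rewrite [\1_B (h + x)]indicE memNset// mulr0 mul0r mulr_ge0// mulrn_wge0.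
  rewrite !indicE !mem_set//=; last by split => //; apply: (BD _ _ Bx); rewrite addrC.
  by rewrite !mulr1 mulr2n (le_trans (ler_normB _ _))// lerD.
have phii x : mu.-integrable setT (EFin \o (fun y => `|F y - F x| * \1_B y)).
  apply: (integrableR_le measurableT _ (integrableRZ (k *+ 2) measurableT Bi)) => [|y _].
    apply: measurable_funM; last exact: measurable_indic.
    by apply: measurableT_comp => //; exact: measurable_funB.
  rewrite ger0_norm ?mulr_ge0// ler_wpM2r// mulr2n.
  by rewrite (le_trans (ler_normB _ _))// lerD.
have phiE x : \int[mu]_h H (x, h) = \int[mu]_y (`|F y - F x| * \1_B y) * \1_B x.
  have xi := integrable_translation x (phii x).
  by rewrite -(Rintegral_translation x (phii x)) -RintegralZr.
have mB0 : 0 < fine (mu B) by rewrite /B lebesgue_ball// exprn_gt0 ?pmulrn_lgt0.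
apply: contrapT => Hn.
have Hlt x : B x -> (C + eps) / fine (mu B) < \int[mu]_y (`|F y - F x| * \1_B y).
  move=> Bx; rewrite ltNge; apply/negP => Hx; apply: Hn; exists (F x) => //.
  by move: Hx; rewrite ler_pdivlMr// mulrC.
have := Rintegral_fubini Hi.
have I1 : C + eps <= \int[mu]_x \int[mu]_h H (x, h).
  rewrite -[C + eps](divfK (lt0r_neq0 mB0)).
  rewrite [X in _ * X](_ : _ = \int[mu]_x (\1_B x : R)); last first.
    by rewrite /Rintegral integral_indic// setIT.
  rewrite -RintegralZl//; apply: le_Rintegral => //.
  - exact: integrableRZ.
  - exact: (integrable_Rintegral1 Hi).
  - move=> x _; rewrite phiE; have [Bx|nBx] := pselect (B x).
      by rewrite [\1_B x]indicE mem_set// !mulr1 ltW// Hlt.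
    by rewrite indicE memNset// !mulr0.
have I2 : \int[mu]_h \int[mu]_x H (x, h) <= C.
  have -> : C = \int[mu]_h ((r *+ 2 * \sum_i \int[mu]_x `|G i x|) * \1_D h).
    rewrite RintegralZl// mulrC [X in _ = X * _](_ : _ = fine (mu D)); first by rewrite /C mulrC.
    by rewrite /Rintegral integral_indic// setIT.
  apply: le_Rintegral => //.
  - exact: (integrable_Rintegral2 Hi).
  - exact: integrableRZ.
  - move=> h _; have [Dh|nDh] := pselect (D h); last first.
      rewrite [\1_D h]indicE memNset// mulr0 (_ : (fun x => H (x, h)) = fun=> 0).
        by rewrite Rintegral_cst// mul0r.
      apply/funext => x; rewrite /H /=.
      have [Bx|nBx] := pselect (B x); last by rewrite [\1_B x]indicE memNset// mulr0.
      have [Bxh|nBxh] := pselect (B (h + x)); last first.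
        by rewrite [\1_B (h + x)]indicE memNset// mulr0 mul0r.
      by case: nDh; apply: (BD _ _ Bx); rewrite addrC.
    rewrite indicE mem_set// mulr1 mulr_sumr.
    have hr i : `|h ord0 i| <= r *+ 2.
      by case: Dh => _ /(_ ord0 i); rewrite /ball /= mxE sub0r normrN => /ltW.
    have := @Rintegral_shift_seq_le (enum 'I_n) h z r (r *+ 2).
    rewrite size_enum_ord !big_enum /= -row_sum_delta => /(_ _ hr zS).
    rewrite mulrn_wge0 ?(ltW r0)// => /(_ isT); apply: le_trans.
    apply: le_Rintegral => //.
    + have mBh : measurable_fun setT (fun x : 'rV[R]_n => \1_B (x + h) : R).
        by apply: (measurableT_comp (measurable_indic mB)); exact: measurable_translation.
      have := integrable_mul_bounded measurableT (osc_integrable h mB) mBh (fun x => indic_bounded B (x + h)).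
      by apply: eq_integrable => // x _; rewrite /H /= mulrAC ![h + x]addrC.
    + exact: osc_integrable.
    + move=> x _; rewrite /H /= [x + h]addrC ler_wpM2r// ler_piMr//.
move=> E; move: I1; rewrite E => /le_trans/(_ I2).
by rewrite gerDl leNgt eps0.
Qed.

End local_poincare.

Lemma ball_sub_ball (R : realType) n (x y : 'rV[R]_n) r : ball x r y ->
  exists2 s, 0 < s & ball y s `<=` ball x r.
Proof.
move=> xy; have /nbhs_ballP[s /= s0 ys] : nbhs y (ball x r).
  by apply: open_nbhs_nbhs; split => //; exact: ball_open.
by exists s.
Qed.

Section connected_poincare.
Context (R : realType) (n : nat).
Local Notation mu := (lebesgue_rV R n).
Variables (S : set 'rV[R]_n) (F : nat -> 'rV[R]_n -> R)
  (G : nat -> 'I_n -> 'rV[R]_n -> R) (k : R).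
Hypotheses (oS : open S) (cS : connected S) (S0 : S !=set0) (Sfin : (mu S < +oo)%E).
Hypotheses (Fi : forall m, mu.-integrable setT (EFin \o F m))
  (Gi : forall m i, mu.-integrable setT (EFin \o G m i))
  (FG : forall m i, weak_partial S i (F m) (G m i)) (Fk : forall m x, `|F m x| <= k)
  (G0 : forall i, \int[mu]_x `|G m i x| @[m --> \oo] --> 0).

Let mS := open_measurable_rV oS.
Let k0 : 0 <= k. Proof. exact: le_trans (normr_ge0 _) (Fk 0 0). Qed.

Let J (c : nat -> R) (A : set 'rV[R]_n) m := \int[mu]_y (`|F m y - c m| * \1_A y).
(** The constants may vary with the index m of the sequence but not with the set A; what has to be
    glued is one sequence [c] for all cubes. *)
Let good c A := J c A m @[m --> \oo] --> 0.

Let J_integrable c A m : measurable A -> (mu A < +oo)%E ->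
  mu.-integrable setT (EFin \o (fun y => `|F m y - c m| * \1_A y)).
Proof.
move=> mA Aoo.
have mF := integrable_measurableR (Fi m).
apply: (integrableR_le measurableT _ (integrableRZ (k + `|c m|) measurableT (integrable_indic_lty mA Aoo))) => [|y _].
  by apply: measurable_funM; [apply: measurableT_comp => //; exact: measurable_funB|exact: measurable_indic].
by rewrite ger0_norm ?mulr_ge0// ler_wpM2r// (le_trans (ler_normB _ _))// lerD.
Qed.

Let J_ge0 c A m : 0 <= J c A m.
Proof. by apply: Rintegral_ge0 => y _; rewrite mulr_ge0. Qed.

Let indic_Rintegral (A : set 'rV[R]_n) : measurable A -> \int[mu]_y (\1_A y : R) = fine (mu A).
Proof. by move=> mA; rewrite /Rintegral integral_indic// setIT. Qed.

Let good_squeeze c A (b : nat -> R) : (forall m, J c A m <= b m) -> b m @[m --> \oo] --> 0 ->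
  good c A.
Proof.
move=> Jb b0; apply: (@squeeze_cvgr _ _ _ _ (fun=> 0) b) => //; last exact: cvg_cst.
by apply: nearW => m; rewrite J_ge0 Jb.
Qed.

Let J_sub c A A' m : measurable A -> measurable A' -> (mu A' < +oo)%E -> A `<=` A' -> J c A m <= J c A' m.
Proof.
move=> mA mA' Aoo AA'; have Aoo' : (mu A < +oo)%E.
  by apply: le_lt_trans Aoo; apply: le_measure; rewrite ?inE.
apply: le_Rintegral => //; [exact: J_integrable|exact: J_integrable|].
move=> y _; rewrite ler_wpM2l// !indicE ler_nat.
by case: (boolP (y \in A)) => // /set_mem /AA' yA'; rewrite mem_set.
Qed.

Let J_setU c A A' m : measurable A -> measurable A' -> (mu A < +oo)%E -> (mu A' < +oo)%E ->
  J c (A `|` A') m <= J c A m + J c A' m.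
Proof.
move=> mA mA' Aoo Aoo'.
have Uoo : (mu (A `|` A') < +oo)%E by apply: le_lt_trans (measureU2 _ mA mA') _; rewrite lte_add_pinfty.
have [i1 i2] := (J_integrable c m mA Aoo, J_integrable c m mA' Aoo').
rewrite /J -RintegralD//; apply: le_Rintegral => //.
- by apply: J_integrable => //; exact: measurableU.
- exact: integrableRD.
move=> y _; rewrite -mulrDr ler_wpM2l// !indicE -natrD ler_nat in_setU.
by case: (y \in A); case: (y \in A').
Qed.

Let J_change c c' A m : measurable A -> (mu A < +oo)%E ->
  J c A m <= J c' A m + `|c m - c' m| * fine (mu A).
Proof.
move=> mA Aoo; have Ai := integrable_indic_lty mA Aoo.
have [i1 i2] := (J_integrable c m mA Aoo, J_integrable c' m mA Aoo).
rewrite -indic_Rintegral// -RintegralZl// -RintegralD//; last exact: integrableRZ.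
apply: le_Rintegral => //; first by apply: integrableRD => //; exact: integrableRZ.
move=> y _; rewrite -mulrDl ler_wpM2r//.
by rewrite (_ : F m y - c m = (F m y - c' m) - (c m - c' m)) ?ler_normB//; ring.
Qed.

Let cst_le c c' A m : measurable A -> (mu A < +oo)%E ->
  `|c m - c' m| * fine (mu A) <= J c A m + J c' A m.
Proof.
move=> mA Aoo; have Ai := integrable_indic_lty mA Aoo.
have [i1 i2] := (J_integrable c m mA Aoo, J_integrable c' m mA Aoo).
rewrite -indic_Rintegral// -RintegralZl// -RintegralD//.
apply: le_Rintegral => //; [exact: integrableRZ|exact: integrableRD|].
move=> y _; rewrite -mulrDl ler_wpM2r// [X in _ <= X]addrC.
by rewrite (_ : c m - c' m = (F m y - c' m) - (F m y - c m)) ?ler_normB//; ring.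
Qed.

Let local_good z : S z -> exists r c, [/\ 0 < r, ball z r `<=` S, forall m, `|c m| <= k &
  good c (ball z r)].
Proof.
move=> Sz; have /nbhs_ballP[e /= e0 zS] := open_nbhs_nbhs (conj oS Sz).
(* Solves r + 2 r n = e, the enlarged radius that [local_poincare] requires inside S. *)
pose r : R := e / (1 + 2 *+ n).
have d0 : 0 < 1 + 2 *+ n :> R by rewrite ltr_wpDr// mulrn_wge0.
have r0 : 0 < r by rewrite divr_gt0.
have rE : r + r *+ 2 *+ n = e.
  by rewrite -mulrnA -mulr_natr -{1}[r]mulr1 -mulrDr natrM mulr_natr divfK ?gt_eqF.
have zS' : ball z (r + r *+ 2 *+ n) `<=` S by rewrite rE.
have /choice[c Hc] : forall m, exists c, `|c| <= k /\
    fine (mu (ball z r)) * \int[mu]_y (`|F m y - c| * \1_(ball z r) y) <=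
    fine (mu (ball 0 (r *+ 2))) * (r *+ 2 * \sum_i \int[mu]_x `|G m i x|) + m.+1%:R^-1.
  move=> m; have [|c ck Hc] := local_poincare (Fi m) (Gi m) (FG m) (Fk m) r0 zS' (eps := m.+1%:R^-1).
    by rewrite invr_gt0.
  by exists c.
have B0 := lebesgue_ball_gt0 z r0.
exists r, c; split => //.
- by apply: subset_trans zS'; apply: le_ball; rewrite lerDl !mulrn_wge0// ltW.
- by move=> m; case: (Hc m).
- apply: (good_squeeze (b := fun m => (fine (mu (ball 0 (r *+ 2))) *
    (r *+ 2 * \sum_i \int[mu]_x `|G m i x|) + m.+1%:R^-1) / fine (mu (ball z r)))).
    by move=> m; rewrite ler_pdivlMr// mulrC; case: (Hc m).
  rewrite -[X in _ --> X](mul0r (fine (mu (ball z r)))^-1); apply: cvgMr_tmp.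
  rewrite -[X in _ --> X]addr0; apply: cvgD; last exact: cvg_harmonic.
  rewrite -[X in _ --> X](mulr0 (fine (mu (ball 0 (r *+ 2))))); apply: cvgMl_tmp.
  rewrite -[X in _ --> X](mulr0 (r *+ 2)); apply: cvgMl_tmp.
  rewrite (_ : nbhs 0 = nbhs (\sum_(i < n) (0 : R))); last by rewrite big1_eq.
  by apply: cvg_big => [|i _]; [exact: add_continuous|exact: G0].
Qed.

Let mball z r : measurable (ball (z : 'rV[R]_n) r).
Proof. exact: measurable_ball_rV. Qed.

Let sub_lty A : measurable A -> A `<=` S -> (mu A < +oo)%E.
Proof. by move=> mA AS; apply: le_lt_trans Sfin; apply: le_measure; rewrite ?inE. Qed.

Section fixed_constants.
Variable c : nat -> R.
Hypothesis ck : forall m, `|c m| <= k.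

Let Z := [set x | exists2 r, 0 < r & ball x r `<=` S /\ good c (ball x r)].

Let ZS : Z `<=` S.
Proof. by move=> x [r r0 [rS _]]; apply: rS; exact: ballxx. Qed.

Let good_sub A A' : measurable A -> measurable A' -> A' `<=` S -> A `<=` A' -> good c A' -> good c A.
Proof.
by move=> mA mA' A'S AA' gA; apply: good_squeeze gA => m; apply: J_sub => //; exact: sub_lty.
Qed.

Let openZ : open Z.
Proof.
rewrite openE => x [r r0 [rS gr]]; apply/nbhs_ballP; exists r; first exact: r0.
move=> y xy.
have [s s0 ys] := ball_sub_ball xy.
exists s; first exact: s0.
split; first exact: (subset_trans ys rS).
exact: (good_sub (mball y s) (mball x r) rS ys gr).
Qed.

(** Around any x some sequence c' is good. If a cube good for c met that neighbourhood, their
    overlap would contain a ball of fixed positive measure, on which both c and c' approximate F; so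
    c - c' tends to 0, and c would be good around x as well. *)
Let openSZ : open (S `\` Z).
Proof.
rewrite openE => x [Sx nZx].
have [r [c' [r0 rS c'k gr]]] := local_good Sx.
apply/nbhs_ballP; exists r; first exact: r0.
move=> y xy; split; first exact: rS.
move=> [s s0 [sS gs]]; apply: nZx; exists r; first exact: r0.
split; first exact: rS.
have [t t0 yt] := ball_sub_ball xy.
pose w := Num.min s t; have w0 : 0 < w by rewrite lt_min s0.
have wx : ball y w `<=` ball x r by apply: subset_trans yt; apply: le_ball; rewrite ge_min lexx orbT.
have ws : ball y w `<=` ball y s by apply: le_ball; rewrite ge_min lexx.
have B0 := lebesgue_ball_gt0 y w0.
have xoo := sub_lty (mball x r) rS.
have woo : (mu (ball y w) < +oo)%E by apply: sub_lty => //; exact: subset_trans rS.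
apply: (good_squeeze (b := fun m => J c' (ball x r) m +
  (J c (ball y s) m + J c' (ball x r) m) / fine (mu (ball y w)) * fine (mu (ball x r)))).
  move=> m; apply: (le_trans (J_change c c' m (mball x r) xoo)).
  rewrite lerD2l ler_wpM2r ?fine_ge0// ler_pdivlMr//.
  apply: (le_trans (cst_le c c' m (mball y w) woo)).
  have soo := sub_lty (mball y s) sS.
  exact: (lerD (J_sub c m (mball y w) (mball y s) soo ws) (J_sub c' m (mball y w) (mball x r) xoo wx)).
rewrite -[X in _ --> X]addr0; apply: cvgD; first exact: gr.
rewrite -[X in _ --> X](mul0r (fine (mu (ball x r)))); apply: cvgMr_tmp.
rewrite -[X in _ --> X](mul0r (fine (mu (ball y w)))^-1); apply: cvgMr_tmp.
by rewrite -[X in _ --> X]addr0; apply: cvgD; [exact: gs|exact: gr].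
Qed.

Let ZE : Z !=set0 -> Z = S.
Proof.
move=> Z0; apply: cS => //.
  by exists Z => //; rewrite setIidr.
exists (~` (S `\` Z)); first by apply: open_closedC.
by rewrite setDE setCI setCK setIUr setICr set0U setIidr.
Qed.

(** Finitely many good cubes cover S up to a set of small measure, and there |F - c| is at most 2 k.
    This replaces any estimate near the boundary. *)
Lemma good_connected : Z !=set0 -> good c S.
Proof.
move=> /ZE ZS'.
pose B j : set 'rV[R]_n := ball (rational_cube R n j).1 (rational_cube R n j).2.
pose A j := if `[< B j `<=` S /\ good c (B j) >] then B j else set0.
have mB j : measurable (B j) by exact: mball.
have mA j : measurable (A j).
  by rewrite /A; case: asboolP => _; [exact: mB|exact: measurable0].
have AS j : A j `<=` S.
  by rewrite /A; case: asboolP => [[BS _]|_]; [exact: BS|exact: sub0set].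
have good0 : good c set0.
  apply: (good_squeeze (b := fun=> 0)); last exact: cvg_cst.
  by move=> m; rewrite /J; under eq_Rintegral do rewrite indic0 mulr0; rewrite Rintegral_cst// mul0r.
have gA j : good c (A j).
  rewrite /A; case: asboolP => [[_ gB]|_]; [exact: gB|exact: good0].
have cov : S = \bigcup_j A j.
  apply/seteqP; split => [x|x [j _ /AS//]].
  rewrite -{1}ZS' => -[r r0 [rS gr]].
  have := @rational_cube_dense R n (ball x r) x (ball_open _ _) (ballxx _ r0).
  move=> [j]; case E : (rational_cube R n j) => [z s] [s0 zx zr]; exists j => //.
  have Bx : B j `<=` ball x r.
    rewrite /B E /=; apply: subset_trans zr; apply: le_ball.
    by rewrite mulr2n lerDl ltW.
  rewrite /A asboolT; first by rewrite /B E.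
  split; first exact: (subset_trans Bx rS).
  exact: (good_sub (mB j) (mball x r) rS Bx gr).
pose U N := \big[setU/set0]_(j < N) A j.
have mU N : measurable (U N) by apply: bigsetU_measurable.
have US N : U N `<=` S by move=> x; rewrite /U -bigcup_mkord => -[j _ /AS].
have Uoo N : (mu (U N) < +oo)%E by exact: sub_lty.
have gU N : good c (U N).
  elim: N => [|N IH]; rewrite /U.
    by rewrite big_ord0; exact: good0.
  rewrite big_ord_recr /=; apply: (good_squeeze (b := fun m => J c (U N) m + J c (A N) m)).
    by move=> m; exact: (J_setU c m (mU N) (mA N) (Uoo N) (sub_lty (mA N) (AS N))).
  by rewrite -[X in _ --> X]addr0; apply: cvgD; [exact: IH|exact: gA].
apply/cvgrPdist_le => e e0.
have k1 : 0 < k *+ 2 + 1 by rewrite ltr_wpDl// mulrn_wge0.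
have [N HN] : exists N, k *+ 2 * fine (mu (S `\` U N)) <= e / 2.
  have mSU N : measurable (S `\` U N) by exact: measurableD.
  have I0 : \bigcap_N (S `\` U N) = set0.
    apply/seteqP; split => // x Hx; have [Sx _] := Hx 0%N I.
    move: (Sx); rewrite {1}cov => -[j _ Ax]; have [_] := Hx j.+1 I; apply.
    by rewrite /U -bigcup_mkord; exists j => /=.
  have cSU : mu (S `\` U N) @[N --> \oo] --> 0%E.
    rewrite -(measure0 mu) -I0; apply: nonincreasing_cvg_mu.
    - by apply: sub_lty => //; exact: subDsetl.
    - exact: mSU.
    - by rewrite I0.
    - move=> N M NM; apply/subsetPset; apply: setDS.
      by move=> x; rewrite /U -!bigcup_mkord => -[j /= jN Ax]; exists j => //=; exact: leq_trans NM.
  have d0 : 0 < e / 2 / (k *+ 2 + 1) by rewrite !divr_gt0.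
  have /cSU [N _ /(_ N (leqnn N)) /= HN] :
      nbhs 0%E [set y : \bar R | (y < (e / 2 / (k *+ 2 + 1))%:E)%E].
    by apply: open_nbhs_nbhs; split; [exact: open_ereal_lt_ereal|rewrite /= lte_fin].
  exists N; move: HN; rewrite -[X in (X < _)%E]fineK; last first.
    by rewrite ge0_fin_numE// sub_lty//; exact: subDsetl.
  have := fine_ge0 (measure_ge0 mu (S `\` U N)); move: (fine _) => w w0.
  by rewrite lte_fin ltr_pdivlMr// mulrDr mulr1 mulrC; lra.
have e2 : 0 < e / 2 by rewrite divr_gt0.
have /cvgrPdist_le/(_ _ e2) := gU N; apply: filterS => m.
rewrite !sub0r !normrN !ger0_norm// => HJ.
have mSU : measurable (S `\` U N) by exact: measurableD.
have SUoo : (mu (S `\` U N) < +oo)%E by apply: sub_lty => //; exact: subDsetl.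
have -> : S = U N `|` (S `\` U N) by rewrite setDUK.
apply: (le_trans (J_setU c m (mU N) mSU (Uoo N) SUoo)).
suff : J c (S `\` U N) m <= k *+ 2 * fine (mu (S `\` U N)) by lra.
have i1 := integrable_indic_lty mSU SUoo.
rewrite -indic_Rintegral// -RintegralZl//; apply: le_Rintegral => //.
- exact: J_integrable.
- exact: integrableRZ.
- by move=> y _; rewrite ler_wpM2r// mulr2n (le_trans (ler_normB _ _))// lerD.
Qed.

End fixed_constants.

Lemma connected_poincare : exists2 c : nat -> R, (forall m, `|c m| <= k) &
  \int[mu]_y (`|F m y - c m| * \1_S y) @[m --> \oo] --> 0.
Proof.
have [z Sz] := S0; have [r [c [r0 rS ck gr]]] := local_good Sz.
by exists c => //; apply: good_connected => //; exists z; exists r.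
Qed.

End connected_poincare.

(** * Powers as combinations of excesses *)

Section layer_cake.
Context (R : realType) (q : R).
Hypothesis q1 : 1 <= q.
Implicit Types (s : R) (N m : nat).

Let q0 : 0 < q. Proof. exact: lt_le_trans q1. Qed.
Let q10 : 0 <= q - 1. Proof. by rewrite subr_ge0. Qed.

Lemma powR_le (a b r : R) : 0 <= r -> 0 <= a -> a <= b -> a `^ r <= b `^ r.
Proof. by move=> r0 a0 ab; apply: ge0_ler_powR => //; rewrite nnegrE (le_trans a0). Qed.

Lemma powR_add_le (a b : R) : 0 <= a -> 0 <= b -> (a + b) `^ q <= 2 `^ q * (a `^ q + b `^ q).
Proof.
wlog ab : a b / a <= b => [H a0 b0|a0 b0].
  by have [/H|/ltW/H] := leP a b; [exact|rewrite addrC [_ `^ q + _]addrC; exact].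
apply: (@le_trans _ _ ((2 * b) `^ q)); first by apply: powR_le; [exact: ltW|exact: addr_ge0|lra].
by rewrite powRM// ler_wpM2l ?powR_ge0// lerDr powR_ge0.
Qed.

(** The weights [a] telescope to these powers. The value at 0 is set apart because for q = 1 the
    power of 0 is 1, and the empty sum would not match. *)
Let w m : R := if m is m'.+1 then m%:R `^ (q - 1) else 0.
Let a m := w m.+1 - w m.

Let a_ge0 m : 0 <= a m.
Proof.
rewrite /a subr_ge0; case: m => [|m] /=; first exact: powR_ge0.
by apply: powR_le => //; rewrite ler_nat.
Qed.

Let sum_a N : \sum_(m < N) a m = w N.
Proof.
elim: N => [|N IH]; first by rewrite big_ord0.
by rewrite big_ord_recr /= IH /a addrC subrK.
Qed.

(* The m-th weight makes sum_m a_m (s - m)^+ comparable to s^q. *)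
Definition layers N s : R := \sum_(m < N) a m * Num.max (s - m%:R) 0.

(** A layer at height N contributes only if N < s, and then the weights up to it sum to (N + 1)^(q -
    1), at most (s + 1)^(q - 1). *)
Lemma layers_le N s : 0 <= s -> layers N s <= s * (s + 1) `^ (q - 1).
Proof.
move=> s0; elim: N => [|N IH]; first by rewrite /layers big_ord0 mulr_ge0 ?powR_ge0.
have [sN|Ns] := leP s N%:R.
  by rewrite /layers big_ord_recr /= max_r ?subr_le0// mulr0 addr0.
apply: (@le_trans _ _ (\sum_(m < N.+1) a m * s)).
  apply: ler_sum => m _; rewrite ler_wpM2l// ge_max s0 andbT lerBlDr lerDl.
  exact: ler0n.
rewrite -mulr_suml sum_a mulrC ler_wpM2l//= powR_le//.
by rewrite -natr1; lra.
Qed.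

Lemma layers_ge N s : 0 <= s -> (Num.min s N%:R / 2) `^ q <= layers N s.
Proof.
move=> s0; set s' := Num.min s N%:R.
have s'0 : 0 <= s' by rewrite le_min s0 ler0n.
have s's : s' <= s by rewrite ge_min lexx.
have s'N : s' <= N%:R by rewrite ge_min lexx orbT.
have term_ge0 (m : 'I_N) : 0 <= a m * Num.max (s - m%:R) 0.
  by rewrite mulr_ge0// le_max lexx orbT.
move: (s'0); rewrite le_eqVlt => /orP[/eqP <-|s'p].
  by rewrite mul0r powR0 ?gt_eqF// sumr_ge0.
have h0 : 0 <= s' / 2 by rewrite divr_ge0.
(* Levels m <= M each contribute at least s' / 2, and their weights sum to (M + 1)^(q - 1), at least
   (s' / 2)^(q - 1). *)
have /andP[M1 M2] := truncn_itv h0; set M := Num.truncn (s' / 2) in M1 M2.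
have MN : (M < N)%N by rewrite -(ltr_nat R); lra.
apply: (@le_trans _ _ (\sum_(m < M.+1) a m * Num.max (s - m%:R) 0)); last first.
  rewrite (big_ord_widen N (fun m => a m * Num.max (s - m%:R) 0))// big_mkcond /=.
  by apply: ler_sum => m _; case: ifP.
apply: (@le_trans _ _ (\sum_(m < M.+1) a m * (s' / 2))).
  rewrite -mulr_suml sum_a -(mulr_powRB1 h0 q0) mulrC ler_wpM2r//= powR_le//.
  exact: ltW.
apply: ler_sum => m _; rewrite ler_wpM2l// le_max; apply/orP; left.
have : m%:R <= M%:R :> R by rewrite ler_nat -ltnS.
lra.
Qed.

(** The hypothesis on excesses compares finite layer sums of X and Y. The q-th power of X is not
    known to be integrable, so it is truncated at N first and recovered by monotone convergence. *)
Lemma excess_powR_integral_le d (T : measurableType d) (mu : {measure set T -> \bar R})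
    (D : set T) (X Y g : T -> R) : measurable D ->
  mu.-integrable D (EFin \o X) -> mu.-integrable D (EFin \o Y) ->
  mu.-integrable D (EFin \o g) ->
  (forall x, 0 <= X x) -> (forall x, 0 <= Y x) ->
  (forall m : nat, \int[mu]_(x in D) Num.max (X x - m%:R) 0 <=
                   \int[mu]_(x in D) Num.max (Y x - m%:R) 0) ->
  (forall x, D x -> Y x * (Y x + 1) `^ (q - 1) <= g x) ->
  (\int[mu]_(x in D) ((X x / 2) `^ q)%:E <= (\int[mu]_(x in D) g x)%:E)%E.
Proof.
move=> mD Xi Yi gi X0 Y0 XY Yg.
have ei (Z : T -> R) (m : nat) : (forall x, 0 <= Z x) -> mu.-integrable D (EFin \o Z) ->
    mu.-integrable D (EFin \o (fun x => Num.max (Z x - m%:R) 0)).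
  move=> Z0 Zi; have mZ := integrable_measurableR Zi.
  apply: (integrableR_le mD _ Zi) => [|x _].
    by apply: measurable_maxr => //; exact: measurable_funB.
  by rewrite ger0_norm ?le_max ?lexx ?orbT// ge_max Z0 andbT lerBlDr lerDl.
have li N (Z : T -> R) : (forall x, 0 <= Z x) -> mu.-integrable D (EFin \o Z) ->
    mu.-integrable D (EFin \o (fun x => layers N (Z x))) /\
    \int[mu]_(x in D) layers N (Z x) =
    \sum_(m < N) a m * \int[mu]_(x in D) Num.max (Z x - m%:R) 0.
  move=> Z0 Zi; elim: N => [|N [IH1 IH2]]; rewrite /layers.
    under eq_fun do rewrite big_ord0.
    split; last by rewrite Rintegral_cst// mul0r big_ord0.
    exact: integrable0.
  under eq_fun do rewrite big_ord_recr /=.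
  have Ei := integrableRZ (a N) mD (ei Z N Z0 Zi).
  split; first exact: integrableRD.
  by rewrite RintegralD// RintegralZl ?ei// big_ord_recr /= -IH2.
have mX := integrable_measurableR Xi.
pose h N x := (Num.min (X x) N%:R / 2) `^ q.
have h0 N x : 0 <= h N x by exact: powR_ge0.
have h_le N M x : (N <= M)%N -> h N x <= h M x.
  move=> NM; apply: powR_le; [exact: ltW|by rewrite divr_ge0// le_min X0 ler0n|].
  rewrite ler_pM2r ?invr_gt0// le_min ge_min lexx /= ge_min.
  by rewrite ler_nat NM orbT.
have mh N : measurable_fun D (h N).
  apply: (measurableT_comp (measurable_powR q)); apply: measurable_funM => //.
  exact: measurable_minr.
have hle N : (\int[mu]_(x in D) (h N x)%:E <= (\int[mu]_(x in D) g x)%:E)%E.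
  have [XLi XL] := li N X X0 Xi; have [YLi YL] := li N Y Y0 Yi.
  have hi : mu.-integrable D (EFin \o h N).
    by apply: (integrableR_le mD (mh N) XLi) => x _; rewrite ger0_norm// layers_ge.
  rewrite -(fineK (integrable_fin_num mD hi)) lee_fin.
  apply: (@le_trans _ _ (\int[mu]_(x in D) layers N (X x))).
    by apply: le_Rintegral => // x _; exact: layers_ge.
  apply: (@le_trans _ _ (\int[mu]_(x in D) layers N (Y x))).
    by rewrite XL YL; apply: ler_sum => m _; rewrite ler_wpM2l.
  by apply: le_Rintegral => // x Dx; apply: le_trans (Yg x Dx); exact: layers_le.
have lim_h x : limn (fun N => (h N x)%:E) = ((X x / 2) `^ q)%:E.
  apply/cvg_lim => //; apply: cvg_near_cst; near=> N.
  rewrite /h min_l//; near: N; exact: nbhs_infty_ger.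
under eq_integral do rewrite -lim_h.
rewrite monotone_convergence//.
- apply: lime_le; last by apply: nearW.
  apply: ereal_nondecreasing_is_cvgn => N M NM; apply: ge0_le_integral => //.
  + by move=> x _; rewrite lee_fin.
  + by apply/measurable_EFinP.
  + by apply/measurable_EFinP.
  + by move=> x _; rewrite lee_fin; exact: h_le.
- by move=> N; exact/measurable_EFinP.
- by move=> N x _; rewrite lee_fin.
- move=> x _ N M NM; rewrite lee_fin; exact: h_le.
Unshelve. all: by end_near. Qed.

End layer_cake.

Lemma truncate_excess (R : realType) (k y : R) : 0 < k ->
  `|y - truncate k y| = Num.max (`|y| - k) 0.
Proof.
move=> k0; have [yk|] := ltP `|y| k.
  by rewrite truncate_id// subrr normr0 max_r// subr_le0 ltW.
move=> ky; rewrite max_l ?subr_ge0//; move: ky; rewrite ler_normr => /orP[ky|ky].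
  by rewrite truncate_ge// !ger0_norm ?subr_ge0//; lra.
rewrite truncate_leN//; last lra.
by rewrite !ler0_norm ?subr_le0//; lra.
Qed.

Lemma truncate_dist_le (R : realType) (k y c : R) : `|c| < k ->
  `|truncate k y - c| <= `|y - c|.
Proof.
move=> ck; have k0 := le_lt_trans (normr_ge0 c) ck.
move: (ck); rewrite ltr_norml => /andP[c1 c2].
have [yk|] := ltP `|y| k; first by rewrite truncate_id.
rewrite ler_normr => /orP[ky|ky].
  by rewrite truncate_ge// !ger0_norm; lra.
rewrite truncate_leN//; last lra.
by rewrite !ler0_norm; lra.
Qed.

(** * Convergence to the average in L^1(S) and in L^q(S) *)

Section long_time.
Context (R : realType) (n : nat).
Local Notation mu := (lebesgue_rV R n).
Variables (S : set 'rV[R]_n) (gamma : 'rV[R]_n -> R) (p : R).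
Hypotheses (oS : open S) (Sfin : (mu S < +oo)%E) (p1 : 1 < p)
  (gamma0 : forall x, S x -> 0 < gamma x) (gammaoo : Lq S +oo gamma)
  (gammaL1 : Lq S 1 (fun x => gamma x `^ (1 / (1 - p)))).
Variables (u : 'rV[R]_n -> R) (v : R -> 'rV[R]_n -> R).
Hypothesis sol : strong_solution S gamma p u v.
Hypotheses (cS : connected S) (S0 : S !=set0) (mfu : measurable_fun S u).

Let mS := open_measurable_rV oS.
Let vi t : 0 <= t -> mu.-integrable S (EFin \o v t) := solution_integrable oS sol (t := t).
Let ci := cst_integrable oS Sfin.
Let mv t (t0 : 0 <= t) := integrable_measurableR (vi t0).

Lemma measure_domain_gt0 : 0 < fine (mu S).
Proof.
have [z Sz] := S0; have /nbhs_ballP[r /= r0 rS] := open_nbhs_nbhs (conj oS Sz).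
apply: (lt_le_trans (lebesgue_ball_gt0 z r0)); apply: fine_le.
- by rewrite ge0_fin_numE// lebesgue_ball// ltry.
- by rewrite ge0_fin_numE.
- by apply: le_measure; rewrite ?inE//; exact: measurable_ball_rV.
Qed.

Lemma average_solution t : 0 <= t -> average S (v t) = average S u.
Proof.
move=> t0; rewrite /average (mass_conservation oS Sfin p1 gamma0 gammaoo gammaL1 sol t0).
congr (_ / _); rewrite /Rintegral; congr fine; apply: ae_eq_integral => //.
- by apply/measurable_EFinP; exact: mv (lexx 0).
- exact/measurable_EFinP.
- by case: sol => _ _ _ _; apply: filterS => x H Sx; rewrite /= H.
Qed.

Let excess_le k t : 0 <= k -> 0 <= t ->
  \int[mu]_(x in S) Num.max (`|v t x| - k) 0 <= \int[mu]_(x in S) Num.max (`|v 0 x| - k) 0.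
Proof. by move=> k0 t0; exact: (excess_nonincreasing oS Sfin p1 gamma0 gammaoo gammaL1 sol). Qed.

Let max_integrable k t : 0 <= k -> 0 <= t ->
  mu.-integrable S (EFin \o (fun x => Num.max (`|v t x| - k) 0)).
Proof.
move=> k0 t0; have mvt := mv t0.
apply: (integrableR_le mS _ (integrable_norm (vi t0))) => [|x _].
  by apply: measurable_maxr => //; apply: measurable_funB => //; exact: measurableT_comp.
rewrite ger0_norm ?le_max ?lexx ?orbT// ge_max /= normr_ge0 andbT lerBlDr lerDl.
exact: k0.
Qed.

(* Along times of vanishing energy the gradients of the truncations vanish in L^1(S),
   so that connected_poincare applies. *)
Lemma truncation_near_cst k eps : 0 < k -> 0 < eps -> exists t c, [/\ 0 < t, `|c| <= k &
  \int[mu]_(x in S) `|truncate k (v t x) - c| <= eps].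
Proof.
move=> k0 eps0.
have /choice[tw Htw] : forall m : nat, exists tw : R * ('rV[R]_n -> R), [/\ 0 < tw.1,
    calA S gamma p (v tw.1) (\- tw.2) &
    \int[mu]_(x in S) energy_density gamma p (weak_gradient S (truncate k \o v tw.1)) x < m.+1%:R^-1].
  move=> m; have m0 : 0 < m.+1%:R^-1 :> R by rewrite invr_gt0.
  have [t [w H]] := small_energy_time oS Sfin p1 gamma0 gammaoo gammaL1 sol k0 m0.
  by exists (t, w).
pose t m := (tw m).1; pose W m := weak_gradient S (truncate k \o v (t m)).
have t0 m : 0 < t m by have [] := Htw m.
have vA m : calA S gamma p (v (t m)) (\- (tw m).2) by have [] := Htw m.
have We m : \int[mu]_(x in S) energy_density gamma p (W m) x < m.+1%:R^-1 by have [] := Htw m.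
have Wi m i : mu.-integrable S (EFin \o (fun x => W m x ord0 i)).
  exact: (calA_integrable oS p1 gamma0 gammaoo gammaL1 (vA m) i k0).
have Wp m : W1p S gamma p (truncate k \o v (t m)) by have [_ _ /(_ k k0)] := vA m.
have mtr m : measurable_fun S (truncate k \o v (t m)).
  exact: (measurableT_comp (measurable_truncate k0) (mv (ltW (t0 m)))).
have tri m : mu.-integrable S (EFin \o (truncate k \o v (t m))).
  by apply: (bounded_integrable (k := k)) => // x _; exact: truncate_le.
pose F m := (truncate k \o v (t m)) \_ S.
pose G m i := (fun x => W m x ord0 i) \_ S.
have Fi m : mu.-integrable setT (EFin \o F m).
  by rewrite -restrict_EFin; apply/(integrable_mkcond _ mS).
have Gi m i : mu.-integrable setT (EFin \o G m i).
  by rewrite -restrict_EFin; apply/(integrable_mkcond _ mS).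
have FG m i : weak_partial S i (F m) (G m i).
  have [_ dW _] := Wp m.
  exact: ((is_weak_gradientP mS (tri m) (Wi m)).1 (weak_gradientP dW) i).
have Fk m x : `|F m x| <= k.
  by rewrite /F patchE; case: ifP => _; [exact: truncate_le|rewrite normr0 ltW].
have GE m i : \int[mu]_x `|G m i x| = \int[mu]_(x in S) `|W m x ord0 i|.
  rewrite [RHS]Rintegral_mkcond; apply: eq_Rintegral => x _.
  by rewrite /G !patchE; case: ifP; rewrite ?normr0.
have G0 i : \int[mu]_x `|G m i x| @[m --> \oo] --> 0.
  apply/cvgrPdist_le => e e0.
  set Ga := \int[mu]_(x in S) (gamma x `^ (1 / (1 - p))).
  have Ga0 : 0 <= Ga by apply: Rintegral_ge0 => x _; exact: powR_ge0.
  (* Fixed first, so that the weight term of Young's inequality is at most e / 2 for all m; the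
     energy term, with its now fixed factor, is small for m large. *)
  pose eta := e / 2 / (Ga + 1).
  have Ga1 : 0 < Ga + 1 by rewrite ltr_wpDl.
  have eta0 : 0 < eta by rewrite !divr_gt0.
  have etaG : eta * Ga <= e / 2.
    rewrite /eta mulrAC ler_pdivrMr// ler_wpM2l//; [by rewrite divr_ge0// ltW|lra].
  have K0 : 0 < eta `^ (1 - p) by exact: powR_gt0.
  have e2 : 0 < e / 2 / eta `^ (1 - p) by rewrite !divr_gt0.
  have /cvgrPdist_le/(_ _ e2) := @cvg_harmonic R; apply: filterS => m.
  rewrite !sub0r !normrN GE => Hm; rewrite ger0_norm; last exact: Rintegral_ge0.
  have [_ _ Lp] := Wp m.
  apply: (le_trans (Rintegral_coord_le oS p1 gamma0 gammaoo gammaL1 i eta0 Lp)).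
  have : eta `^ (1 - p) * \int[mu]_(x in S) energy_density gamma p (W m) x <= e / 2.
    rewrite mulrC -ler_pdivlMr//; apply: (le_trans (ltW (We m))).
    by apply: le_trans Hm; exact: ler_norm.
  rewrite -/Ga; lra.
have [c ck Hc] := connected_poincare oS cS S0 Sfin Fi Gi FG Fk G0.
have /cvgrPdist_le/(_ _ eps0)[m _ /(_ m (leqnn m))] := Hc.
rewrite sub0r normrN => Hm; exists (t m), (c m); split => //.
apply: le_trans (le_trans (ler_norm _) Hm); rewrite Rintegral_mkcond.
rewrite le_eqVlt; apply/orP; left; apply/eqP; apply: eq_Rintegral => x _.
by rewrite /F !patchE indicE; case: ifP; rewrite ?mulr1 ?mulr0.
Qed.

Let M := average S u.

Lemma L1_limit eps : 0 < eps -> exists t0, 0 < t0 /\ forall t, t0 <= t ->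
  \int[mu]_(x in S) `|v t x - M| <= eps.
Proof.
move=> eps0; have e4 : 0 < eps / 4 by rewrite divr_gt0.
have [c [c0 tci Hc]] := small_tail mS (vi (lexx 0)) e4.
(* Above c the excess over k is dominated by the tail at c; adding 1 keeps k positive. *)
pose k := c + 1; have k0 : 0 < k by rewrite ltr_wpDl.
have [t0 [d [t00 dk Hd]]] := truncation_near_cst k0 e4.
exists t0; split => // t tt0.
apply: (le_trans (L1_dist_cst_nonincreasing oS Sfin p1 gamma0 gammaoo gammaL1 sol M (ltW t00) tt0)).
have t0i := vi (ltW t00); have mvt := mv (ltW t00).
have Ei := max_integrable (ltW k0) (ltW t00).
have E1 : \int[mu]_(x in S) Num.max (`|v t0 x| - k) 0 <= eps / 4.
  apply: (le_trans (excess_le (ltW k0) (ltW t00))); apply: le_trans Hc.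
  apply: le_Rintegral => //; first exact: max_integrable (ltW k0) (lexx 0).
  move=> x _; rewrite ge_max tail_ge0 andbT /tail /k.
  by case: ltP => cv; rewrite ?mulr1 ?mulr0; lra.
have tri : mu.-integrable S (EFin \o (fun x => `|truncate k (v t0 x) - d|)).
  apply: integrable_norm; apply: (integrableRB mS _ (ci d)).
  apply: (bounded_integrable (k := k)) => //; last by move=> x _; exact: truncate_le.
  exact: (measurableT_comp (measurable_truncate k0)).
have E2 : \int[mu]_(x in S) `|v t0 x - d| <= eps / 2.
  apply: (@le_trans _ _ (\int[mu]_(x in S) (Num.max (`|v t0 x| - k) 0 + `|truncate k (v t0 x) - d|))).
    apply: le_Rintegral => //; [exact/integrable_norm/integrableRB|exact: integrableRD|].
    move=> x _; apply: (@le_trans _ _ (`|v t0 x - truncate k (v t0 x)| + `|truncate k (v t0 x) - d|)).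
      by apply: le_trans (ler_normD _ _); rewrite addrA subrK.
    by rewrite lerD2r truncate_excess.
  by rewrite RintegralD//; lra.
have m0 := measure_domain_gt0.
(* The constant d is forced close to the average, because the average of v t0 is still M and
   averaging does not increase the L^1 distance to d. *)
have E3 : `|M - d| * fine (mu S) <= eps / 2.
  rewrite -[X in _ * X](gtr0_norm m0) -normrM mulrBl /M -(average_solution (ltW t00)) /average divfK ?gt_eqF//.
  rewrite -Rintegral_cst// -RintegralB//.
  apply: le_trans E2; apply: le_normr_Rintegral => //; exact: integrableRB.
apply: (@le_trans _ _ (\int[mu]_(x in S) (`|v t0 x - d| + `|M - d|))).
  apply: le_Rintegral => //.
  - by apply: integrable_norm; exact: integrableRB.
  - by apply: integrableRD => //; apply: integrable_norm; exact: integrableRB.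
  - move=> x _; apply: le_trans (ler_normB _ _).
    by rewrite (_ : v t0 x - d - (M - d) = v t0 x - M)//; ring.
rewrite RintegralD//; last by apply: integrable_norm; exact: integrableRB.
by rewrite Rintegral_cst//; lra.
Qed.

Section Lq_limit.
Variable q : R.
Hypotheses (q1 : 1 <= q) (uq : Lq S q%:E u).

Let q0 : 0 < q. Proof. exact: lt_le_trans q1. Qed.

Let v0q : mu.-integrable S (EFin \o (fun x => `|v 0 x| `^ q)).
Proof.
have mv0 := mv (lexx 0).
have mpow (f : 'rV[R]_n -> R) : measurable_fun S f -> measurable_fun S (fun x => `|f x| `^ q).
  by move=> mf; apply: (measurableT_comp (measurable_powR q)); exact: measurableT_comp.
apply/integrableP; split; first by apply/measurable_EFinP; exact: mpow mv0.
have [_] := (LqP mS u q0).1 uq; congr (_ < _)%E; apply: ae_eq_integral => //.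
- by apply/measurable_EFinP; exact: mpow (Lq_measurable mS uq).
- by apply: measurableT_comp => //; apply/measurable_EFinP; exact: mpow mv0.
- case: sol => _ _ _ _; apply: filterS => x H Sx /=.
  by rewrite [in RHS]ger0_norm ?powR_ge0// H.
Qed.

Let excess k t x := Num.max (`|v t x| - k) 0.

(** Uniform integrability of the q-th powers: the excess of the excess over k at level m is the
    excess over k + m, so monotonicity of all excesses feeds [excess_powR_integral_le], with the
    initial value as comparison. *)
Let excess_powR_small eps : 0 < eps -> exists2 k, `|M| < k & forall t, 0 <= t ->
  (\int[mu]_(x in S) (excess k t x `^ q)%:E <= eps%:E)%E.
Proof.
move=> eps0; have K0 : 0 < 2 `^ q :> R by exact: powR_gt0.
have eK : 0 < eps / 2 `^ q by rewrite divr_gt0.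
have [c [c0 tci Hc]] := small_tail mS v0q eK.
have M0 := normr_ge0 M.
(* Where the excess at time 0 is positive, |v 0| exceeds c + 1 >= 1, so its q-th power exceeds c and
   lies in the tail, and the excess plus 1 is at most |v 0|. The summand |M| serves
   [truncate_dist_le]. *)
exists (c + 1 + `|M|) => [|t t0]; first by rewrite ltrDr ltr_wpDl.
set k := c + 1 + `|M|; have k0 : 0 <= k by rewrite !addr_ge0.
have Xi := max_integrable k0 t0; have Yi := max_integrable k0 (lexx 0).
have := excess_powR_integral_le q1 mS Xi Yi tci.
have shiftE r (m : nat) : (fun x => Num.max (Num.max (`|v r x| - k) 0 - m%:R) 0) =
    (fun x => Num.max (`|v r x| - (k + m%:R)) 0).
  apply/funext => x; have m0 : 0 <= m%:R :> R by exact: ler0n.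
  have [h|h] := leP (`|v r x| - k) 0.
    by rewrite !max_r//; lra.
  by congr Num.max; lra.
have X0 r x : 0 <= Num.max (`|v r x| - k) 0 by rewrite le_max lexx orbT.
move=> /(_ (X0 t) (X0 0)) H.
have {}H : (\int[mu]_(x in S) ((excess k t x / 2) `^ q)%:E <=
    (\int[mu]_(x in S) tail (fun x => (`|v 0 x| `^ q)) c x)%:E)%E.
  apply: H => [m|x _].
    by rewrite !shiftE; apply: excess_le => //; rewrite addr_ge0.
  have [h|h] := leP (`|v 0 x| - k) 0; first by rewrite mul0r tail_ge0.
  have y1 : 1 <= `|v 0 x| by rewrite /k in h; lra.
  have yq : `|v 0 x| <= `|v 0 x| `^ q by exact: le1r_powR.
  rewrite /tail (ger0_norm (powR_ge0 _ _)) (_ : c < _); last first.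
    by apply: lt_le_trans yq; rewrite /k in h; lra.
  rewrite mulr1 -(mulr_powRB1 (normr_ge0 _) q0); apply: ler_pM.
  - exact: ltW.
  - exact: powR_ge0.
  - by rewrite lerBlDr lerDl.
  - by apply: powR_le; [rewrite subr_ge0|lra|rewrite /k; lra].
have mX : measurable_fun S (fun x => (excess k t x / 2) `^ q).
  apply: (measurableT_comp (measurable_powR q)); apply: measurable_funM => //.
  exact: integrable_measurableR Xi.
rewrite (eq_integral (fun x => (2 `^ q)%:E * ((excess k t x / 2) `^ q)%:E)%E); last first.
  move=> x _; rewrite -EFinM -powRM ?divr_ge0//; last exact: X0.
  by congr ((_ `^ _)%:E); field.
rewrite ge0_integralZl//; last 2 first.
- exact/measurable_EFinP.
- by move=> x _; rewrite lee_fin powR_ge0.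
apply: (@le_trans _ _ ((2 `^ q)%:E * (eps / 2 `^ q)%:E)%E); last first.
  by rewrite -EFinM lee_fin mulrC divfK ?gt_eqF.
by rewrite lee_pmul2l//; apply: (le_trans H); rewrite lee_fin.
Qed.

Let powR_integral_le k t (f A : 'rV[R]_n -> R) eps : 0 <= k -> 0 <= t -> measurable_fun S f ->
  mu.-integrable S (EFin \o A) -> (forall x, 0 <= A x) ->
  (forall x, S x -> `|f x| `^ q <= 2 `^ q * (A x + excess k t x `^ q)) ->
  (\int[mu]_(x in S) (excess k t x `^ q)%:E <= eps%:E)%E ->
  (\int[mu]_(x in S) (`|f x| `^ q)%:E <= (2 `^ q * (\int[mu]_(x in S) A x + eps))%:E)%E.
Proof.
move=> k0 t0 mf Ai A0 fA He.
have mX : measurable_fun S (fun x => excess k t x `^ q).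
  apply: (measurableT_comp (measurable_powR q)).
  exact: integrable_measurableR (max_integrable k0 t0).
have mA := integrable_measurableR Ai.
have mAX := measurable_funD mA mX.
apply: (@le_trans _ _ (\int[mu]_(x in S) ((2 `^ q)%:E * (A x + excess k t x `^ q)%:E)%E)%E).
  apply: ge0_le_integral => //.
  - apply/measurable_EFinP; apply: (measurableT_comp (measurable_powR q)).
    exact: measurableT_comp.
  - by apply/measurable_EFinP; exact: measurable_funM.
rewrite ge0_integralZl//; last 2 first.
- exact/measurable_EFinP.
- by move=> x _; rewrite lee_fin addr_ge0 ?powR_ge0.
rewrite EFinM lee_pmul2l ?lte_fin ?powR_gt0//.
under eq_integral do rewrite EFinD.
rewrite ge0_integralD//; first last.
- exact/measurable_EFinP.
- by move=> x _; rewrite lee_fin powR_ge0.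
- exact/measurable_EFinP.
- by move=> x _; rewrite lee_fin.
rewrite EFinD leeD// /Rintegral fineK//.
exact: (integrable_fin_num mS Ai).
Qed.

Let norm_le_excess k t x : `|v t x| <= k + excess k t x.
Proof. by rewrite -lerBlDl le_max lexx. Qed.

Lemma solution_Lq t : 0 <= t -> Lq S q%:E (v t).
Proof.
move=> t0; apply/(LqP mS _ q0); split; first exact: mv.
have [k Mk Hk] := excess_powR_small ltr01.
have k0 := le_trans (normr_ge0 M) (ltW Mk).
have := @powR_integral_le k t (v t) (fun=> k `^ q) 1 k0 t0 (mv t0) (ci _).
move=> H; apply: le_lt_trans (H _ _ (Hk t t0)) (ltry _) => [x|x _]; first exact: powR_ge0.
apply: le_trans (powR_add_le q1 _ _); rewrite ?le_max ?lexx ?orbT//.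
by apply: powR_le => //; exact: ltW.
Qed.

(** Splits v t - M at height k: the truncated part is bounded by k + |M|, so its q-th power is a
    bounded factor times an L^1 distance, to which [L1_limit] applies; the rest is the excess. *)
Let dist_powR_le k t x : `|M| < k ->
  `|v t x - M| `^ q <= 2 `^ q * ((k + `|M|) `^ (q - 1) * `|v t x - M| + excess k t x `^ q).
Proof.
move=> Mk; have k0 := le_lt_trans (normr_ge0 M) Mk.
have q10 : 0 <= q - 1 by rewrite subr_ge0.
apply: (@le_trans _ _ ((`|truncate k (v t x) - M| + excess k t x) `^ q)).
  apply: powR_le => //; first exact: ltW.
  rewrite /excess -truncate_excess// [X in _ <= X]addrC; apply: le_trans (ler_normD _ _).
  by rewrite addrA subrK.
apply: (le_trans (powR_add_le q1 _ _)); rewrite ?le_max ?lexx ?orbT//.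
rewrite ler_wpM2l ?powR_ge0// lerD2r -(mulr_powRB1 (normr_ge0 _) q0) mulrC.
apply: ler_pM; [exact: powR_ge0|exact: normr_ge0| |exact: truncate_dist_le].
apply: powR_le => //; apply: (le_trans (ler_normB _ _)).
by rewrite lerD2r truncate_le.
Qed.

Lemma Lq_limit : Lq_norm S q%:E (fun x => v t x - M) @[t --> +oo] --> 0%E.
Proof.
have norm_small e : 0 < e -> \forall t \near +oo, (0 <= Lq_norm S q%:E (fun x => (v t x - M)%R) <= e%:E)%E.
  (* The distance part and the excess part will each be at most a, and 2^q (a + a) = e^q. *)
  move=> e0; pose a := e `^ q / 2 `^ q / 2.
  have a0 : 0 < a by rewrite !divr_gt0// powR_gt0.
  have [k Mk Hk] := excess_powR_small a0.
  have k0 := le_lt_trans (normr_ge0 M) Mk.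
  pose b := (k + `|M|) `^ (q - 1).
  have b0 : 0 < b by rewrite powR_gt0// ltr_wpDr.
  have ab0 : 0 < a / b by rewrite divr_gt0.
  have [t0 [t00 Ht0]] := L1_limit ab0.
  exists t0; split; first exact: num_real.
  move=> t /ltW t0t; have t1 := le_trans (ltW t00) t0t.
  have di : mu.-integrable S (EFin \o (fun x => v t x - M)) := integrableRB mS (vi t1) (ci M).
  have Ni := integrable_norm di.
  rewrite Lq_normE// poweR_ge0 /=.
  have : (\int[mu]_(x in S) (`|v t x - M| `^ q)%:E <= (e `^ q)%:E)%E.
    have := @powR_integral_le k t (fun x => v t x - M) (fun x => b * `|v t x - M|) a (ltW k0) t1
      (integrable_measurableR di) (integrableRZ b mS Ni).
    move=> H; apply: le_trans (H _ _ (Hk t t1)) _ => [x|x _|].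
    - by rewrite mulr_ge0// ltW.
    - exact: dist_powR_le.
    rewrite lee_fin RintegralZl// [X in X <= _]mulrC -ler_pdivlMr ?powR_gt0//.
    have H1 : b * \int[mu]_(x in S) `|v t x - M| <= a by rewrite mulrC -ler_pdivlMr// Ht0.
    by rewrite (_ : _ / _ = a + a) ?lerD2r// /a; lra.
  set I := (\int[mu]_(x in S) _)%E => HI.
  apply: (@le_trans _ _ ((e `^ q)%:E `^ q^-1)%E).
    apply: gt0_ler_poweR => //; first by rewrite invr_ge0 ltW.
    - by rewrite in_itv/= leey andbT; apply: integral_ge0 => x _; rewrite lee_fin powR_ge0.
    - by rewrite in_itv/= leey andbT lee_fin powR_ge0.
  by rewrite poweR_EFin -powRrM mulfV ?gt_eqF// powRr1// ltW.
apply/fine_cvgP; split.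
  apply: filterS (norm_small 1 ltr01) => t /andP[H0 H1].
  by rewrite ge0_fin_numE// (le_lt_trans H1)// ltry.
apply/cvgrPdist_le => e e0; apply: filterS (norm_small e e0) => t /andP[H0 H1].
rewrite sub0r normrN /= ger0_norm ?fine_ge0//.
by rewrite -lee_fin fineK// ge0_fin_numE// (le_lt_trans H1)// ltry.
Qed.

End Lq_limit.
End long_time.

Theorem theorem4p12 (R : realType) (n : nat) (S : set 'rV[R]_n) (p : R)
    (gamma : 'rV[R]_n -> R) (T : R -> ('rV[R]_n -> R) -> 'rV[R]_n -> R)
    (n_ge2 : (2 <= n)%N)
    (S_nonempty : S !=set0) (S_open : open S) (S_connected : connected S)
    (S_bounded : bounded_set S) (S_C1 : C1_boundary S)
    (p_gt1 : 1 < p) (p_neq2 : p != 2)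
    (gamma_gt0 : forall x, S x -> 0 < gamma x)
    (gamma_Loo : Lq S +oo gamma)
    (gamma_L1 : Lq S 1 (fun x => gamma x `^ (1 / (1 - p))))
    (gamma_Ap : exists2 gamma0, A_p p gamma0 &
       {ae lebesgue_rV R n, forall x, S x -> gamma0 x = gamma x})
    (T_semigroup : is_semigroup S gamma p T)
    (q : R) (q_ge1 : 1 <= q) (u : 'rV[R]_n -> R) (u_Lq : Lq S q%:E u) :
  (forall t, 0 <= t -> Lq S q%:E (T t u)) /\
  Lq_norm S q%:E (fun x => T t u x - average S u) @[t --> +oo] --> 0%E.
Proof.
have mS := open_measurable_rV S_open.
have Sfin := bounded_set_lebesgue_lty S_bounded S_open.
have q0 : 0 < q := lt_le_trans ltr01 q_ge1.
(* The semigroup is specified on L^1(S); S has finite measure and |u| <= 1 + |u|^q. *)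
have u_L1 : Lq S 1 u.
  have [mu uq] := (LqP mS u q0).1 u_Lq.
  have mpow : measurable_fun S (fun x => `|u x| `^ q).
    by apply: (measurableT_comp (measurable_powR q)); exact: measurableT_comp.
  have pi : (lebesgue_rV R n).-integrable S (EFin \o (fun x => `|u x| `^ q)).
    apply/integrableP; split; first exact/measurable_EFinP.
    move: uq; congr (_ < _)%E; apply: eq_integral => x _ /=.
    by rewrite [in RHS]ger0_norm ?powR_ge0.
  apply/(Lq1P mS); apply: (integrableR_le mS mu (integrableRD mS (cst_integrable S_open Sfin 1) pi)) => x _.
  have [u1|/ltW u1] := leP `|u x| 1; first by rewrite (le_trans u1)// lerDl powR_ge0.
  by rewrite (le_trans (le1r_powR u1 q_ge1))// lerDr.
have sol := T_semigroup u u_L1; have mu := Lq_measurable mS u_L1.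
split.
  exact: (solution_Lq S_open Sfin p_gt1 gamma_gt0 gamma_Loo gamma_L1 sol q_ge1 u_Lq).
exact: (Lq_limit S_open Sfin p_gt1 gamma_gt0 gamma_Loo gamma_L1 sol S_connected S_nonempty mu q_ge1 u_Lq).
Qed.
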